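(* Let $p\ge 2$ and let $I$ be an interval. There is an open dense subset $\mathcal U\subset C^\infty(I,\mathbf R\times S^p)$ such that the following holds for every frontal curve $f:I\to\mathbf R^{1+p}$ with $f'(t)=a(t)\tau(t)$, $(a,\tau)\in\mathcal U$ (i.e. for a generic frontal curve $f$). The curve $f$ has no inflection point. Let $\{\nu_1,\dots,\nu_{p-1}\}$ be a normally parallel orthonormal frame along $\mathrm{Tan}(f)$, and let $\nu=\sum_{i=1}^{p-1}R_i\nu_i$ be a generic normally parallel normal field, i.e. $R=(R_1,\dots,R_{p-1})$ is taken in a suitable residual subset of $\mathbf R^{p-1}$ depending on $f$. For $r\in\mathbf R$ let $g_r:I\to\mathbf R^{1+p}$ be the directrix of the parallel $\mathrm{Tan}(f)+r\nu:I\times\mathbf R\to\mathbf R^{1+p}$. Then for every $(t,r)\in I\times\mathbf R$ the type of $g_r$ at $t$ is one of the following: $$ \begin{array}{|c|c|} \hline \text{type} & \text{codimension}\\ \hline (1,2,\dots,p,1+p) & 0\\ (1,2,\dots,p,2+p) & 1\\ (2,3,\dots,1+p,2+p) & 1\\ (2,3,\dots,1+p,3+p) & 2\\ (3,4,\dots,2+p,3+p) & 2\\ \hline \end{array} $$ where the number in the second column is the codimension in the $(t,r)$-plane $I\times\mathbf R$ of the locus of points $(t,r)$ at which $g_r$ has the given type at $t$.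
   Context: All maps are $C^\infty$. $S^p\subset\mathbf R^{1+p}$ is the unit sphere; $C^\infty(I,\mathbf R\times S^p)$ carries the Whitney $C^\infty$ topology. A frontal curve is a map $f:I\to\mathbf R^{1+p}$ for which there are smooth $\tau:I\to S^p$ and $a:I\to\mathbf R$ with $f'(t)=a(t)\tau(t)$. A point $t$ is an inflection point of $f$ if $\tau'(t)=0$. The tangent surface of $f$ is $\mathrm{Tan}(f)(t,s)=f(t)+s\tau(t)$, $(t,s)\in I\times\mathbf R$. Type: for a curve $h:I\to\mathbf R^{1+p}$ let $W_k(h)(t)=(h'(t),h''(t),\dots,h^{(k)}(t))$, a $(1+p)\times k$ matrix. For a strictly increasing sequence of positive integers $a_1<\dots<a_{1+p}$, $h$ is of type $(a_1,\dots,a_{1+p})$ at $t$ if $a_i=\min\{k\mid \mathrm{rank}\,W_k(h)(t)=i\}$ for $i=1,\dots,1+p$. Frames: suppose $f$ has no inflection point. Let $\mu(t)$ be a unit vector field with $\mu\cdot\tau=0$ such that $\tau'(t)=\kappa(t)\mu(t)$, with $\kappa$ nowhere zero; the tangent bundle of $\mathrm{Tan}(f)$ at $(t,s)$ is spanned by $\tau(t),\mu(t)$, and the normal bundle is its orthogonal complement. A normally parallel orthonormal frame is an orthonormal frame $\nu_1(t),\dots,\nu_{p-1}(t)$ of this normal bundle (extended to be independent of $s$) such that each derivative $\nu_i'(t)$ lies in the span of $\tau(t),\mu(t)$. The torsion functions $\ell_i$ are defined by $\mu'=-\kappa\tau+\sum_{i=1}^{p-1}\ell_i\nu_i$. A normally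 parallel normal field is $\nu=\sum_iR_i\nu_i$ with constants $R_i$. The parallel is $(\mathrm{Tan}(f)+r\nu)(t,s)=f(t)+s\tau(t)+r\nu(t)$. Its directrix is the frontal curve $$g_r(t)=f(t)+r\sum_{i=1}^{p-1}R_i\Big(\frac{\ell_i(t)}{\kappa(t)}\tau(t)+\nu_i(t)\Big),$$ which has tangential frame $\tau$ and whose tangent surface $(t,s)\mapsto g_r(t)+s\tau(t)$ equals the parallel after the reparametrization of the form $(t,s)\mapsto(t,s+c(t))$. A locus may be empty for a particular $f$. *)

(* Defs.v *)
From HB Require Import structures.
From mathcomp Require Import all_boot all_order all_algebra.
From mathcomp Require Import all_classical all_reals all_analysis.

Set Implicit Arguments.
Unset Strict Implicit.
Unset Printing Implicit Defensive.

Import Order.TTheory GRing.Theory Num.Theory.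
Import numFieldNormedType.Exports.

Local Open Scope classical_set_scope.
Local Open Scope ring_scope.

Section Smoothness.
Context {R : realType} {V : normedModType R}.

(* All curves are total functions on R of which only the values on the interval
   I matter; derivatives are taken inside I, hence are one-sided at an endpoint
   of I that belongs to I. *)
Definition diff_quotient (g : R -> V) (t s : R) : V :=
  (s - t)^-1 *: (g s - g t).

Definition derivable_in (I : set R) (g : R -> V) (t : R) : Prop :=
  cvg (diff_quotient g t @ within I t^').

Definition derive_in (I : set R) (g : R -> V) (t : R) : V :=
  lim (diff_quotient g t @ within I t^').

Definition deriven_in (I : set R) (n : nat) (g : R -> V) : R -> V :=
  iter n (derive_in I) g.

Definition smooth_on (I : set R) (g : R -> V) : Prop :=
  forall n t, I t -> derivable_in I (deriven_in I n g) t.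

End Smoothness.

Definition dot {R : realType} {n : nat} (u v : 'rV[R]_n) : R :=
  \sum_(i < n) u 0 i * v 0 i.

Section WhitneyTopology.
Variables (R : realType) (p : nat) (I : set R).

(* Elements of C^oo(I, R x S^p). Two records that agree on I represent the same
   map; they are topologically indistinguishable below. *)
Record smooth_RxS := SmoothRxS {
  sm_a : R -> R;
  sm_tau : R -> 'rV[R]_p.+1;
  sm_a_smooth : smooth_on I sm_a;
  sm_tau_smooth : smooth_on I sm_tau;
  sm_tau_sphere : forall t, I t -> dot (sm_tau t) (sm_tau t) = 1
}.

Definition jet (k : nat) (x : smooth_RxS) (t : R) :
    R * ('cV[R]_k.+1 * 'M[R]_(k.+1, p.+1)) :=
  (t, (\col_(j < k.+1) deriven_in I j (sm_a x) t,
       \matrix_(j < k.+1, i < p.+1) deriven_in I j (sm_tau x) t 0 i)).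

(* The sets {x | j^k x (I) is contained in O}, O open. Since R x S^p is embedded
   in R x R^(1+p), J^k(I, R x S^p) is topologized as a subspace of the space of
   jets with values in the ambient vector space. *)
Definition whitney_base : set (set smooth_RxS) :=
  [set W | exists k (O : set (R * ('cV[R]_k.+1 * 'M[R]_(k.+1, p.+1)))),
     open O /\ W = [set x | forall t, I t -> O (jet k x t)]].

HB.instance Definition _ := gen_eqMixin smooth_RxS.
HB.instance Definition _ := gen_choiceMixin smooth_RxS.
HB.instance Definition _ :=
  isSubBaseTopological.Build smooth_RxS whitney_base id.

End WhitneyTopology.

Section Curves.
Variables (R : realType) (p : nat) (I : set R).
Implicit Types (f h tau mu : R -> 'rV[R]_p.+1) (a kappa : R -> R).

Definition frontal f a tau : Prop :=
  smooth_on I f /\ forall t, I t -> derive_in I f t = a t *: tau t.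

Definition inflection tau (t : R) : Prop := I t /\ derive_in I tau t = 0.

Definition W h (k : nat) (t : R) : 'M[R]_(p.+1, k) :=
  \matrix_(i < p.+1, j < k) deriven_in I j.+1 h t 0 i.

(* The sequence a_1 < ... < a_(1+p) is 0-indexed here. *)
Definition has_type h (t : R) (s : seq nat) : Prop :=
  [/\ size s = p.+1, path ltn 0 s &
      forall i, (i < p.+1)%N ->
        \rank (W h (nth 0%N s i) t) = i.+1 /\
        forall k, \rank (W h k t) = i.+1 -> (nth 0%N s i <= k)%N].

Definition principal_normal tau mu kappa : Prop :=
  [/\ smooth_on I mu, smooth_on I kappa &
      forall t, I t ->
        [/\ dot (mu t) (mu t) = 1, dot (mu t) (tau t) = 0,
            derive_in I tau t = kappa t *: mu t & kappa t != 0]].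

Definition normally_parallel_frame tau mu
    (nu : 'I_p.-1 -> R -> 'rV[R]_p.+1) : Prop :=
  (forall i, smooth_on I (nu i)) /\
  forall t, I t ->
    [/\ forall i j, dot (nu i t) (nu j t) = (i == j)%:R,
        forall i, dot (nu i t) (tau t) = 0 /\ dot (nu i t) (mu t) = 0 &
        forall i, exists c d, derive_in I (nu i) t = c *: tau t + d *: mu t].

Definition torsion tau mu kappa (nu : 'I_p.-1 -> R -> 'rV[R]_p.+1)
    (ell : 'I_p.-1 -> R -> R) : Prop :=
  forall t, I t ->
    derive_in I mu t = - kappa t *: tau t + \sum_i ell i t *: nu i t.

Definition tangent_surface f tau (t s : R) : 'rV[R]_p.+1 := f t + s *: tau t.

Definition normal_field (nu : 'I_p.-1 -> R -> 'rV[R]_p.+1)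
    (c : 'rV[R]_p.-1) (t : R) : 'rV[R]_p.+1 := \sum_i c 0 i *: nu i t.

Definition parallel f tau nu (c : 'rV[R]_p.-1) (r t s : R) : 'rV[R]_p.+1 :=
  tangent_surface f tau t s + r *: normal_field nu c t.

Definition directrix f tau kappa (nu : 'I_p.-1 -> R -> 'rV[R]_p.+1)
    (ell : 'I_p.-1 -> R -> R) (c : 'rV[R]_p.-1) (r t : R) : 'rV[R]_p.+1 :=
  f t + r *: \sum_i c 0 i *: ((ell i t / kappa t) *: tau t + nu i t).

Lemma parallelE f tau kappa nu ell c r t s :
  parallel f tau nu c r t s =
  tangent_surface (directrix f tau kappa nu ell c r) tau t
    (s - r * \sum_i c 0 i * (ell i t / kappa t)).
Proof.
rewrite /parallel /tangent_surface /directrix /normal_field.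
under [in RHS]eq_bigr do rewrite scalerDr scalerA.
rewrite big_split /= -scaler_suml scalerDr scalerA scalerBl.
set x := f t; set y := s *: _; set z := r *: _; set w := _ *: tau t.
by rewrite [y - w]addrC !addrA [x + w + z]addrAC addrK [RHS]addrAC.
Qed.

End Curves.

Definition residual {T : topologicalType} (A : set T) : Prop :=
  exists G : nat -> set T,
    (forall n, open (G n) /\ dense (G n)) /\ \bigcap_n G n `<=` A.

(* L is a (possibly empty) embedded submanifold of codimension k of I x R:
   around each of its points it is, in a box, the graph of a smooth function of
   2 - k of the two coordinates. *)
Definition has_codim {R : realType} (I : set R) (k : nat) (L : set (R * R)) :
    Prop :=
  forall t0 r0, L (t0, r0) -> I t0 /\
    exists A B : set R,
      [/\ open A, open B, A t0, B r0 &
        match k with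
        | 0%N => L `&` (A `*` B) = (I `&` A) `*` B
        | 1%N =>
          (exists phi : R -> R,
             [/\ smooth_on (I `&` A) phi, forall t, (I `&` A) t -> B (phi t) &
                 L `&` (A `*` B) = [set (t, phi t) | t in I `&` A]]) \/
          (exists phi : R -> R,
             [/\ smooth_on B phi, forall r, B r -> (I `&` A) (phi r) &
                 L `&` (A `*` B) = [set (phi r, r) | r in B]])
        | 2%N => L `&` (A `*` B) = [set (t0, r0)]
        | _ => False
        end].

Definition type_table (p : nat) : seq (seq nat * nat) :=
  [:: (rcons (iota 1 p) (1 + p)%N, 0%N);
      (rcons (iota 1 p) (2 + p)%N, 1%N);
      (rcons (iota 2 p) (2 + p)%N, 1%N);
      (rcons (iota 2 p) (3 + p)%N, 2%N);
      (rcons (iota 3 p) (3 + p)%N, 2%N)].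

(* Main.v *)
Require Import Defs.
From HB Require Import structures.
From mathcomp Require Import all_boot all_order all_algebra all_fingroup.
From mathcomp Require Import all_classical all_reals all_analysis.
From mathcomp Require Import ring lra zify.

Set Implicit Arguments.
Unset Strict Implicit.
Unset Printing Implicit Defensive.

Import Order.TTheory GRing.Theory Num.Theory.
Import numFieldNormedType.Exports.

Local Open Scope classical_set_scope.
Local Open Scope ring_scope.

(** Why the theorem holds.

    Write D = det (tau, tau', ..., tau^(p)), and v_i for the derivative of ell_i / kappa. The
    directrix along c = (R_1, ..., R_{p-1}) has velocity (a + r w) tau with w = <c, v>
    (directrix_velocity). By Leibniz's formula the matrix of its derivatives at t is, up to an
    invertible triangular factor, that of the derivatives of tau preceded by m zero columns, m
    being the order of b = a + r w at t (rank_derivatives). So its type is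
    (m+1, ..., m+p, m+p+1) where D is nonzero (type_nondegenerate) and has the last entry
    m+p+2 at a simple zero of D (type_flex), and everything depends on how m and the zeros of
    D are distributed in the (t, r)-plane.

    Let u = a v' - a' v, a curve in R^(p-1), and E = <c, u> = a w' - a' w. Suppose that E has
    only simple zeros and does not vanish at the zeros of D. Where b = 0 one has w nonzero, as
    otherwise a = w = 0 and E would have a double zero; so b = 0 is the graph of r = - a / w.
    Where b = b' = 0 one has E = 0, which happens at isolated t, with D nonzero and then b''
    nonzero. This gives all five cases with their codimensions (codim_order0 and the
    lemmas that follow it).
    For a given curve, the assumptions on E hold for c in a residual set (residual_generic),
    provided that u has no double zero and no zero in common with D, and that the zeros of D
    are simple.

    These provisos are turned into conditions on the jet of (a, tau) which do not mention
    frames: up to the factor kappa^4, the combinations of the u_i with the minors of nu_i,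
    tau', tau'' are the functions theta, the minors of a vector built from tau''' and tau''''
    together with tau', tau'' (frame_theta). The set U (regular) consists of the maps for which
    D has only simple zeros, theta has no double zero, and the two have no common zero.
    It is open as a condition on jets (open_jet_condition).

    For its density, a map is moved inside a given open set by adding to a, or to tau before
    projection to the sphere, generic polynomials times one small positive function
    (whitney_perturbation). The function whose zeros are to be made simple depends on the
    coefficients of these polynomials, and it is enough to see that at each t some coefficient
    moves it: then generic_simple_zeros applies, a parametric transversality theorem that rests
    on Baire's theorem and on a pigeonhole argument in place of Sard's theorem
    (no_slice_of_double_zeros). The perturbation is made in stages. The Wronskians of the first
    n components of tau are treated by induction on n, the preceding Wronskian and its
    derivative being the coefficients by which the last component enters (simple_wr_step).
    Then theta, which is affine in the one-jet of a, is treated by moving a (theta_step). This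
    requires that its two coefficients theta0 and theta1 have no common zero. In dimension at
    least four this is a consequence of the simple zeros of D (theta01_nonzero). In dimension
    three it says that the torsion determinant of tau has simple zeros, which takes one more
    perturbation (torsion_step). *)

(** * Derivatives inside an interval *)

(** A one-constructor wrapper: without it, comparing two smoothness statements by
    conversion unfolds iterated limits. *)
Variant smooth {R : realType} {V : normedModType R} (I : set R) (g : R -> V) : Prop :=
  Smooth of smooth_on I g.

Lemma smoothP {R : realType} {V : normedModType R} (I : set R) (g : R -> V) :
  smooth I g <-> smooth_on I g.
Proof. by split=> [[]|]. Qed.

Section Derivation.
Context {R : realType}.
Implicit Types (I : set R) (f g : R -> R) (t l : R).

Lemma near_distP t (P : set R) :
  (\forall s \near t, P s) <->
  exists2 d, 0 < d & forall s, `|s - t| < d -> P s.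
Proof.
split=> [/nbhs_ballP[d /= d0 H]|[d d0 H]].
  by exists d => // s sd; apply: H; rewrite /ball /= distrC.
by apply/(nbhs_ballP t P).2; exists d => // s; rewrite /ball /= distrC; apply: H.
Qed.

(** The relation f has derivative l at t inside I; unlike derive_in it does not presuppose
    that the derivative exists or is unique. *)
Definition dI I f t l := diff_quotient f t @ within I t^' --> l.

(** Every point of I is a limit point of I, which makes derivatives inside I unique. *)
Definition limpt I := forall t, I t -> ProperFilter (within I t^').

Lemma within_dnbhsP I t (P : set R) :
  within I t^' P <->
  exists2 d, 0 < d & forall s, I s -> s != t -> `|s - t| < d -> P s.
Proof.
split=> [|[d d0 H]].
  rewrite /within /= => /nbhs_ballP[d /= d0 H]; exists d => // s Is st sd.
  by apply: H => //; rewrite /ball /= distrC.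
rewrite /within /=; apply/nbhs_ballP; exists d => //= s sd st Is.
by apply: H => //; rewrite distrC.
Qed.

(** The tangent-line form of differentiability has no division and makes sense at s = t. *)
Lemma dIP I f t l :
  dI I f t l <-> forall e, 0 < e -> exists2 d, 0 < d &
    forall s, I s -> `|s - t| < d -> `|f s - f t - l * (s - t)| <= e * `|s - t|.
Proof.
have key s : s != t -> `|f s - f t - l * (s - t)| =
    `|l - diff_quotient f t s| * `|s - t|.
  move=> st; rewrite -normrM /diff_quotient /GRing.scale /=.
  rewrite distrC; congr `| _ |; have st0 : s - t != 0 by rewrite subr_eq0.
  by field.
split=> [/cvgrPdist_lt H e e0|H].
  have /within_dnbhsP[d d0 {}H] := H _ e0; exists d => // s Is sd.
  have [->|st] := eqVneq s t; first by rewrite !subrr mulr0 subr0 normr0 mulr0.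
  by rewrite key// ler_wpM2r// ltW// H.
apply/cvgrPdist_lt => e e0.
have [d d0 {}H] := H (e / 2) ltac:(by rewrite divr_gt0).
apply/within_dnbhsP; exists d => // s Is st sd.
have := H s Is sd; rewrite key// ler_pM2r ?normr_gt0 ?subr_eq0// => /le_lt_trans.
by apply; rewrite ltr_pdivrMr// ltr_pMr// ltr1n.
Qed.

Lemma dI_cont I f t l : dI I f t l -> forall e, 0 < e -> exists2 d, 0 < d &
  forall s, I s -> `|s - t| < d -> `|f s - f t| < e.
Proof.
move=> /dIP H e e0; have [d d0 {}H] := H 1 ltr01.
have c0 : 0 < 1 + `|l| by rewrite ltr_wpDr.
exists (Num.min d (e / (1 + `|l|))); first by rewrite lt_min d0 divr_gt0.
move=> s Is; rewrite lt_min => /andP[sd se].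
have := H s Is sd; rewrite mul1r => {}H.
have : `|f s - f t| <= (1 + `|l|) * `|s - t|.
  rewrite mulrDl mul1r -[X in _ <= _ + X]normrM.
  by rewrite -[f s - f t](subrK (l * (s - t))) (le_trans (ler_normD _ _))// lerD2r.
by move=> /le_lt_trans; apply; rewrite mulrC -ltr_pdivlMr.
Qed.

Lemma dI_cvg I f t l : dI I f t l -> f @ within I t^' --> f t.
Proof.
move=> H; apply/cvgrPdist_lt => e e0; have [d d0 {}H] := dI_cont H e0.
by apply/within_dnbhsP; exists d => // s Is _ sd; rewrite distrC H.
Qed.

Lemma dI_ext_near I J f g t l (d : R) : 0 < d -> I t ->
  (forall s, `|s - t| < d -> J s -> I s /\ f s = g s) -> f t = g t ->
  dI I f t l -> dI J g t l.
Proof.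
move=> d0 It H ft /dIP Hf; apply/dIP => e e0.
have [d' d'0 {}Hf] := Hf e e0.
exists (Num.min d d'); first by rewrite lt_min d0.
move=> s Js; rewrite lt_min => /andP[sd sd'].
by have [Is <-] := H s sd Js; rewrite -ft; apply: Hf.
Qed.

Lemma dI_ext I f g t l : (forall s, I s -> f s = g s) -> I t ->
  dI I f t l -> dI I g t l.
Proof.
by move=> fg It; apply: (dI_ext_near ltr01 It) => [s _ Is|]; [split=> //|]; exact: fg.
Qed.

Lemma dI_sub I J f t l : J `<=` I -> dI I f t l -> dI J f t l.
Proof.
move=> JI /dIP H; apply/dIP => e e0; have [d d0 {}H] := H e e0.
by exists d => // s /JI; exact: H.
Qed.

Lemma dI_cst I t c : dI I (fun=> c) t 0.
Proof.
apply/dIP => e e0; exists 1 => // s _ _.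
by rewrite subrr mul0r subr0 normr0 mulr_ge0// ltW.
Qed.

Lemma dI_id I t : dI I id t 1.
Proof.
apply/dIP => e e0; exists 1 => // s _ _.
by rewrite mul1r subrr normr0 mulr_ge0// ltW.
Qed.

Lemma dI_add I f g t l m :
  dI I f t l -> dI I g t m -> dI I (fun s => f s + g s) t (l + m).
Proof.
rewrite /dI => Hf Hg.
rewrite (_ : diff_quotient (fun s => f s + g s) t =
   diff_quotient f t \+ diff_quotient g t); first exact: cvgD.
by apply/funext => s; rewrite /diff_quotient /= -scalerDr opprD addrACA.
Qed.

Lemma dI_mul I f g t l m : dI I f t l -> dI I g t m ->
  dI I (fun s => f s * g s) t (l * g t + f t * m).
Proof.
rewrite /dI => Hf Hg.
rewrite (_ : diff_quotient (fun s => f s * g s) t =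
   (fun s => diff_quotient f t s * g t) \+ (fun s => f s * diff_quotient g t s)).
  apply: cvgD; first by apply: cvgM => //; exact: cvg_cst.
  by apply: cvgM => //; exact: dI_cvg Hf.
by apply/funext => s; rewrite /diff_quotient /GRing.scale /=; ring.
Qed.

Lemma dI_comp I (J : set R) (b : R -> R) f t l m :
  (forall s, I s -> J (f s)) -> dI I f t l -> dI J b (f t) m ->
  dI I (fun s => b (f s)) t (m * l).
Proof.
move=> IJ Hf Hb; apply/dIP => e e0.
have e1 : 0 < e / 2 / (1 + `|m|) by rewrite !divr_gt0// ltr_wpDr.
have e2 : 0 < e / 2 / (1 + `|l|) by rewrite !divr_gt0// ltr_wpDr.
have [d1 d10 H1] := (dIP I f t l).1 Hf _ e1.
have [d1' d10' H1'] := (dIP I f t l).1 Hf _ ltr01.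
have [d2 d20 H2] := (dIP J b (f t) m).1 Hb _ e2.
have [d3 d30 H3] := dI_cont Hf d20.
exists (Num.min (Num.min d1 d1') d3); first by rewrite !lt_min d10 d10' d30.
move=> s Is; rewrite !lt_min => /andP[/andP[sd1 sd1'] sd3].
have := H1 s Is sd1; have := H1' s Is sd1'; have := H2 _ (IJ _ Is) (H3 s Is sd3).
set x := b (f s) - _; set y := f s - f t; set z := s - t; move=> A B C.
have By : `|y| <= (1 + `|l|) * `|z|.
  rewrite mulrDl mul1r -[X in _ <= _ + X]normrM.
  rewrite -[y](subrK (l * z)) (le_trans (ler_normD _ _))// lerD2r.
  by rewrite mul1r in B.
rewrite (_ : _ - _ = (x - m * y) + m * (y - l * z)); last by ring.
rewrite (le_trans (ler_normD _ _))// (_ : e * _ = e / 2 * `|z| + e / 2 * `|z|); last by field.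
apply: lerD.
  apply: (le_trans A); rewrite -[X in X <= _]mulrA ler_wpM2l ?divr_ge0// ?(ltW e0)//.
  by rewrite ler_pdivrMl// ltr_wpDr.
rewrite normrM (le_trans (ler_wpM2l _ C))// mulrA ler_wpM2r//.
rewrite mulrCA ger_pMr ?divr_gt0//.
by rewrite ler_pdivrMr ?ltr_wpDr// mul1r lerDr.
Qed.

Lemma dI_unique I f t l m : limpt I -> I t -> dI I f t l -> dI I f t m -> l = m.
Proof. by move=> H It; have ? := H t It; apply: cvg_unique. Qed.

Lemma derive_inE I f t l : limpt I -> I t -> dI I f t l -> derive_in I f t = l.
Proof. by move=> H It; have ? := H t It; move/cvg_lim; apply. Qed.

Lemma dI_derivable I f t l : dI I f t l -> derivable_in I f t.
Proof. by move=> H; apply/cvg_ex; exists l. Qed.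

Lemma derivable_dI I f t : derivable_in I f t -> dI I f t (derive_in I f t).
Proof. by []. Qed.

(** Bridges to the two-sided derivative, at interior points of I. *)
Lemma dI_is_derive I f t l (d : R) : 0 < d -> (forall s, `|s - t| < d -> I s) ->
  dI I f t l -> is_derive t 1 f l.
Proof.
move=> d0 dIs /dIP H.
have C : (fun h => h^-1 *: ((f \o shift t) (h *: 1) - f t)) @ 0^' --> l.
  apply/cvgrPdist_lt => e e0.
  have [d' d'0 {}H] := H (e / 2) ltac:(by rewrite divr_gt0).
  rewrite /dnbhs near_withinE.
  apply/near_distP; exists (Num.min d d'); first by rewrite /= lt_min d0.
  move=> h; rewrite subr0 lt_min => /andP[hd hd'] h0.
  have /= := H (h + t); rewrite addrK => {}H.
  have := H (dIs _ _) hd'; rewrite addrK => /(_ hd).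
  rewrite /GRing.scale /= mulr1.
  rewrite -ler_pdivrMr ?normr_gt0// -normfV -normrM => H1.
  apply: (@le_lt_trans _ _ (e/2)); last by rewrite ltr_pdivrMr// ltr_pMr// ltr1n.
  by apply: le_trans H1; rewrite -normrN le_eqVlt; apply/orP; left; apply/eqP; congr `|_|; field.
split; first by apply/cvg_ex; exists l.
exact: cvg_lim C.
Qed.

Lemma is_derive_dI I f t l : is_derive t 1 f l -> dI I f t l.
Proof.
move=> [/cvg_ex[m C] E].
have ml : m = l by rewrite -E; apply/esym; exact: cvg_lim C.
rewrite {}ml {E m} in C; apply/dIP => e e0.
have [d d0 {}C] : exists2 d, 0 < d & forall h, `|h| < d -> h != 0 ->
    `|l - h^-1 *: (f (h *: 1 + t) - f t)| < e.
  have /= D : within (fun h : R => h != 0) (nbhs (0 : R))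
      (fun h => `|l - h^-1 *: (f (h *: 1 + t) - f t)| < e).
    exact: (cvgrPdist_lt _ _).1 C _ e0.
  have [d d0 H] := (near_distP 0 _).1 D; exists d => // h hd; apply: H.
  by rewrite subr0.
exists d => // s Is sd; have [->|st] := eqVneq s t.
  by rewrite !subrr mulr0 subr0 normr0 mulr0.
have := C (s - t); rewrite subr_eq0 => /(_ sd st).
rewrite /GRing.scale /= mulr1 subrK => /ltW.
rewrite -[_ <= e](@ler_pM2r _ `|s - t|) ?normr_gt0 ?subr_eq0// -normrM.
move/(le_trans _); apply; rewrite -normrN le_eqVlt; apply/orP; left; apply/eqP.
by congr `|_|; have : s - t != 0 by [rewrite subr_eq0]; move=> ?; field.
Qed.

Lemma interval_limpt I : is_interval I -> (exists u v, [/\ I u, I v & u < v]) ->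
  limpt I.
Proof.
move=> Ii [u [v [Iu Iv uv]]] t It.
apply: Build_ProperFilter_ex => P /within_dnbhsP[d d0 H].
have [ut|tu] := ltP u t.
  exists (Num.max u (t - d / 2)); apply: H.
  - apply: (Ii u t) => //; rewrite ?le_max ?lexx//= ge_max (ltW ut)/= lerBlDr.
    by rewrite lerDl divr_ge0// ltW.
  - by rewrite lt_eqF// gt_max ut/= ltrBlDr ltrDl divr_gt0.
  rewrite distrC ger0_norm; last first.
    by rewrite subr_ge0 ge_max (ltW ut)/= lerBlDr lerDl divr_ge0// ltW.
  rewrite ltrBlDr -ltrBlDl lt_max; apply/orP; right.
  by rewrite ltrD2l ltrN2 ltr_pdivrMr// ltr_pMr// ltr1n.
have tv := le_lt_trans tu uv.
exists (Num.min v (t + d / 2)); apply: H.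
- apply: (Ii t v) => //; rewrite ?ge_min ?lexx//= le_min (ltW tv)/=.
  by rewrite lerDl divr_ge0// ltW.
- by rewrite gt_eqF// lt_min tv/= ltrDl divr_gt0.
rewrite ger0_norm; last first.
  by rewrite subr_ge0 le_min (ltW tv)/= lerDl divr_ge0// ltW.
rewrite ltrBlDr gt_min; apply/orP; right.
by rewrite addrC ltrD2r ltr_pdivrMr// ltr_pMr// ltr1n.
Qed.

Lemma dI_MVT I f f' (a b : R) : is_interval I -> (forall t, I t -> dI I f t (f' t)) ->
  I a -> I b -> a < b ->
  exists c, [/\ a < c, c < b & f b - f a = f' c * (b - a)].
Proof.
move=> Ii H Ia Ib ab.
have HI c : a <= c <= b -> I c by move=> h; apply: (Ii a b).
have [||c] := @MVT R f f' a b ab.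
- move=> x; rewrite in_itv /= => /andP[ax xb].
  apply: (@dI_is_derive I f x (f' x) (Num.min (x - a) (b - x))).
  + by rewrite lt_min !subr_gt0 ax.
  + move=> s; rewrite lt_min => /andP[/ltr_normlP[h1 _] /ltr_normlP[_ h2]].
    by apply: HI; apply/andP; split; lra.
  + by apply: H; apply: HI; rewrite !ltW.
- apply/continuous_within_itvP => //; split.
  + move=> x; rewrite in_itv /= => /andP[ax xb]; apply/cvgrPdist_lt => e e0.
    have Ix : I x by apply: HI; rewrite !ltW.
    have [d d0 D] := dI_cont (H x Ix) e0.
    apply/near_distP; exists (Num.min d (Num.min (x - a) (b - x))).
      by rewrite !lt_min !subr_gt0 ax d0.
    move=> s /=; rewrite !lt_min => /andP[sd /andP[/ltr_normlP[h1 _] /ltr_normlP[_ h2]]].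
    rewrite distrC; apply: D => //.
    by apply: HI; apply/andP; split; lra.
  + apply/cvgrPdist_lt => e e0; have [d d0 D] := dI_cont (H a Ia) e0.
    rewrite near_withinE; apply/near_distP; exists (Num.min d (b - a)).
      by rewrite !lt_min !subr_gt0 d0.
    move=> s /=; rewrite !lt_min => /andP[sd /ltr_normlP[h1 h2]] h3.
    rewrite distrC; apply: D => //.
    by apply: HI; apply/andP; split; lra.
  + apply/cvgrPdist_lt => e e0; have [d d0 D] := dI_cont (H b Ib) e0.
    rewrite near_withinE; apply/near_distP; exists (Num.min d (b - a)).
      by rewrite !lt_min !subr_gt0 d0.
    move=> s /=; rewrite !lt_min => /andP[sd /ltr_normlP[h1 h2]] h3.
    rewrite distrC; apply: D => //.
    by apply: HI; apply/andP; split; lra.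
by rewrite in_itv /= => /andP[ac cb] E; exists c.
Qed.

(** A sequence of functions each of which is the derivative of the preceding one: exhibiting
    such a sequence proves smoothness and computes all derivatives at once. *)
Definition tower I (F : nat -> R -> R) :=
  forall n t, I t -> dI I (F n) t (F n.+1 t).

Lemma tower_deriven I (F : nat -> R -> R) f : limpt I -> tower I F ->
  (forall t, I t -> f t = F 0%N t) ->
  forall n t, I t -> deriven_in I n f t = F n t.
Proof.
move=> HI HF fF; elim=> [|n IHn] t It; first exact: fF.
apply: derive_inE => //.
by apply: (dI_ext (f := F n)) (HF n t It) => // s Is; apply/esym/IHn.
Qed.

Lemma tower_smooth I (F : nat -> R -> R) f : limpt I -> tower I F ->
  (forall t, I t -> f t = F 0%N t) -> smooth I f.
Proof.
move=> HI HF fF; split=> n t It; apply: dI_derivable.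
apply: (dI_ext (f := F n)) (HF n t It) => // s Is.
by apply/esym/(tower_deriven HI HF fF).
Qed.

Lemma smooth_tower I f : smooth I f -> tower I (fun n => deriven_in I n f).
Proof. by move=> [H] n t It; apply: derivable_dI; apply: H. Qed.

End Derivation.

(** * Polynomial expressions in jets and smooth functions *)

Section Expressions.
Context {R : realType}.

(** Polynomial expressions over a set A of generators. They are an abstract form of the
    functions that occur below, polynomials in the derivatives of finitely many functions:
    formal differentiation keeps them polynomial, so a single argument yields smoothness,
    formulas for derivatives, continuity, and dependence on jets of finite order. *)
Inductive dexp (A : Type) : Type :=
| Cst of R
| Gen of A
| Add of dexp A & dexp A
| Mul of dexp A & dexp A.

Fixpoint eval (A : Type) (env : A -> R) (e : dexp A) : R :=
  match e with
  | Cst r => r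
  | Gen x => env x
  | Add e1 e2 => eval env e1 + eval env e2
  | Mul e1 e2 => eval env e1 * eval env e2
  end.

Fixpoint dd (A : Type) (dA : A -> dexp A) (e : dexp A) : dexp A :=
  match e with
  | Cst _ => Cst A 0
  | Gen x => dA x
  | Add e1 e2 => Add (dd dA e1) (dd dA e2)
  | Mul e1 e2 => Add (Mul (dd dA e1) e2) (Mul e1 (dd dA e2))
  end.

Lemma dI_eval (A : Type) (dA : A -> dexp A) (env : R -> A -> R) I t e :
  (forall x, dI I (env^~ x) t (eval (env t) (dA x))) ->
  dI I (fun s => eval (env s) e) t (eval (env t) (dd dA e)).
Proof.
move=> H; elim: e => [r|x|e1 IH1 e2 IH2|e1 IH1 e2 IH2] /=.
- exact: dI_cst.
- exact: H.
- exact: dI_add.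
- exact: dI_mul.
Qed.

(** If the derivative of every generator is an expression in the generators, iterating the
    formal derivative of an expression produces all its derivatives. *)
Lemma eval_tower (A : Type) (dA : A -> dexp A) (env : R -> A -> R) I e :
  (forall x t, I t -> dI I (env^~ x) t (eval (env t) (dA x))) ->
  tower I (fun n s => eval (env s) (iter n (dd dA) e)).
Proof. by move=> H n t It; apply: dI_eval => x; apply: H. Qed.

Fixpoint gens (A : Type) (ok : A -> Prop) (e : dexp A) : Prop :=
  match e with
  | Cst _ => True
  | Gen x => ok x
  | Add e1 e2 | Mul e1 e2 => gens ok e1 /\ gens ok e2
  end.

Lemma gens_sub (A : Type) (ok ok' : A -> Prop) e :
  (forall x, ok x -> ok' x) -> gens ok e -> gens ok' e.
Proof.
move=> H; elim: e => [r|x|e1 IH1 e2 IH2|e1 IH1 e2 IH2] //=; try exact: H.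
- by move=> [? ?]; split; [exact: IH1|exact: IH2].
- by move=> [? ?]; split; [exact: IH1|exact: IH2].
Qed.

Lemma gens_bounded (A : Type) (ord : A -> nat) e :
  exists K, gens (fun x => (ord x <= K)%N) e.
Proof.
elim: e => [r|x|e1 [K1 H1] e2 [K2 H2]|e1 [K1 H1] e2 [K2 H2]]; first by exists 0%N.
- by exists (ord x) => /=.
- exists (maxn K1 K2); split; [apply: gens_sub H1|apply: gens_sub H2] => x h;
  by rewrite (leq_trans h)// ?leq_maxl// leq_maxr.
- exists (maxn K1 K2); split; [apply: gens_sub H1|apply: gens_sub H2] => x h;
  by rewrite (leq_trans h)// ?leq_maxl// leq_maxr.
Qed.

Lemma eval_ext (A : Type) (ok : A -> Prop) (r r' : A -> R) e :
  (forall x, ok x -> r x = r' x) -> gens ok e -> eval r e = eval r' e.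
Proof.
move=> H; elim: e => [c|x|e1 IH1 e2 IH2|e1 IH1 e2 IH2] //=; try exact: H.
- by move=> [? ?]; rewrite IH1// IH2.
- by move=> [? ?]; rewrite IH1// IH2.
Qed.

Lemma cvg_eval (A : Type) (T : Type) (F : set_system T) {FF : Filter F}
    (env : T -> A -> R) (r : A -> R) (ok : A -> Prop) e :
  (forall x, ok x -> env^~ x @ F --> r x) -> gens ok e ->
  (fun j => eval (env j) e) @ F --> eval r e.
Proof.
move=> H; elim: e => [c|x|e1 IH1 e2 IH2|e1 IH1 e2 IH2] /=.
- by move=> _; exact: cvg_cst.
- exact: H.
- by move=> [? ?]; apply: cvgD; [exact: IH1|exact: IH2].
- by move=> [? ?]; apply: cvgM; [exact: IH1|exact: IH2].
Qed.

(** Continuity of evaluation, uniformly in the infinitely many generators that do not occur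
    in the expression; the filter of uniform closeness reduces it to cvg_eval. *)
Lemma eval_near (A : Type) (r : A -> R) (ok : A -> Prop) e (eps : R) :
  0 < eps -> gens ok e -> exists2 eta, 0 < eta &
    forall env, (forall x, ok x -> `|env x - r x| < eta) ->
      `|eval env e - eval r e| < eps.
Proof.
move=> eps0 ge.
pose B eta : set (A -> R) := [set env | forall x, ok x -> `|env x - r x| < eta].
pose F := filter_from [set eta : R | 0 < eta] B.
have FF : Filter F.
  apply: filter_from_filter; first by exists 1 => /=.
  move=> i j /= i0 j0; exists (Num.min i j); first by rewrite /= lt_min i0.
  move=> env H; split=> x ox; have := H x ox; rewrite lt_min => /andP[] //.
have C : (fun env => eval env e) @ F --> eval r e.
  apply: cvg_eval ge => x ox; apply/cvgrPdist_lt => e' e'0; exists e' => //= env.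
  by move=> /(_ x ox); rewrite distrC.
have [eta eta0 H] := (cvgrPdist_lt _ _).1 C _ eps0.
by exists eta => // env Henv; rewrite distrC; apply: H.
Qed.

End Expressions.

Section SmoothClosure.
Context {R : realType} (I : set R) (I_limpt : limpt I).
Implicit Types (f g h : R -> R).

(** Generators (x, n) standing for the n-th derivative of the function number x. *)
Definition djet (V : Type) (x : V * nat) : dexp (V * nat) :=
  Gen (R := R) (x.1, x.2.+1).

Definition fenv (V : Type) (f : V -> R -> R) (t : R) (x : V * nat) : R :=
  deriven_in I x.2 (f x.1) t.

Lemma dI_fenv (V : Type) (f : V -> R -> R) : (forall v, smooth I (f v)) ->
  forall x t, I t -> dI I ((fenv f)^~ x) t (eval (fenv f t) (djet x)).
Proof. by move=> H [v n] t It; exact: (smooth_tower (H v)). Qed.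

Lemma smooth_fenv (V : Type) (f : V -> R -> R) (e : dexp (V * nat)) g :
  (forall v, smooth I (f v)) -> (forall t, I t -> g t = eval (fenv f t) e) ->
  smooth I g /\ forall n t, I t ->
    deriven_in I n g t = eval (fenv f t) (iter n (dd (@djet V)) e).
Proof.
move=> H gE; have T := eval_tower (e := e) (dI_fenv H); split.
  exact: (tower_smooth I_limpt T).
exact: (tower_deriven I_limpt T).
Qed.

Lemma smooth_ext f g : (forall t, I t -> f t = g t) -> smooth I f ->
  smooth I g.
Proof.
move=> fg H; apply: (tower_smooth I_limpt (smooth_tower H)) => t It /=.
by rewrite fg.
Qed.

Lemma deriven_ext f g : (forall t, I t -> f t = g t) -> smooth I f ->
  forall n t, I t -> deriven_in I n f t = deriven_in I n g t.
Proof.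
move=> fg H n t It; apply/esym.
by apply: (tower_deriven I_limpt (smooth_tower H)) => // s Is; rewrite /= fg.
Qed.

Lemma smooth_cst (c : R) : smooth I (fun=> c).
Proof.
by apply: (smooth_fenv (V := void) (f := of_void _) (e := Cst _ c) _ _).1 => // -[].
Qed.

Lemma smooth_id : smooth I (@id R).
Proof.
apply: (@tower_smooth _ _ (fun n t => if n is k.+1 then (k == 0)%:R else t)) => //.
by move=> [|n] t It /=; [exact: dI_id|exact: dI_cst].
Qed.

Lemma smooth_add f g : smooth I f -> smooth I g ->
  smooth I (fun t => f t + g t).
Proof.
move=> Hf Hg; pose F b := if b then f else g.
have HF b : smooth I (F b) by case: b; [exact: Hf|exact: Hg].
by have [] := smooth_fenv (e := Add (Gen (true, 0%N)) (Gen (false, 0%N))) HF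
  (fun t _ => erefl).
Qed.

Lemma smooth_mul f g : smooth I f -> smooth I g ->
  smooth I (fun t => f t * g t).
Proof.
move=> Hf Hg; pose F b := if b then f else g.
have HF b : smooth I (F b) by case: b; [exact: Hf|exact: Hg].
by have [] := smooth_fenv (e := Mul (Gen (true, 0%N)) (Gen (false, 0%N))) HF
  (fun t _ => erefl).
Qed.

Lemma smooth_opp f : smooth I f -> smooth I (fun t => - f t).
Proof.
move=> H; apply: (smooth_ext (f := fun t => (-1) * f t)).
  by move=> t _; rewrite mulN1r.
exact: (smooth_mul (@smooth_cst (-1)) H).
Qed.

Lemma smooth_sum (J : Type) (r : seq J) (P : pred J) (f : J -> R -> R) :
  (forall j, smooth I (f j)) -> smooth I (fun t => \sum_(j <- r | P j) f j t).
Proof.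
move=> H; elim: r => [|j r IH].
  apply: (smooth_ext (f := fun=> 0)); last exact: smooth_cst.
  by move=> t _; rewrite big_nil.
have [Pj|Pj] := boolP (P j).
  apply: (smooth_ext (f := fun t => f j t + \sum_(j <- r | P j) f j t)).
    by move=> t _; rewrite big_cons Pj.
  exact: smooth_add.
by apply: smooth_ext IH => t _; rewrite big_cons (negbTE Pj).
Qed.

Lemma smooth_prod (J : Type) (r : seq J) (P : pred J) (f : J -> R -> R) :
  (forall j, smooth I (f j)) -> smooth I (fun t => \prod_(j <- r | P j) f j t).
Proof.
move=> H; elim: r => [|j r IH].
  apply: (smooth_ext (f := fun=> 1)); last exact: smooth_cst.
  by move=> t _; rewrite big_nil.
have [Pj|Pj] := boolP (P j).
  apply: (smooth_ext (f := fun t => f j t * \prod_(j <- r | P j) f j t)).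
    by move=> t _; rewrite big_cons Pj.
  exact: smooth_mul.
by apply: smooth_ext IH => t _; rewrite big_cons (negbTE Pj).
Qed.

Lemma smooth_exp f k : smooth I f -> smooth I (fun t => f t ^+ k).
Proof.
move=> H; elim: k => [|k IH]; first exact: (@smooth_cst 1).
apply: (smooth_ext (f := fun t => f t * f t ^+ k)); first by move=> t _; rewrite exprS.
exact: smooth_mul.
Qed.

Lemma smooth_det n (A : 'I_n -> 'I_n -> R -> R) : (forall i j, smooth I (A i j)) ->
  smooth I (fun t => \det (\matrix_(i, j) A i j t)).
Proof.
move=> H; rewrite /determinant.
apply: smooth_sum => s; apply: smooth_mul; first exact: smooth_cst.
apply: (smooth_ext (f := fun t => \prod_i A i (fun_of_perm s i) t)).
  by move=> t _; apply: eq_bigr => i _; rewrite mxE.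
exact: smooth_prod.
Qed.

Lemma smooth_derive f : smooth I f -> smooth I (derive_in I f).
Proof.
by move=> [H]; split=> n t It; have := H n.+1 t It; rewrite /deriven_in iterSr.
Qed.

Lemma smooth_deriven n f : smooth I f -> smooth I (deriven_in I n f).
Proof. by move=> H; elim: n => // n IH; exact: smooth_derive. Qed.

Lemma dI_smooth f t : smooth I f -> I t -> dI I f t (derive_in I f t).
Proof. by move=> [H] It; apply: derivable_dI; exact: (H 0%N). Qed.

(** The generators Some (tt, n) are the derivatives of f, and None is h. *)
Definition algstep (c : R) (k : nat) (x : option (unit * nat)) :
    dexp (option (unit * nat)) :=
  match x with
  | Some y => Gen (Some (y.1, y.2.+1))
  | None => Mul (Mul (Cst _ c) (Gen (Some (tt, 1%N))))
                (iter k (Mul (Gen None)) (Cst _ 1))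
  end.

(** A function satisfying h' = c f' h^k with f smooth is smooth, since every further
    derivative of h is again a polynomial in h and the jet of f. Inverses and inverse
    square roots are of this kind. *)
Lemma smooth_alg f h c k : smooth I f ->
  (forall t, I t -> dI I h t (c * derive_in I f t * h t ^+ k)) -> smooth I h.
Proof.
move=> Hf Hh.
pose env t (x : option (unit * nat)) :=
  if x is Some y then deriven_in I y.2 f t else h t.
apply: (tower_smooth I_limpt (F := fun n s => eval (env s) (iter n (dd (algstep c k)) (Gen None)))) => //.
apply: eval_tower => -[[[] n]|] t It.
  exact: (smooth_tower Hf).
have := Hh t It; congr (dI I _ t _) => /=.
congr (_ * _).
elim: k {Hh} => [|k IH]; first by rewrite expr0.
by rewrite exprS /= -IH.
Qed.

Lemma dI_inv f t l : f t != 0 -> dI I f t l ->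
  dI I (fun s => (f s)^-1) t (- l * (f t)^-1 ^+ 2).
Proof.
move=> f0 H; have := is_derive_id (f t) (1 : R) => D.
have {}D := is_deriveV (f := id) f0 D.
have {}D := @is_derive_dI R setT _ _ _ D.
rewrite (_ : - l * _ = (- (f t) ^- 2 *: 1) * l); last first.
  by rewrite /GRing.scale /= mulr1 exprVn; ring.
exact: (dI_comp (J := setT) (b := fun x => x^-1)).
Qed.

Lemma smooth_inv f : smooth I f -> (forall t, I t -> f t != 0) ->
  smooth I (fun t => (f t)^-1).
Proof.
move=> H f0; apply: (smooth_alg (c := -1) (k := 2) H) => t It.
by rewrite mulN1r; apply: dI_inv; [exact: f0|exact: dI_smooth].
Qed.

Lemma dI_rsqrt f t l : 0 < f t -> dI I f t l ->
  dI I (fun s => (Num.sqrt (f s))^-1) t (- 2^-1 * l * (Num.sqrt (f t))^-1 ^+ 3).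
Proof.
move=> f0 H; have D := @is_derive_dI R setT _ _ _ (is_derive1_sqrt f0).
have {}D := dI_comp (I := I) (J := setT) (fun _ _ => Logic.I) H D.
have s0 : Num.sqrt (f t) != 0 by rewrite gt_eqF// sqrtr_gt0.
have := dI_inv (f := fun s => Num.sqrt (f s)) s0 D; congr (dI I _ t _).
by rewrite invfM; set x := (Num.sqrt (f t))^-1; ring.
Qed.

Lemma smooth_rsqrt f : smooth I f -> (forall t, I t -> 0 < f t) ->
  smooth I (fun t => (Num.sqrt (f t))^-1).
Proof.
move=> H f0; apply: (smooth_alg (c := - 2^-1) (k := 3) H) => t It.
by apply: dI_rsqrt; [exact: f0|exact: dI_smooth].
Qed.

Lemma dI_sum (J : Type) (r : seq J) (P : pred J) (f : J -> R -> R) (l : J -> R) t :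
  (forall j, dI I (f j) t (l j)) ->
  dI I (fun s => \sum_(j <- r | P j) f j s) t (\sum_(j <- r | P j) l j).
Proof.
move=> H; elim: r => [|j r IH].
  rewrite big_nil (_ : (fun s => _) = fun=> 0); first exact: dI_cst.
  by apply/funext => s; rewrite big_nil.
have [Pj|Pj] := boolP (P j).
  rewrite big_cons Pj (_ : (fun s => _) = fun s => f j s + \sum_(j <- r | P j) f j s).
    exact: dI_add.
  by apply/funext => s; rewrite big_cons Pj.
rewrite big_cons (negbTE Pj) (_ : (fun s => _) = fun s => \sum_(j <- r | P j) f j s) //.
by apply/funext => s; rewrite big_cons (negbTE Pj).
Qed.

Lemma dI_scale c f t l : dI I f t l -> dI I (fun s => c * f s) t (c * l).
Proof.
by move=> H; have := dI_mul (dI_cst I t c) H; rewrite mul0r add0r.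
Qed.

Lemma deriven_mul f g : smooth I f -> smooth I g ->
  forall n t, I t -> deriven_in I n (fun s => f s * g s) t =
    \sum_(i < n.+1) 'C(n, i)%:R * (deriven_in I (n - i) f t * deriven_in I i g t).
Proof.
move=> Hf Hg n t It.
pose F n := deriven_in I n f; pose G n := deriven_in I n g.
pose T n (t : R) := \sum_(i < n.+1) 'C(n, i)%:R * (F (n - i)%N t * G i t).
apply: (@tower_deriven _ _ T) => //; last first.
  by move=> s Is; rewrite /T big_ord1 bin0 subn0 mul1r.
move=> {t It} {}n t It.
suff <- : \sum_(i < n.+1) 'C(n, i)%:R *
    (F (n - i).+1 t * G i t + F (n - i)%N t * G i.+1 t) = T n.+1 t.
  apply: dI_sum => i; apply: dI_scale.
  by apply: dI_mul; [exact: (smooth_tower Hf)|exact: (smooth_tower Hg)].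
under eq_bigr do rewrite mulrDr.
rewrite big_split /= /T [in RHS]big_ord_recl /=.
under [in RHS]eq_bigr do rewrite /bump /= add1n binS natrD mulrDl subSS.
rewrite [in RHS]big_split /= [in RHS]addrA.
congr (_ + _).
rewrite big_ord_recl [in RHS]big_ord_recr /=.
rewrite (@bin_small n n.+1)// mul0r addr0 !bin0 !subn0; congr (_ + _).
by apply: eq_bigr => i _; rewrite /bump leq0n add1n -(subnSK (ltn_ord i)).
Qed.

End SmoothClosure.

Section RowCalculus.
Context {R : realType}.

Lemma cvg_rowP (T : Type) (F : set_system T) {FF : Filter F} n
    (h : T -> 'rV[R]_n) (v : 'rV[R]_n) :
  h @ F --> v <-> forall i, (fun t => h t 0 i) @ F --> v 0 i.
Proof.
split=> [H i|H].
  apply: (cvg_comp h (fun v : 'rV[R]_n => v 0 i) H).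
  exact: coord_continuous.
apply/cvg_ballP => e e0.
have : \forall t \near F, forall i, ball (v 0 i) e (h t 0 i).
  by apply: filter_forall => i; apply: (cvg_ball (H i)).
by apply: filterS => t Ht; split=> // i j; rewrite (ord1 i).
Qed.

Variables (I : set R) (I_limpt : limpt I).

Lemma smooth_derivable (V : normedModType R) (h : R -> V) t :
  smooth I h -> I t -> derivable_in I h t.
Proof. by move=> [H]; exact: (H 0%N). Qed.

Lemma row_derivableP n (h : R -> 'rV[R]_n) t : I t ->
  derivable_in I h t <-> forall i, derivable_in I (fun s => h s 0 i) t.
Proof.
move=> It; have FF := I_limpt It; split=> [/cvg_ex[l] /cvg_rowP H i|H].
  apply/cvg_ex; exists (l 0 i); rewrite (_ : diff_quotient _ _ = (fun s => diff_quotient h t s 0 i)) //.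
  by apply/funext => s; rewrite /diff_quotient !mxE.
apply/cvg_ex; exists (\row_i derive_in I (fun s => h s 0 i) t); apply/cvg_rowP => i.
rewrite mxE (_ : (fun s => _) = diff_quotient (fun s => h s 0 i) t); first exact: H.
by apply/funext => s; rewrite /diff_quotient !mxE.
Qed.

Lemma row_derive_in n (h : R -> 'rV[R]_n) t i : I t -> derivable_in I h t ->
  derive_in I h t 0 i = derive_in I (fun s => h s 0 i) t.
Proof.
move=> It H; apply/esym/derive_inE => //; rewrite /dI.
have FF := I_limpt It.
move/cvg_rowP : (H) => /(_ i).
by rewrite (_ : (fun s => _) = diff_quotient (fun s => h s 0 i) t)//;
  apply/funext => s; rewrite /diff_quotient !mxE.
Qed.

Lemma row_smoothP n (h : R -> 'rV[R]_n) :
  smooth I h <-> forall i, smooth I (fun s => h s 0 i).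
Proof.
split=> [[H] i|H].
  apply: (@tower_smooth _ _ (fun n t => deriven_in I n h t 0 i)) => // k t It.
  rewrite -[deriven_in I k.+1 h]/(derive_in I (deriven_in I k h)).
  rewrite row_derive_in//; last exact: H.
  apply: derivable_dI; move: i.
  by apply/(row_derivableP (deriven_in I k h)) => //; exact: H.
(* The two facts support each other: the derivatives of order m exist because those of
   the components do, and then have the expected components. *)
suff K m : (forall t i, I t -> deriven_in I m h t 0 i =
      deriven_in I m (fun s => h s 0 i) t) /\
    (forall t, I t -> derivable_in I (deriven_in I m h) t) by split=> k t; apply (K k).
have D k : (forall t i, I t -> deriven_in I k h t 0 i =
      deriven_in I k (fun s => h s 0 i) t) ->
    (forall t, I t -> derivable_in I (deriven_in I k h) t).
  move=> E t It; apply/row_derivableP => // i; apply: dI_derivable.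
  apply: (dI_ext (f := deriven_in I k (fun s => h s 0 i))) => //.
    by move=> s Is; rewrite E.
  exact: (smooth_tower (H i)).
elim: m => [|k [E Dk]]; first by split; [|exact: (D 0%N)].
have E' t i : I t -> deriven_in I k.+1 h t 0 i = deriven_in I k.+1 (fun s => h s 0 i) t.
  move=> It; rewrite -[deriven_in I k.+1 h]/(derive_in I (deriven_in I k h)) row_derive_in//; last exact: Dk.
  apply: derive_inE => //.
  apply: (dI_ext (f := deriven_in I k (fun s => h s 0 i))) => //.
    by move=> s Is; rewrite E.
  exact: (smooth_tower (H i)).
by split; [exact: E'|exact: (D k.+1 E')].
Qed.

Lemma row_deriven n (h : R -> 'rV[R]_n) k t i : smooth I h -> I t ->
  deriven_in I k h t 0 i = deriven_in I k (fun s => h s 0 i) t.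
Proof.
move=> [H] It.
apply/esym.
apply: (tower_deriven (F := fun k t => deriven_in I k h t 0 i) I_limpt) => // m s Is.
rewrite -[deriven_in I m.+1 h]/(derive_in I (deriven_in I m h)).
rewrite row_derive_in//; last exact: H.
apply: derivable_dI; move: i.
by apply/(row_derivableP (deriven_in I m h)) => //; exact: H.
Qed.

Lemma smooth_sub (J : set R) (f : R -> R) : limpt J -> J `<=` I -> smooth I f ->
  smooth J f.
Proof.
move=> HJ JI H; apply: (tower_smooth (F := fun n => deriven_in I n f) HJ) => // n t Jt.
apply: (dI_sub JI); exact: (smooth_tower H (JI _ Jt)).
Qed.

Lemma limptI (A : set R) : open A -> limpt (I `&` A).
Proof.
move=> Ao t [It At]; have FF := I_limpt It.
apply: Build_ProperFilter_ex => P /within_dnbhsP[d d0 H].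
have /nbhs_ballP[d' /= d'0 Ad'] := open_nbhs_nbhs (conj Ao At).
have : within I t^' (fun s => (I `&` A) s /\ s != t /\ `|s - t| < d).
  apply/within_dnbhsP; exists (Num.min d d'); first by rewrite lt_min d0.
  move=> s Is st; rewrite lt_min => /andP[sd sd']; split=> //; split=> //.
  by apply: Ad'; rewrite /ball /= distrC.
by move=> /(@filter_ex _ _ FF)[s [IAs [st sd]]]; exists s; apply: H.
Qed.

End RowCalculus.

Section RowSmooth.
Context {R : realType} (I : set R) (I_limpt : limpt I) (n : nat).
Implicit Types (f g : R -> 'rV[R]_n).

Lemma smooth_dot f g : smooth I f -> smooth I g ->
  smooth I (fun t => dot (f t) (g t)).
Proof.
move=> /(row_smoothP I_limpt) Hf /(row_smoothP I_limpt) Hg.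
by apply: smooth_sum => // j; exact: smooth_mul.
Qed.

Lemma derive_dot f g t : smooth I f -> smooth I g -> I t ->
  derive_in I (fun t => dot (f t) (g t)) t =
  dot (derive_in I f t) (g t) + dot (f t) (derive_in I g t).
Proof.
move=> Hf Hg It; apply: derive_inE => //.
rewrite /dot -big_split /=; apply: dI_sum => j.
rewrite !row_derive_in//; last exact: smooth_derivable; last exact: smooth_derivable.
by apply: dI_mul; apply: dI_smooth => //; exact/(row_smoothP I_limpt _).1.
Qed.

Lemma smooth_row_derive f : smooth I f -> smooth I (derive_in I f).
Proof.
by move=> [H]; split=> k t It; have := H k.+1 t It; rewrite /deriven_in iterSr.
Qed.

End RowSmooth.

(** * Generic simplicity of zeros *)

Section SegmentBase.
Context {R : realType} (I : set R).
Hypothesis I_interval : is_interval I.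
Hypothesis I_nondeg : exists u v, [/\ I u, I v & u < v].

Lemma rational_between (x y : R) : x < y -> exists q : rat, x < ratr q < y.
Proof. by move=> /rat_in_itvoo[q]; rewrite in_itv /= => h; exists q. Qed.

(** A countable set of segments that contains arbitrarily short neighbourhoods, inside I, of
    each point of I. Besides the rationals of I, the endpoints of I that belong to I are
    needed. *)
Lemma segment_base : exists q : nat -> R, (forall n, I (q n)) /\
  forall t d, I t -> 0 < d -> exists n1 n2,
    [/\ t - d < q n1, q n1 <= t, t <= q n2 & q n2 < t + d].
Proof.
have [u [v [Iu Iv uv]]] := I_nondeg.
pose g (r : rat) : R :=
  if `[< I (ratr r) >] then ratr r
  else if (u <= ratr r) && `[< I (sup I) >] then sup I
  else if (ratr r < u) && `[< I (inf I) >] then inf I else u.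
have Ig r : I (g r).
  rewrite /g; case: asboolP => // _; case: andP => [[_ /asboolP//]|_].
  by case: andP => [[_ /asboolP//]|_].
suff H t d : I t -> 0 < d -> exists r1 r2,
    [/\ t - d < g r1, g r1 <= t, t <= g r2 & g r2 < t + d].
  exists (fun n => if unpickle n is Some r then g r else u); split=> [n|t d It d0].
    by case: unpickle.
  have [r1 [r2 h]] := H t d It d0.
  by exists (pickle r1), (pickle r2); rewrite !pickleK.
move=> It d0.
have [r1 [r1l r1t]] : exists r, t - d < g r /\ g r <= t.
  have [[s [Is st]]|ns] := pselect (exists s, I s /\ s < t).
    have lt : Num.max s (t - d) < t by rewrite gt_max st gtrBl.
    have [r /andP[sr rt]] := rational_between lt; exists r.
    have Ir : I (ratr r).
      apply: (I_interval Is It); rewrite (ltW rt) andbT ltW//.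
      by apply: le_lt_trans sr; rewrite le_max lexx.
    rewrite /g asboolT// (ltW rt); split=> //.
    by apply: le_lt_trans sr; rewrite le_max lexx orbT.
  have tmin s : I s -> t <= s.
    by move=> Is; rewrite leNgt; apply/negP => st; apply: ns; exists s.
  have ti : inf I = t.
    apply/eqP; rewrite eq_le; apply/andP; split.
      by apply: ge_inf => //; exists t => s /tmin.
    by apply: lb_le_inf; [exists t|move=> s /tmin].
  have lt : t - d < t by rewrite gtrBl.
  have [r /andP[_ rt]] := rational_between lt; exists r.
  have nIr : ~ I (ratr r) by move=> /tmin; rewrite leNgt rt.
  have ru : ratr r < u by apply: (lt_le_trans rt); exact: tmin.
  by rewrite /g asboolF// leNgt ru/= ti asboolT.
suff [r2 [h1 h2]] : exists r, t <= g r /\ g r < t + d by exists r1, r2.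
have [[s [Is ts]]|ns] := pselect (exists s, I s /\ t < s).
  have lt : t < Num.min s (t + d) by rewrite lt_min ts ltrDl.
  have [r /andP[tr rs]] := rational_between lt; exists r.
  have Ir : I (ratr r).
    apply: (I_interval It Is); rewrite (ltW tr)/= ltW//.
    by apply: (lt_le_trans rs); rewrite ge_min lexx.
  rewrite /g asboolT// (ltW tr); split=> //.
  by apply: (lt_le_trans rs); rewrite ge_min lexx orbT.
have tmax s : I s -> s <= t.
  by move=> Is; rewrite leNgt; apply/negP => st; apply: ns; exists s.
have ts : sup I = t.
  apply/eqP; rewrite eq_le; apply/andP; split.
    by apply: ge_sup; [exists t|move=> s /tmax].
  by apply: ub_le_sup => //; exists t => s /tmax.
have lt : t < t + d by rewrite ltrDl.
have [r /andP[tr _]] := rational_between lt; exists r.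
have nIr : ~ I (ratr r) by move=> /tmax; rewrite leNgt tr.
have ur : u <= ratr r by apply: le_trans (ltW tr); exact: tmax.
by rewrite /g asboolF// ur/= ts asboolT.
Qed.

End SegmentBase.

Section Sard.
Context {R : realType} (I : set R).
Hypothesis I_interval : is_interval I.
Hypothesis I_nondeg : exists u v, [/\ I u, I v & u < v].

(** A one-parameter family of functions that moves at a definite speed (constant c) when the
    parameter changes cannot have a double zero for every value of the parameter. This is the
    elementary heart of all genericity arguments below, a Sard lemma for functions that are
    only known to be continuously differentiable in t. Take N + 1 equidistant parameters and
    place each in one of N bins according to the position of its double zero. Two of them
    share a bin; near its double zero the function is flat, so by the mean value theorem the
    two functions differ there by less than the spacing of the parameters allows. *)
Lemma no_slice_of_double_zeros (a b c eps : R) (f f' : R -> R -> R) :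
  I a -> I b -> 0 < c -> 0 < eps ->
  (forall h t, I t -> dI I (f h) t (f' h t)) ->
  (forall e, 0 < e -> exists2 th, 0 < th & forall h t s, 0 <= h <= eps ->
     a <= t <= b -> a <= s <= b -> `|t - s| < th -> `|f' h t - f' h s| < e) ->
  (forall h h' t, 0 <= h <= eps -> 0 <= h' <= eps -> a <= t <= b ->
     c * `|h - h'| <= `|f h t - f h' t|) ->
  ~ (forall h, 0 <= h <= eps -> exists t, [/\ a <= t <= b, f h t = 0 & f' h t = 0]).
Proof.
move=> Ia Ib c0 eps0 Df unif low zeros.
have [t0 [/andP[at0 t0b] _ _]] := zeros 0 ltac:(by rewrite lexx ltW).
have ab : a <= b := le_trans at0 t0b.
have HI t : a <= t <= b -> I t by exact: (I_interval Ia Ib).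
pose L := b - a + 1; have L0 : 0 < L by rewrite ltr_wpDl// subr_ge0.
(* This oscillation of the derivative costs half of the separation c eps / N over a bin of
   length L / N. *)
have e0 : 0 < c * eps / (2 * L) by rewrite divr_gt0// mulr_gt0.
have [th th0 {}unif] := unif _ e0.
pose N := (Num.truncn (L / th)).+1.
have N0 : 0 < N%:R :> R by rewrite ltr0n.
have LN : L / N%:R < th by rewrite ltr_pdivrMr// mulrC -ltr_pdivrMr// truncnS_gt.
pose hh (k : 'I_N.+1) : R := eps * k%:R / N%:R.
have hhP k : 0 <= hh k <= eps.
  rewrite divr_ge0 ?mulr_ge0 ?(ltW eps0)//= ler_pdivrMr// ler_pM2l// ler_nat.
  by rewrite -ltnS.
have /choice[tt ttP] : forall k, exists t,
  [/\ a <= t <= b, f (hh k) t = 0 & f' (hh k) t = 0] by move=> k; exact: zeros.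
have posP k : 0 <= (tt k - a) * N%:R / L < N%:R.
  have [/andP[at1 tb] _ _] := ttP k.
  rewrite divr_ge0 ?mulr_ge0 ?subr_ge0 ?(ltW L0)//= ltr_pdivrMr// mulrC ltr_pM2l//.
  by rewrite /L; lra.
pose bin (k : 'I_N.+1) : 'I_N := inord (Num.truncn ((tt k - a) * N%:R / L)).
have binE k : bin k = Num.truncn ((tt k - a) * N%:R / L) :> nat.
  rewrite inordK// -(@ltr_nat R); have /andP[p1 p2] := posP k.
  by apply: le_lt_trans p2; rewrite truncn_le.
have : ~ injective bin.
  by move=> /leq_card; rewrite !card_ord ltnn.
apply => i j Eij; apply/eqP; apply: contraT => ij; exfalso.
have close : `|tt i - tt j| < L / N%:R.
  have E : Num.truncn ((tt i - a) * N%:R / L) = Num.truncn ((tt j - a) * N%:R / L).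
    by rewrite -!binE Eij.
  have /andP[pi _] := posP i; have /andP[pj _] := posP j.
  have /andP[i1 i2] := truncn_itv pi; have /andP[j1 j2] := truncn_itv pj.
  rewrite E -natr1 in i1 i2; rewrite -natr1 in j2.
  move: i1 i2 j1 j2; set x := _%:R; set X := _ / L; set Y := _ / L => i1 i2 j1 j2.
  have -> : tt i - tt j = (X - Y) * (L / N%:R).
    by rewrite /X /Y; field; rewrite !gt_eqF.
  rewrite normrM (@ger0_norm _ (L / _)); last by rewrite divr_ge0 ?ltW.
  rewrite gtr_pMl ?divr_gt0// ltr_norml; apply/andP; split; lra.
have far : eps / N%:R <= `|hh i - hh j|.
  have -> : hh i - hh j = (i%:R - j%:R) * (eps / N%:R) by rewrite /hh; ring.
  rewrite normrM (@ger0_norm _ (eps / _)); last by rewrite divr_ge0 ?ltW.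
  rewrite ler_peMl ?divr_ge0 ?(ltW eps0) ?(ltW N0)//.
  have : (i != j :> nat) by [].
  rewrite neq_ltn => /orP[|] ij'; [rewrite distrC|]; rewrite ger0_norm ?subr_ge0 ?ler_nat ?(ltnW ij')//;
  by rewrite lerBrDr nat1r ler_nat.
have [ti fi f'i] := ttP i; have [tj fj f'j] := ttP j.
(* One of the two points is a zero of the derivative of f (hh i), whichever comes first. *)
have bound : `|f (hh i) (tt j) - f (hh i) (tt i)| <=
    c * eps / (2 * L) * `|tt i - tt j|.
  have key x y : a <= x <= b -> a <= y <= b -> x < y -> `|x - y| < th ->
      f' (hh i) x = 0 \/ f' (hh i) y = 0 ->
      `|f (hh i) y - f (hh i) x| <= c * eps / (2 * L) * `|x - y|.
    move=> xab yab xy xyth f0.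
    have [s [xs sy ->]] := dI_MVT I_interval (Df (hh i)) (HI _ xab) (HI _ yab) xy.
    rewrite normrM [`|x - y|]distrC ler_wpM2r//.
    move: (xab) (yab) => /andP[ax xb] /andP[ay yb].
    have sab : a <= s <= b by rewrite (le_trans ax (ltW xs)) (le_trans (ltW sy) yb).
    rewrite distrC ger0_norm ?subr_ge0 ?(ltW xy)// in xyth.
    case: f0 => f0.
      have := unif (hh i) s x (hhP i) sab xab; rewrite f0 subr0 => h; apply/ltW/h.
      by rewrite ger0_norm ?subr_ge0 ?(ltW xs)//; lra.
    have := unif (hh i) s y (hhP i) sab yab; rewrite f0 subr0 => h; apply/ltW/h.
    by rewrite distrC ger0_norm ?subr_ge0 ?(ltW sy)//; lra.
  have [lt|lt|->] := ltgtP (tt i) (tt j).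
  - by apply: key => //; [exact: lt_trans close LN|left].
  - rewrite distrC [`|tt i - _|]distrC; apply: key => //; last by right.
    by rewrite distrC; exact: lt_trans close LN.
  - by rewrite !subrr normr0 mulr0.
have := low (hh i) (hh j) (tt j) (hhP i) (hhP j) tj.
rewrite fj subr0 => low1; rewrite fi subr0 in bound.
have : c * (eps / N%:R) <= c * eps / (2 * L) * (L / N%:R).
  apply: (le_trans (ler_wpM2l (ltW c0) far)); apply: (le_trans low1).
  by apply: (le_trans bound); rewrite ler_wpM2l// ltW.
have -> : c * eps / (2 * L) * (L / N%:R) = c * (eps / N%:R) / 2.
  by field; rewrite !gt_eqF.
by rewrite leNgt ltr_pdivrMr// ltr_pMr ?ltr1n// mulr_gt0// divr_gt0.
Qed.

End Sard.

Section Residual.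
Context {T : topologicalType}.

Lemma residual_bigcap (J : countType) (G : J -> set T) :
  (forall j, open (G j) /\ dense (G j)) -> residual (\bigcap_j G j).
Proof.
move=> H; exists (fun n => if unpickle n is Some j then G j else setT); split.
  move=> n; case: unpickle => [j|]; first exact: H.
  split; [exact: openT|by move=> O O0 _; rewrite setIT].
by move=> x Hx j _; have := Hx (pickle j) Logic.I; rewrite pickleK.
Qed.

Lemma residualS (A B : set T) : A `<=` B -> residual A -> residual B.
Proof. by move=> AB [G [H GA]]; exists G; split=> //; exact: subset_trans GA AB. Qed.

Lemma residualI (A B : set T) : residual A -> residual B -> residual (A `&` B).
Proof.
move=> [G [HG GA]] [H [HH HB]].
apply: (@residualS (\bigcap_(x : nat + nat) match x with inl n => G n | inr n => H n end)).
  move=> x Hx; split; [apply: GA => n _; exact: (Hx (inl n))|].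
  by apply: HB => n _; exact: (Hx (inr n)).
by apply: residual_bigcap => -[].
Qed.

End Residual.

(* Matrices of parameters form a complete normed space, to which Baire's theorem applies. *)
HB.instance Definition _ (K : realType) m n := NormedModule.on 'M[K]_(m, n).

Lemma residual_dense {R : realType} {V : completeNormedModType R} (A : set V) :
  residual A -> dense A.
Proof.
move=> [G [HG GA]] O O0 oO; have [x [Ox Gx]] := Baire HG O0 oO.
by exists x; split=> //; exact: GA.
Qed.

Section GenericParameter.
Context {R : realType} (I : set R).
Hypothesis I_interval : is_interval I.
Hypothesis I_nondeg : exists u v, [/\ I u, I v & u < v].
Context {V : normedModType R}.
Implicit Types (f : V -> R -> R) (z : V) (t : R).

Lemma near_normP z (P : set V) :
  (\forall y \near z, P y) <-> exists2 d, 0 < d & forall y, `|y - z| < d -> P y.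
Proof.
split=> [/nbhs_ballP[d /= d0 H]|[d d0 H]].
  by exists d => // y yd; apply: H; rewrite -ball_normE /ball_ /= distrC.
by apply/(nbhs_ballP z P).2; exists d => // y; rewrite -ball_normE /ball_ /= distrC; apply: H.
Qed.

Definition jcont f := forall z0 t0 e, I t0 -> 0 < e -> exists2 d, 0 < d &
  forall z t, I t -> `|z - z0| < d -> `|t - t0| < d -> `|f z t - f z0 t0| < e.

(** Moving the parameter along v moves the value of f at a speed bounded below, uniformly near
    (z0, t0). For f differentiable in z this says that the derivative along v is nonzero; this
    form avoids differentiating with respect to z. *)
Definition moved_by f (v : V) z0 t0 := exists c d : R, [/\ 0 < c, 0 < d &
  forall z t h, I t -> `|z - z0| < d -> `|z + h *: v - z0| < d -> `|t - t0| < d ->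
    c * `|h| <= `|f (z + h *: v) t - f z t|].

Lemma near_segment (a b : R) (P : V -> R -> Prop) z0 : I a -> I b ->
  (forall t0, a <= t0 <= b -> exists2 d, 0 < d &
     forall z t, I t -> `|z - z0| < d -> `|t - t0| < d -> P z t) ->
  \forall z \near z0, forall t, a <= t <= b -> P z t.
Proof.
move=> Ia Ib H.
have := (compact_near_coveringP `[a, b]%classic).1 (@segment_compact R a b).
move=> /(_ V (nbhs z0) (fun z t => I t -> P z t) _) K.
have : \forall z \near z0, `[a, b]%classic `<=` (fun t => I t -> P z t).
  apply: K => t /= /itvP tab.
  have [d d0 {}H] := H t ltac:(by rewrite !tab).
  exists (ball t d, ball z0 d); first by split=> /=; exact: nbhsx_ballx.
  move=> [t' z'] /= [bt bz] It'; apply: H => //.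
    by rewrite distrC; move: bz; rewrite -ball_normE.
  by rewrite distrC.
apply: filterS => z Hz t tab; apply: Hz; first by rewrite /= in_itv.
exact: (I_interval Ia Ib).
Qed.

(** Uniform continuity on a compact slice, the hypothesis on the derivative in
    no_slice_of_double_zeros. *)
Lemma unif_cont_slice f z (v : V) (a b eps : R) : jcont f -> I a -> I b ->
  forall e, 0 < e -> exists2 th, 0 < th & forall h t s, 0 <= h <= eps ->
     a <= t <= b -> a <= s <= b -> `|t - s| < th ->
     `|f (z + h *: v) t - f (z + h *: v) s| < e.
Proof.
move=> Cf Ia Ib e e0.
have HI t : a <= t <= b -> I t by exact: (I_interval Ia Ib).
have := (compact_near_coveringP _).1
  (compact_setX (@segment_compact R 0 eps) (@segment_compact R a b)).
pose P (th : R) (ht : R * R) := a <= ht.2 <= b -> forall s, a <= s <= b ->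
  `|ht.2 - s| < th -> `|f (z + ht.1 *: v) ht.2 - f (z + ht.1 *: v) s| < e.
move=> /(_ R 0^'+ P _) K.
have : \forall th \near 0^'+, (`[0, eps]%classic `*` `[a, b]%classic) `<=` P th.
  apply: K => -[h t] /= [_ /itvP tab].
  have tI : I t by apply: HI; rewrite !tab.
  have [d d0 D] := Cf (z + h *: v) t (e / 2) tI ltac:(by rewrite divr_gt0).
  pose r := Num.min (d / 2) (d / (1 + `|v|)).
  have v1 : 0 < 1 + `|v| by rewrite ltr_wpDr.
  have r0 : 0 < r by rewrite lt_min !divr_gt0.
  have rd : r <= d / 2 by rewrite ge_min lexx.
  have rv : r * `|v| < d.
    have : r * (1 + `|v|) <= d by rewrite -ler_pdivlMr// ge_min lexx orbT.
    by apply: lt_le_trans; rewrite mulrDr mulr1 ltrDr.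
  exists (ball h r `*` ball t r, [set th | th < r]).
    split=> /=; last exact: nbhs_right_lt.
    by exists (ball h r, ball t r) => //; split; exact: nbhsx_ballx.
  move=> [[h' t'] th] /= [[bh bt] thr] t'ab s sab ts.
  rewrite /ball /= in bh bt.
  have zh : `|z + h' *: v - (z + h *: v)| < d.
    rewrite opprD addrACA subrr add0r -scalerBl normrZ distrC.
    by apply: le_lt_trans rv; rewrite ler_wpM2r// ltW.
  have tt' : `|t' - t| < d by rewrite distrC; apply: (lt_le_trans bt); lra.
  have st : `|s - t| < d.
    rewrite -(subrK t' s) -addrA (le_lt_trans (ler_normD _ _))//.
    rewrite distrC [`|t' - t|]distrC.
    have := lt_trans ts thr; move: bt rd; set x := `|t' - s|; set y := `|t - t'|; lra.
  have D1 := D _ _ (HI _ t'ab) zh tt'; have D2 := D _ _ (HI _ sab) zh st.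
  set A := f _ t'; set B := f _ s; set C := f (z + h *: v) t in D1 D2 *.
  rewrite -/A in D1; rewrite -/B in D2.
  rewrite (_ : A - B = (A - C) - (B - C)); last by ring.
  by rewrite (le_lt_trans (ler_normB _ _))//; lra.
move=> H.
have /filter_ex[th [th0 {}H]] :
    \forall th \near 0^'+, 0 < th /\ (`[0, eps]%classic `*` `[a, b]%classic) `<=` P th.
  by apply: filterI => //; exact: nbhs_right_gt.
exists th => // h t s hab tab sab; exact: (H (h, t)).
Qed.

(** Parametric transversality for curves t |-> (F t, F' t), which generically miss the origin
    because it has codimension two. Cut the problem into countably many pieces: a member i of
    the family, a direction e j, a segment of I and a quantitative form (low) of the fact that
    e j moves F i. On each piece the good parameters form an open set, by compactness of the
    segment, which is dense since otherwise a whole slice z + h e j, h in [0, eps], would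
    consist of bad parameters. *)
Theorem generic_simple_zeros (A J : countType) (e : J -> V) (F F' : A -> V -> R -> R) :
  (forall i z t, I t -> dI I (F i z) t (F' i z t)) ->
  (forall i, jcont (F i)) -> (forall i, jcont (F' i)) ->
  residual [set z | forall t, I t -> (exists i j, moved_by (F i) (e j) z t) ->
    exists i, F i z t != 0 \/ F' i z t != 0].
Proof.
move=> DF CF CF'.
have [q [Iq qP]] := segment_base I_interval I_nondeg.
pose r (n : nat) : R := n.+1%:R^-1.
have r0 n : 0 < r n by rewrite invr_gt0 ltr0n.
pose seg (n1 n2 : nat) t := q n1 <= t <= q n2.
have segI n1 n2 t : seg n1 n2 t -> I t by exact: I_interval.
pose low (x : (A * J) * (nat * (nat * nat))) z := forall z' t h,
  seg x.2.2.1 x.2.2.2 t -> `|z' - z| < r x.2.1 ->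
  `|z' + h *: e x.1.2 - z| < r x.2.1 ->
  r x.2.1 * `|h| <= `|F x.1.1 (z' + h *: e x.1.2) t - F x.1.1 z' t|.
pose bad (x : (A * J) * (nat * (nat * nat))) z t := F x.1.1 z t = 0 /\ F' x.1.1 z t = 0.
pose G x : set V := [set z | low x z -> forall t, seg x.2.2.1 x.2.2.2 t -> ~ bad x z t].
apply: (residualS (A := \bigcap_x G x)); last first.
  apply: residual_bigcap => x; split.
    rewrite openE => z; rewrite /interior /= => Gz.
    (* Where low fails it fails nearby, by strict inequalities, and G x holds vacuously. *)
    have [lz|nlz] := pselect (low x z); last first.
      have [[[z' t] h] /= nH] : exists y : (V * R) * R, ~ (seg x.2.2.1 x.2.2.2 y.1.2 ->
          `|y.1.1 - z| < r x.2.1 -> `|y.1.1 + y.2 *: e x.1.2 - z| < r x.2.1 ->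
          r x.2.1 * `|y.2| <= `|F x.1.1 (y.1.1 + y.2 *: e x.1.2) y.1.2 - F x.1.1 y.1.1 y.1.2|).
        apply: contrapT => /forallNP nex; apply: nlz => z' t h.
        by have := nex ((z', t), h); rewrite notK.
      have {nH}[ts [h1 [h2 nH]]] : seg x.2.2.1 x.2.2.2 t /\ `|z' - z| < r x.2.1 /\
          `|z' + h *: e x.1.2 - z| < r x.2.1 /\ ~ (r x.2.1 * `|h| <=
             `|F x.1.1 (z' + h *: e x.1.2) t - F x.1.1 z' t|).
        by move: nH => /not_implyP[? /not_implyP[? /not_implyP[? ?]]].
      apply/near_normP; exists (Num.min (r x.2.1 - `|z' - z|)
          (r x.2.1 - `|z' + h *: e x.1.2 - z|)); first by rewrite lt_min !subr_gt0 h1.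
      move=> y; rewrite lt_min => /andP[y1 y2] ly; exfalso; apply: nH.
      apply: ly => //.
        rewrite -(subrK z z') -addrA (le_lt_trans (ler_normD _ _))//.
        by rewrite [`|z - y|]distrC -ltrBrDl.
      rewrite -(subrK z (z' + _)) -addrA (le_lt_trans (ler_normD _ _))//.
      by rewrite [`|z - y|]distrC -ltrBrDl.
    have Gz' := Gz lz.
    suff : \forall y \near z, forall t, seg x.2.2.1 x.2.2.2 t -> ~ bad x y t.
      by apply: filterS => y Hy _.
    apply: near_segment; [exact: Iq|exact: Iq|] => t ts.
    have [F0|F0] := eqVneq (F x.1.1 z t) 0; last first.
      have [d d0 H] := CF x.1.1 z t `|F x.1.1 z t| (segI _ _ _ ts)
         ltac:(by rewrite normr_gt0).
      exists d => // y s Is yd sd [E _]; have := H y s Is yd sd.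
      by rewrite E sub0r normrN ltxx.
    have F'0 : F' x.1.1 z t != 0.
      by apply/eqP => E; apply: (Gz' t ts).
    have [d d0 H] := CF' x.1.1 z t `|F' x.1.1 z t| (segI _ _ _ ts)
       ltac:(by rewrite normr_gt0).
    exists d => // y s Is yd sd [_ E]; have := H y s Is yd sd.
    by rewrite E sub0r normrN ltxx.
  move=> O [z Oz] oO; apply: contrapT => nO.
  have badO y : O y -> low x y /\ exists t, seg x.2.2.1 x.2.2.2 t /\ bad x y t.
    move=> Oy; have : ~ G x y by move=> Gy; apply: nO; exists y.
    move=> /not_implyP[ly nb]; split=> //; apply: contrapT => /forallNP nex.
    by apply: nb => t ts bt; apply: (nex t).
  have /near_normP[d d0 Od] := open_nbhs_nbhs (conj oO Oz).
  pose v := e x.1.2; have v1 : 0 < 1 + `|v| by rewrite ltr_wpDr.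
  pose eps := Num.min (d / 2) (r x.2.1 / 2) / (1 + `|v|).
  have m0 : 0 < Num.min (d / 2) (r x.2.1 / 2) by rewrite lt_min !divr_gt0.
  have eps0 : 0 < eps by rewrite divr_gt0.
  have small h : 0 <= h <= eps -> `|h *: v| < d /\ `|h *: v| < r x.2.1.
    move=> /andP[h0 he].
    have : `|h *: v| <= Num.min (d / 2) (r x.2.1 / 2).
      rewrite normrZ ger0_norm//; apply: (@le_trans _ _ (eps * `|v|)).
        by rewrite ler_wpM2r.
      rewrite /eps -mulrA ger_pMr// ler_pdivrMl// mulr1.
      by rewrite ler_wpDl.
    rewrite le_min => /andP[x1 x2].
    by split; [apply: (le_lt_trans x1)|apply: (le_lt_trans x2)];
      rewrite ltr_pdivrMr// ltr_pMr// ltr1n.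
  have zO h : 0 <= h <= eps -> O (z + h *: v).
    by move=> hh; apply: Od; rewrite addrAC subrr add0r; case: (small h hh).
  have lz : low x z.
    by have [] := badO z Oz.
  apply: (@no_slice_of_double_zeros _ I I_interval (q x.2.2.1) (q x.2.2.2) (r x.2.1) eps
    (fun h => F x.1.1 (z + h *: v)) (fun h => F' x.1.1 (z + h *: v))) => //.
  - by move=> h t; exact: DF.
  - by apply: unif_cont_slice.
  - move=> h h' t hh hh' ts.
    have := lz (z + h' *: v) t (h - h') ts.
    have -> : z + h' *: v + (h - h') *: e x.1.2 = z + h *: v.
      by rewrite -addrA -scalerDl (addrC h') subrK.
    rewrite [z + h' *: v]addrC [z + h *: v]addrC !addrK.
    by apply; [case: (small h' hh')|case: (small h hh)].
  - move=> h hh; have [_ [t [ts [b1 b2]]]] := badO _ (zO h hh).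
    by exists t.
move=> z Gz t It [i [j [c [d [c0 d0 H]]]]].
apply: contrapT => /forallNP nex.
have bz : F i z t = 0 /\ F' i z t = 0.
  have := nex i; split; apply/eqP; apply: contraT => h; exfalso; apply: (nex i); tauto.
have m0 : 0 < Num.min c d by rewrite lt_min c0.
pose n := Num.truncn (Num.min c d)^-1.
have rn : r n < Num.min c d.
  rewrite /r -[X in _ < X]invrK ltf_pV2 ?posrE ?invr_gt0 ?ltr0n//.
  exact: truncnS_gt.
move: rn; rewrite lt_min => /andP[rc rd].
have [n1 [n2 [q1 q1' q2 q2']]] := qP t d It d0.
have ts : seg n1 n2 t by rewrite /seg q1' q2.
have := Gz ((i, j), (n, (n1, n2))) Logic.I; rewrite /G /=.
move=> /(_ _ t ts); apply => //= z' s h /= ss h1 h2.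
apply: (@le_trans _ _ (c * `|h|)); first by rewrite ler_wpM2r// ltW.
apply: H; [exact: (segI _ _ _ ss)|exact: lt_trans h1 rd|exact: lt_trans h2 rd|].
move: ss => /andP[s1 s2]; rewrite ltr_norml; apply/andP; split; lra.
Qed.

End GenericParameter.

Section GenericLinearForm.
Context {R : realType} (I : set R).
Hypothesis I_interval : is_interval I.
Hypothesis I_nondeg : exists u v, [/\ I u, I v & u < v].

Lemma simple_zero_isolated f (t l : R) : dI I f t l -> f t = 0 -> l != 0 ->
  exists2 d, 0 < d & forall s, I s -> `|s - t| < d -> f s = 0 -> s = t.
Proof.
move=> /dIP H f0 l0.
have [d d0 {}H] := H (`|l| / 2) ltac:(by rewrite divr_gt0// normr_gt0).
exists d => // s Is sd fs; have := H s Is sd.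
rewrite f0 fs subr0 sub0r normrN normrM => K.
apply/eqP; rewrite -subr_eq0 -normr_eq0; apply: contraT => n0.
have p : 0 < `|s - t| by rewrite lt_neqAle eq_sym n0 /=.
by move: K; rewrite ler_pM2r// leNgt ltr_pdivrMr// ltr_pMr ?ltr1n// normr_gt0.
Qed.

Lemma dot_continuous n (w : 'rV[R]_n) : continuous (fun c : 'rV[R]_n => dot c w).
Proof.
move=> c; rewrite /dot; apply: cvg_big; [exact: add_continuous|exact: nbhs_filter|move=> i _].
have C : (fun c : 'rV[R]_n => c 0 i) @ c --> c 0 i by exact: coord_continuous.
exact: (cvgM C (cvg_cst (w 0 i))).
Qed.

Lemma dotDl n (a b c : 'rV[R]_n) : dot (a + b) c = dot a c + dot b c.
Proof. by rewrite /dot -big_split /=; apply: eq_bigr => i _; rewrite mxE mulrDl. Qed.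

Lemma dotZl n (k : R) (a b : 'rV[R]_n) : dot (k *: a) b = k * dot a b.
Proof. by rewrite /dot mulr_sumr; apply: eq_bigr => i _; rewrite mxE mulrA. Qed.

Lemma dotC n (a b : 'rV[R]_n) : dot a b = dot b a.
Proof. by apply: eq_bigr => i _; rewrite mulrC. Qed.

Lemma dotDr n (a b c : 'rV[R]_n) : dot a (b + c) = dot a b + dot a c.
Proof. by rewrite !(dotC a) dotDl. Qed.

Lemma dot_ge0 n (a : 'rV[R]_n) : 0 <= dot a a.
Proof. by apply: sumr_ge0 => i _; rewrite -expr2 sqr_ge0. Qed.

Lemma dot_eq0 n (a : 'rV[R]_n) : (dot a a == 0) = (a == 0).
Proof.
apply/idP/eqP => [|->]; last first.
  by rewrite /dot big1// => i _; rewrite mxE mul0r.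
rewrite psumr_eq0 => [/allP H|i _]; last by rewrite -expr2 sqr_ge0.
apply/rowP => i; rewrite mxE; apply/eqP.
by have := H i (mem_index_enum i); rewrite /= mulf_eq0 orbb.
Qed.

(** Avoiding one hyperplane for each simple zero of h i: simple zeros are isolated, so that
    there are countably many of them. In practice each segment of a countable family on which
    h i has at most one zero contributes at most one hyperplane. *)
Lemma residual_linear_form n (A : countType) (h h' : A -> R -> R)
    (a : A -> R -> R) (w : A -> R -> 'rV[R]_n) :
  (forall i t, I t -> dI I (h i) t (h' i t)) ->
  residual [set c | forall i t, I t -> h i t = 0 -> h' i t != 0 -> w i t != 0 ->
     a i t + dot c (w i t) != 0].
Proof.
move=> Dh; have [q [Iq qP]] := segment_base I_interval I_nondeg.
pose seg (x : A * (nat * nat)) t := q x.2.1 <= t <= q x.2.2.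
pose G x : set 'rV[R]_n := [set c |
  (forall s t, seg x s -> seg x t -> h x.1 s = 0 -> h x.1 t = 0 -> s = t) ->
  forall t, seg x t -> h x.1 t = 0 -> w x.1 t != 0 -> a x.1 t + dot c (w x.1 t) != 0].
apply: (residualS (A := \bigcap_x G x)) => [c Gc i t It h0 h'0 w0|].
  have [d d0 H] := simple_zero_isolated (Dh i t It) h0 h'0.
  have [n1 [n2 [q1 q1' q2 q2']]] := qP t d It d0.
  have near_t s : seg (i, (n1, n2)) s -> h i s = 0 -> s = t.
    move=> /andP[/= s1 s2] hs; apply: H hs.
      by apply: (I_interval (Iq n1) (Iq n2)); rewrite s1 s2.
    by rewrite ltr_norml; apply/andP; split; lra.
  apply: (Gc (i, (n1, n2)) Logic.I _ t) => //=; last by rewrite /seg /= q1' q2.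
  by move=> s s' S S' hs hs'; rewrite (near_t s)// (near_t s').
apply: residual_bigcap => x.
have [uniq|nuniq] := pselect (forall s t, seg x s -> seg x t -> h x.1 s = 0 -> h x.1 t = 0 -> s = t); last first.
  have -> : G x = setT by apply/seteqP; split=> // c _ /nuniq.
  by split; [exact: openT|move=> O O0 _; rewrite setIT].
have [[t [ts [t0 w0]]]|nt] := pselect (exists t, seg x t /\ h x.1 t = 0 /\ w x.1 t != 0); last first.
  have -> : G x = setT.
    by apply/seteqP; split=> // c _ _ t ts t0 w0; exfalso; apply: nt; exists t.
  by split; [exact: openT|move=> O O0 _; rewrite setIT].
have -> : G x = [set c | a x.1 t + dot c (w x.1 t) != 0].
  apply/seteqP; split=> c /= Gc; first exact: Gc.
  by move=> _ s ss s0 _; rewrite (uniq s t).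
split.
  apply: (@open_comp _ _ (fun c => a x.1 t + dot c (w x.1 t)) [set y : R | y != 0]).
    move=> c _; have C : (fun c => dot c (w x.1 t)) @ c --> dot c (w x.1 t) by exact: dot_continuous.
    exact: (cvgD (cvg_cst (a x.1 t)) C).
  exact: open_neq.
move=> O [c Oc] oO; have [c0|c0] := eqVneq (a x.1 t + dot c (w x.1 t)) 0; last by exists c.
have /near_normP[d d0 Od] := open_nbhs_nbhs (conj oO Oc).
pose k := d / 2 / (1 + `|w x.1 t|).
have n0 : 0 < 1 + `|w x.1 t| by rewrite ltr_wpDr.
have k0 : 0 < k by rewrite !divr_gt0.
exists (c + k *: w x.1 t); split.
  apply: Od; rewrite addrAC subrr add0r normrZ gtr0_norm//.
  apply: (@le_lt_trans _ _ (d / 2)); last by rewrite ltr_pdivrMr// ltr_pMr// ltr1n.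
  rewrite /k -[X in X <= _]mulrA ger_pMr ?divr_gt0// ler_pdivrMl// mulr1.
  by rewrite ler_wpDl.
by rewrite /= dotDl addrA c0 add0r dotZl mulf_neq0 ?gt_eqF// lt_neqAle eq_sym dot_eq0 w0 dot_ge0.
Qed.

End GenericLinearForm.

(** * Small positive functions on an interval *)

Section Bump.
Context {R : realType}.

(** The family t^(-k) exp(-1/t) is closed under differentiation, which makes its member with
    k = 0 smooth; the other members serve only to express the derivatives. *)
Definition flat (k : nat) (t : R) : R :=
  if 0 < t then t^-1 ^+ k * expR (- t^-1) else 0.

Lemma flat_ge0 k t : 0 <= flat k t.
Proof.
by rewrite /flat; case: ifPn => // t0; rewrite mulr_ge0 ?expR_ge0// exprn_ge0// invr_ge0 ltW.
Qed.

Lemma flat0_gt0 t : 0 < t -> 0 < flat 0 t.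
Proof. by move=> t0; rewrite /flat t0 expr0 mul1r expR_gt0. Qed.

Lemma flat_le0 k t : t <= 0 -> flat k t = 0.
Proof. by move=> t0; rewrite /flat ltNge t0. Qed.

(** The exponential beats every power; the square on the right makes flat k differentiable
    at 0 with derivative 0. *)
Lemma flat_bound k t : 0 < t -> flat k t <= (k.+2)`!%:R * t ^+ 2.
Proof.
move=> t0; rewrite /flat t0 expRN.
set y := t^-1; have y0 : 0 < y by rewrite invr_gt0.
have H : y ^+ k.+2 / (k.+2)`!%:R <= expR y.
  by apply: le_trans (expR_ge1Dxn k.+1 (ltW y0)); rewrite lerDr.
have f0 : 0 < (k.+2)`!%:R :> R by rewrite ltr0n fact_gt0.
rewrite ler_pdivrMr ?expR_gt0//.
apply: le_trans (ler_wpM2l _ H); last by rewrite mulr_ge0 ?ltW// exprn_gt0.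
have -> : t = y^-1 by rewrite invrK.
rewrite le_eqVlt; apply/orP; left; apply/eqP.
move: f0; set c := _%:R => f0; rewrite [y ^+ k.+2]exprS [y ^+ k.+1]exprS.
by field; rewrite !gt_eqF.
Qed.

Lemma dI_pow (J : set R) f (t l : R) k : dI J f t l ->
  dI J (fun s => f s ^+ k) t (k%:R * f t ^+ k.-1 * l).
Proof.
move=> H; elim: k => [|k IH]; first by rewrite !mul0r; exact: dI_cst.
rewrite (_ : (fun s => _) = fun s => f s * f s ^+ k); last first.
  by apply/funext => s; rewrite exprS.
have := dI_mul H IH; congr (dI J _ t _).
case: k {IH} => [|k] /=; first by rewrite !expr0; ring.
by rewrite -[k.+2%:R]natr1 exprS; ring.
Qed.

Lemma dI_flat k t : dI setT (flat k) t (flat k.+2 t - k%:R * flat k.+1 t).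
Proof.
have [t0|t0|->] := ltgtP t 0.
- rewrite !flat_le0 ?(ltW t0)// mulr0 subr0.
  have tn : 0 < - t by rewrite oppr_gt0.
  apply: (dI_ext_near (I := setT) tn _ _ _ (dI_cst setT t 0)) => //.
    move=> s; rewrite ltr_norml => /andP[_ h] _; split=> //.
    by rewrite flat_le0// ltW//; lra.
  by rewrite flat_le0// ltW.
- have D : dI setT (fun s => s^-1 ^+ k * expR (- s^-1)) t
      (flat k.+2 t - k%:R * flat k.+1 t).
    have D1 : dI setT (fun s : R => s^-1) t (- (t^-1 ^+ 2)).
      have := dI_inv (f := id) (lt0r_neq0 t0) (dI_id setT t).
      by rewrite mulN1r.
    have D2 : dI setT (fun s : R => expR (- s^-1)) t (expR (- t^-1) * (-1 * - (t^-1 ^+ 2))).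
      apply: (dI_comp (J := setT) (f := fun s => - s^-1)) => //.
        have := dI_scale (c := -1) D1; rewrite (_ : (fun s => _) = (fun s => - s^-1)) //.
        by apply/funext => s; rewrite mulN1r.
      by apply: is_derive_dI; exact: is_derive_expR.
    have := dI_mul (dI_pow (k := k) D1) D2; congr (dI _ _ t _).
    rewrite /flat t0; case: k => [|k] /=.
      by rewrite !expr0; ring.
    by rewrite !exprS; ring.
  apply: (dI_ext_near (I := setT) t0 _ _ _ D) => //.
    move=> s; rewrite ltr_norml => /andP[h _] _; split=> //.
    by rewrite /flat (_ : 0 < s = true)//; lra.
  by rewrite /flat t0.
- rewrite !(flat_le0 _ (lexx 0)) mulr0 subr0; apply/dIP => e e0.
  have f0 : 0 < (k.+2)`!%:R :> R by rewrite ltr0n fact_gt0.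
  exists (e / (k.+2)`!%:R); first by rewrite divr_gt0.
  move=> s _; rewrite subr0 (flat_le0 _ (lexx 0)) subr0 mul0r subr0 => se.
  rewrite ger0_norm ?flat_ge0//.
  have [s0|s0] := leP s 0; first by rewrite flat_le0// mulr_ge0// ltW.
  rewrite gtr0_norm// in se *; apply: (le_trans (flat_bound k s0)).
  by rewrite expr2 mulrA ler_pM2r// mulrC -ler_pdivlMr// ltW.
Qed.

Definition bumpR (t : R) : R := flat 0 (1 + t) * flat 0 (1 - t).

Lemma bump_ge0 t : 0 <= bumpR t.
Proof. by rewrite mulr_ge0// flat_ge0. Qed.

Lemma bump_gt0 t : `|t| < 1 -> 0 < bumpR t.
Proof.
rewrite ltr_norml => /andP[h1 h2].
by rewrite mulr_gt0// flat0_gt0//; lra.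
Qed.

Lemma bump_out t : 1 <= `|t| -> bumpR t = 0.
Proof.
rewrite ler_normr => /orP[h|h]; rewrite /bumpR.
  by rewrite [flat 0 (1 - t)]flat_le0 ?mulr0//; lra.
by rewrite flat_le0 ?mul0r//; lra.
Qed.

Section Comp.
Variables (I : set R) (I_limpt : limpt I).

(** The generators inl n are the derivatives of f, and inr k is flat k of f. *)
Definition flatstep (x : nat + nat) : @dexp R (nat + nat) :=
  match x with
  | inl n => Gen (inl n.+1)
  | inr k => Mul (Add (Gen (inr k.+2)) (Mul (Cst _ (- k%:R)) (Gen (inr k.+1))))
                 (Gen (inl 1%N))
  end.

Lemma smooth_flat f : smooth I f -> smooth I (fun t => flat 0 (f t)).
Proof.
move=> Hf; pose env t (x : nat + nat) :=
  match x with inl n => deriven_in I n f t | inr k => flat k (f t) end.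
apply: (tower_smooth I_limpt (F := fun n s => eval (env s) (iter n (dd flatstep) (Gen (inr 0%N))))) => //.
apply: eval_tower => -[n|k] t It; first exact: (smooth_tower Hf).
have := dI_comp (J := setT) (fun _ _ => Logic.I) (dI_smooth Hf It) (@dI_flat k (f t)).
by congr (dI I _ t _) => /=; rewrite mulNr.
Qed.

Lemma smooth_bump f : smooth I f -> smooth I (fun t => bumpR (f t)).
Proof.
move=> H; apply: smooth_mul; [exact: I_limpt| |]; apply: (smooth_flat (f := fun t => _)).
  by apply: smooth_add; [exact: I_limpt|exact: smooth_cst|exact: H].
by apply: smooth_add; [exact: I_limpt|exact: smooth_cst|exact: smooth_opp].
Qed.
End Comp.
End Bump.

Section Proper.
Context {R : realType} (I : set R).
Hypothesis I_interval : is_interval I.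
Hypothesis I_nondeg : exists u v, [/\ I u, I v & u < v].
Let I_limpt : limpt I := interval_limpt I_interval I_nondeg.

(** The inverse of the distance to the right end of J, when J has a right end that it does
    not contain; otherwise 0 will do. *)
Lemma end_barrier (J : set R) : is_interval J -> (exists u v, [/\ J u, J v & u < v]) ->
  exists b : R -> R, [/\ smooth J b, forall t, J t -> 0 <= b t &
    forall t0, ~ J t0 -> (forall t, J t -> t < t0) -> forall M,
      exists2 d, 0 < d & forall t, J t -> `|t - t0| < d -> M < b t].
Proof.
move=> Ji Jn; have Jl := interval_limpt Ji Jn.
have [u [_ [Ju _ _]]] := Jn.
have [[t0 [nt0 ub]]|no] := pselect (exists t0, ~ J t0 /\ forall t, J t -> t < t0).
  have [[t1 [nt1 ub1 near1]]|no] := pselect (exists t1, [/\ ~ J t1, forall t, J t -> t < t1 &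
      forall d, 0 < d -> exists t, J t /\ `|t - t1| < d]).
    exists (fun t => (t1 - t)^-1); split.
    - apply: smooth_inv => // [|t Jt]; last by rewrite gt_eqF// subr_gt0 ub1.
      by apply: smooth_add; [exact: Jl|exact: smooth_cst|apply: smooth_opp; [exact: Jl|exact: smooth_id]].
    - by move=> t Jt; rewrite invr_ge0 subr_ge0 ltW// ub1.
    - move=> t2 nt2 ub2 M.
      have [lt|le] := ltP t1 t2.
        exists (t2 - t1); first by rewrite subr_gt0.
        move=> t Jt; rewrite ltr_norml => /andP[h _]; have := ub1 t Jt; lra.
      have [lt|ge] := ltP t2 t1.
        have [t [Jt]] := near1 (t1 - t2) ltac:(by rewrite subr_gt0).
        by rewrite ltr_norml => /andP[h _]; have := ub2 t Jt; lra.
      have -> : t2 = t1 by apply/eqP; rewrite eq_le le.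
      have M0 : 0 < 1 + `|M| by rewrite ltr_wpDr.
      exists (1 + `|M|)^-1; first by rewrite invr_gt0.
      move=> t Jt; rewrite distrC gtr0_norm ?subr_gt0 ?ub1// => h.
      rewrite (@lt_trans _ _ (1 + `|M|))//; first by rewrite (le_lt_trans (ler_norm _))// ltrDr.
      by rewrite -[X in X < _]invrK ltf_pV2// posrE ?invr_gt0// subr_gt0 ub1.
  exists (fun=> 0); split=> [|//|t1 nt1 ub1 M]; first exact: smooth_cst.
  have : ~ (forall d, 0 < d -> exists t, J t /\ `|t - t1| < d).
    by move=> h; apply: no; exists t1.
  move=> /existsNP[d /not_implyP[d0 nex]]; exists d => // t Jt td.
  by exfalso; apply: nex; exists t.
exists (fun=> 0); split=> [|//|t1 nt1 ub1 M]; first exact: smooth_cst.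
by exfalso; apply: no; exists t1.
Qed.

(** The square of t controls infinite ends, the barriers control finite ends that are missing
    from I; the left end is treated by reflection. *)
Lemma proper_function : exists s : R -> R, [/\ smooth I s, forall t, I t -> 0 <= s t &
  forall M, compact [set t | I t /\ s t <= M]].
Proof.
have [br [brs br0 brP]] := end_barrier I_interval I_nondeg.
pose J : set R := [set t | I (- t)].
have Ji : is_interval J.
  move=> x y /= Jx Jy z /andP[xz zy]; apply: (I_interval Jy Jx).
  by rewrite !lerN2 xz zy.
have Jn : exists u v, [/\ J u, J v & u < v].
  have [u [v [Iu Iv uv]]] := I_nondeg.
  by exists (- v), (- u); rewrite /J /= !opprK ltrN2.
have [bl [bls bl0 blP]] := end_barrier Ji Jn.
have JN t : I t -> J (- t) by rewrite /J /= opprK.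
have blN : smooth I (fun t => bl (- t)).
  pose F n t := (-1) ^+ n * deriven_in J n bl (- t).
  apply: (tower_smooth (F := F)) => // [n t It|t It]; last by rewrite /F expr0 mul1r.
  have D : dI I (fun s : R => - s) t (-1).
    rewrite (_ : (fun s => _) = (fun s => -1 * s)); last by apply/funext => s; rewrite mulN1r.
    by rewrite -[X in dI _ _ _ X]mulr1; apply: dI_scale; exact: dI_id.
  have := dI_comp JN D (smooth_tower bls (JN _ It)).
  move=> /(_ n) /(dI_scale (c := (-1) ^+ n)); congr (dI I _ t _).
  by rewrite /F exprSr; ring.
pose s t := t ^+ 2 + (br t + bl (- t)).
have ss : smooth I s.
  apply: smooth_add; [exact: I_limpt|apply: smooth_exp; [exact: I_limpt|exact: smooth_id]|].
  by apply: smooth_add; [exact: I_limpt|exact: brs|exact: blN].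
have sb t : I t -> [/\ t ^+ 2 <= s t, br t <= s t & bl (- t) <= s t].
  move=> It; have := br0 t It; have := bl0 _ (JN t It); have := sqr_ge0 t.
  by rewrite /s; move: (t ^+ 2) (br t) (bl _) => *; split; lra.
exists s; split=> [//|t It|M].
  by have [h _ _] := sb t It; apply: le_trans h; exact: sqr_ge0.
set K := [set t | _].
apply: (@subclosed_compact _ K `[- (1 + `|M|), 1 + `|M|]%classic); last first.
- move=> t [It st]; have [h _ _] := sb t It.
  have tM : t ^+ 2 <= (1 + `|M|) ^+ 2.
    apply: (le_trans h); apply: (le_trans st); apply: (le_trans (ler_norm _)).
    by have := normr_ge0 M; nra.
  rewrite /= in_itv /= -ler_norml -(ler_pXn2r (n := 2))// ?nnegrE ?addr_ge0//.
  by rewrite -normrX ger0_norm ?sqr_ge0.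
- exact: segment_compact.
move=> t0 clt0.
have near0 d : 0 < d -> exists t, [/\ I t, s t <= M & `|t - t0| < d].
  move=> d0; have [t [[It st] /= bt]] := clt0 _ (nbhsx_ballx t0 d d0).
  by exists t; split=> //; rewrite distrC.
have It0 : I t0.
  apply: contrapT => nI.
  have [t1 [It1 _ _]] := near0 1 ltr01.
  have side : (forall t, I t -> t < t0) \/ (forall t, J t -> t < - t0).
    have [lt|gt|E] := ltgtP t1 t0; last by rewrite -E in nI.
      left=> t It; rewrite ltNge; apply/negP => le; apply: nI.
      by apply: (I_interval It1 It); rewrite (ltW lt).
    right=> t It; rewrite ltrNr ltNge; apply/negP => le; apply: nI.
    by apply: (I_interval It It1); rewrite le (ltW gt).
  case: side => side.
    have [d d0 H] := brP t0 nI side M; have [t [It st td]] := near0 d d0.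
    have [_ h _] := sb t It; have := H t It td; by rewrite ltNge (le_trans h st).
  have nJ : ~ J (- t0) by rewrite /J /= opprK.
  have [d d0 H] := blP (- t0) nJ side M; have [t [It st td]] := near0 d d0.
  have [_ _ h] := sb t It; have := H (- t) (JN _ It).
  by rewrite -opprD normrN => /(_ td); rewrite ltNge (le_trans h st).
split=> //=; rewrite leNgt; apply/negP => Ms.
have [d d0 H] := dI_cont (dI_smooth ss It0) (e := s t0 - M) ltac:(by rewrite subr_gt0).
have [t [It st td]] := near0 d d0; have := H t It td.
by rewrite ltr_norml => /andP[h _]; move: st h; lra.
Qed.

End Proper.

Lemma uniform_upto {R : realType} (P : nat -> R -> Prop) k :
  (forall i M M', M <= M' -> P i M -> P i M') ->
  (forall i, exists M, 0 < M /\ P i M) ->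
  exists M, 0 < M /\ forall i, (i <= k)%N -> P i M.
Proof.
move=> mono H; elim: k => [|k [M [M0 IH]]].
  have [M [M0 PM]] := H 0%N; exists M; split=> // i; by rewrite leqn0 => /eqP ->.
have [M' [M'0 PM']] := H k.+1; exists (Num.max M M'); split.
  by rewrite lt_max M0.
move=> i; rewrite leq_eqVlt => /orP[/eqP ->|]; first by apply: mono PM'; rewrite le_max lexx orbT.
by rewrite ltnS => /IH; apply: mono; rewrite le_max lexx.
Qed.

Section SmallFunction.
Context {R : realType} (I : set R) (I_limpt : limpt I).

Lemma compact_bounded (K : set R) (f : R -> R) : compact K -> K `<=` I -> smooth I f ->
  exists2 M, 0 < M & forall t, K t -> `|f t| <= M.
Proof.
move=> cK KI sf; have := (compact_near_coveringP K).1 cK.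
move=> /(_ R +oo%R (fun M t => I t -> `|f t| <= M) _) H.
have : \forall M \near +oo%R, K `<=` (fun t => I t -> `|f t| <= M).
  apply: H => t /KI It.
  have [d d0 D] := dI_cont (dI_smooth sf It) ltr01.
  exists (ball t d, [set M | `|f t| + 1 < M]).
    split=> /=; first exact: nbhsx_ballx.
    by apply: nbhs_pinfty_gt; exact: num_real.
  move=> [t' M] /= [bt M1] It'.
  have {}D := D t' It' ltac:(by rewrite distrC).
  rewrite -(subrK (f t) (f t')) (le_trans (ler_normD _ _))//.
  by move: M1 D; lra.
move=> HM.
have /filter_ex[M [M0 {}HM]] :
    \forall M \near +oo%R, 0 < M /\ K `<=` (fun t => I t -> `|f t| <= M).
  by apply: filterI => //; apply: nbhs_pinfty_gt; exact: num_real.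
by exists M => // t Kt; apply: HM => //; exact: KI.
Qed.

Variable s : R -> R.
Hypothesis s_smooth : smooth I s.
Hypothesis s_ge0 : forall t, I t -> 0 <= s t.
Hypothesis s_proper : forall M, compact [set t | I t /\ s t <= M].

(** Bumps supported on the shell where s is within 1 of n, times monomials. *)
Let b (n j : nat) (t : R) : R := bumpR (s t - n%:R) * t ^+ j.

Let b_smooth n j : smooth I (b n j).
Proof.
apply: smooth_mul; [exact: I_limpt| |].
  apply: (@smooth_bump _ _ I_limpt (fun t => s t - n%:R)).
  by apply: smooth_add; [exact: I_limpt|exact: s_smooth|exact: smooth_cst].
by apply: smooth_exp; [exact: I_limpt|exact: smooth_id].
Qed.

Let b_away n j i t : I t -> 1 < `|s t - n%:R| -> deriven_in I i (b n j) t = 0.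
Proof.
elim: i t => [|i IH] t It far; first by rewrite /= /b bump_out ?mul0r// ltW.
apply: derive_inE => //.
have [d d0 D] := dI_cont (dI_smooth s_smooth It)
  (e := `|s t - n%:R| - 1) ltac:(by rewrite subr_gt0).
apply: (dI_ext_near d0 It _ _ (dI_cst I t 0)); last exact/esym/IH.
move=> s' sd Is'; split=> //; apply/esym/IH => //.
have := D s' Is' sd; rewrite distrC.
have := ler_normD (s t - s s') (s s' - n%:R); rewrite addrA subrK.
move: (`|s t - n%:R|) (`|s t - s s'|) (`|s s' - n%:R|) => x y z; lra.
Qed.

Let b_bound (K d n : nat) : exists2 M, 0 < M & forall t i j, I t -> (i <= K)%N ->
  (j <= d)%N -> `|deriven_in I i (b n j) t| <= M.
Proof.
have H (i j : nat) : exists2 M, 0 < M & forall t, I t -> `|deriven_in I i (b n j) t| <= M.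
  have [M M0 HM] := @compact_bounded _ (deriven_in I i (b n j)) (@s_proper (n%:R + 1))
    (fun _ => @proj1 _ _) (smooth_deriven i (b_smooth n j)).
  exists M => // t It; have [st|st] := leP (s t) (n%:R + 1); first exact: HM.
  rewrite b_away ?normr0 ?(ltW M0)//.
  by apply: lt_le_trans (ler_norm _); lra.
have H' (i : nat) : exists M, 0 < M /\ forall j, (j <= d)%N ->
    forall t, I t -> `|deriven_in I i (b n j) t| <= M.
  apply: (uniform_upto (P := fun j M => forall t, I t -> `|deriven_in I i (b n j) t| <= M)).
    by move=> j M M' MM' h t It; exact: le_trans (h t It) MM'.
  by move=> j; have [M] := H i j; exists M.
have [M [M0 HM]] : exists M, 0 < M /\ forall i, (i <= K)%N -> forall j, (j <= d)%N ->
    forall t, I t -> `|deriven_in I i (b n j) t| <= M.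
  apply: (uniform_upto (P := fun i M => forall j, (j <= d)%N -> forall t, I t ->
     `|deriven_in I i (b n j) t| <= M)) => // i M M' MM' h j jd t It.
  exact: le_trans (h j jd t It) MM'.
by exists M => // t i j It iK jd; exact: HM.
Qed.

(** The sum of the bumps is locally finite: how many terms are kept is immaterial once all
    shells that meet t are included. *)
Let series_split (c : nat -> R) (g : nat -> R) (t : R) (L1 L2 : nat) :
  (forall n, 1 < `|s t - n%:R| -> g n = 0) ->
  s t + 1 < L1%:R -> s t + 1 < L2%:R ->
  \sum_(0 <= n < L1) c n * g n = \sum_(0 <= n < L2) c n * g n.
Proof.
move=> g0; wlog L12 : L1 L2 / (L1 <= L2)%N => [H h1 h2|h1 h2].
  have [/H|/ltnW/H] := leqP L1 L2; first exact.
  by move=> ->.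
rewrite [RHS](big_cat_nat (leq0n L1) L12) /= [X in _ = _ + X]big_nat_cond [X in _ = _ + X]big1 ?addr0//.
move=> n /andP[/andP[Ln _] _]; rewrite g0 ?mulr0//.
have : (L1%:R : R) <= n%:R by rewrite ler_nat.
by move=> Ln'; rewrite distrC; apply: lt_le_trans (ler_norm _); lra.
Qed.

Let sum_halves L : \sum_(0 <= n < L) (2^-1 : R) ^+ n.+1 <= 1.
Proof.
suff -> : \sum_(0 <= n < L) (2^-1 : R) ^+ n.+1 = 1 - 2^-1 ^+ L.
  by rewrite gerBl exprn_ge0// invr_ge0.
elim: L => [|L IH]; first by rewrite big_nil expr0 subrr.
rewrite big_nat_recr//= IH exprS.
by set x := _ ^+ L; field.
Qed.

(** A sum of bumps with rapidly decreasing coefficients, locally finite because s is proper: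
    on the set where s <= m it is as small, with its derivatives up to a fixed order, as
    prescribed by eta m. The powers of t make room for multiplication by polynomials. *)
Lemma small_positive_function (K d : nat) (eta : nat -> R) : (forall m, 0 < eta m) ->
  exists delta : R -> R, [/\ smooth I delta, forall t, I t -> 0 < delta t &
    forall t, I t -> exists m : nat, s t <= m%:R /\ forall i j, (i <= K)%N -> (j <= d)%N ->
      `|deriven_in I i (fun t => delta t * t ^+ j) t| <= eta m].
Proof.
move=> eta0.
(* A nonincreasing minorant of eta. *)
pose em := fix em m := if m is k.+1 then Num.min (em k) (eta m) else eta 0%N.
have em0 m : 0 < em m by elim: m => //= m IH; rewrite lt_min IH eta0.
have em_le m : em m <= eta m by case: m => //= m; rewrite ge_min lexx orbT.
have em_mono m n : (m <= n)%N -> em n <= em m.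
  move=> /subnK <-; elim: (n - m)%N => //= k IH; by rewrite ge_min IH.
have /choice[M HM] : forall n, exists M, 0 < M /\ forall t i j, I t -> (i <= K)%N ->
  (j <= d)%N -> `|deriven_in I i (b n j) t| <= M.
  by move=> n; have [M M0 HM] := b_bound K d n; exists M.
(* A point t of the shell n has s t <= n + 1, so the integer part of s t plus one is at most
   n + 2, whence the shift. *)
pose c n := em n.+2 * 2^-1 ^+ n.+1 / M n.
have c0 n : 0 < c n.
  by rewrite divr_gt0 ?mulr_gt0 ?exprn_gt0//; case: (HM n).
pose N t := (Num.truncn (s t)).+3.
have NP t : s t + 1 < (N t)%:R.
  have := truncnS_gt (s t); rewrite /N -[(_.+3)%:R]natr1 -[(_.+2)%:R]natr1.
  by move: (_.+1)%:R => x; lra.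
pose F j i t := \sum_(0 <= n < N t) c n * deriven_in I i (b n j) t.
have FT j : tower I (F j).
  move=> i t It.
  have [r r0 D] := dI_cont (dI_smooth s_smooth It) ltr01.
  have NP1 : s t + 1 < ((N t).+1)%:R by apply: (lt_trans (NP t)); rewrite ltr_nat.
  have FE i' s' : I s' -> `|s' - t| < r ->
      F j i' s' = \sum_(0 <= n < (N t).+1) c n * deriven_in I i' (b n j) s'.
    move=> Is' sr; apply: (@series_split c (fun n => deriven_in I i' (b n j) s') s') => //.
      by move=> n far; exact: b_away.
    have := D s' Is' sr; rewrite ltr_norml => /andP[_ h].
    have := NP t; rewrite -natr1; move: (N t)%:R => x; lra.
  apply: (dI_ext_near (I := I) r0 It (f := fun s' => \sum_(0 <= n < (N t).+1) c n * deriven_in I i (b n j) s')).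
  - by move=> s' sr Is'; rewrite FE.
  - by rewrite FE// subrr normr0.
  - rewrite FE ?subrr ?normr0//; apply: dI_sum => n.
    by apply: dI_scale; exact: (smooth_tower (b_smooth n j)).
pose delta t := F 0%N 0%N t.
have bj n j t : b n j t = b n 0%N t * t ^+ j by rewrite /b expr0 mulr1.
have dE j t : I t -> delta t * t ^+ j = F j 0%N t.
  move=> It; rewrite /delta /F big_distrl /=; apply: eq_bigr => n _.
  by rewrite /= [in RHS]bj mulrA.
exists delta; split.
- by apply: (tower_smooth I_limpt (FT 0%N)).
- move=> t It; rewrite /delta /F.
  have b0 n : 0 <= b n 0%N t by rewrite /b expr0 mulr1 bump_ge0.
  have /andP[n1 n2] := truncn_itv (s_ge0 It).
  have Nt : Num.truncn (s t) \in index_iota 0 (N t).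
    by rewrite mem_index_iota /N /= ltnS !leqW.
  rewrite (bigD1_seq _ Nt (iota_uniq _ _)) /=.
  apply: ltr_pwDl; last by apply: sumr_ge0 => n _; rewrite mulr_ge0// ltW.
  rewrite mulr_gt0// /b expr0 mulr1 bump_gt0// ger0_norm ?subr_ge0//.
  by rewrite ltrBlDr nat1r.
- move=> t It; exists (Num.truncn (s t)).+1; split; first exact/ltW/truncnS_gt.
  move=> i j iK jd.
  rewrite (tower_deriven (F := F j) I_limpt)//; last by move=> t' It'; rewrite dE.
  apply: (@le_trans _ _ (em (Num.truncn (s t)).+1)); last exact: em_le.
  rewrite /F (le_trans (ler_norm_sum _ _ _))//.
  apply: (@le_trans _ _ (\sum_(0 <= n < N t) em (Num.truncn (s t)).+1 * 2^-1 ^+ n.+1)); last first.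
    by rewrite -mulr_sumr ger_pMr// sum_halves.
  apply: ler_sum_nat => n _.
  have [far|nfar] := ltP 1 `|s t - n%:R|.
    by rewrite b_away// mulr0 normr0 mulr_ge0 ?exprn_ge0// ltW.
  rewrite normrM gtr0_norm//.
  have [M0 Mb] := HM n.
  apply: (@le_trans _ _ (c n * M n)); first by rewrite ler_wpM2l ?(ltW (c0 n))// Mb.
  rewrite /c divfK ?gt_eqF// ler_wpM2r ?exprn_ge0//.
  apply: em_mono; rewrite ltnS.
  move: nfar; rewrite ler_norml => /andP[_ h].
  have /andP[n1 n2] := truncn_itv (s_ge0 It).
  rewrite -ltnS -(@ltr_nat R) -[(_.+2)%:R]natr1.
  by rewrite -natr1 in h *; lra.
Qed.

End SmallFunction.

(** * Perturbations in the Whitney topology *)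

Section NormalisedJets.
Context {R : realType} (p : nat).

(** Generators for the jet of s / |s|: the derivatives of the components of s, and 1 / |s|,
    which is None. *)
Definition ngen := option ('I_p.+1 * nat).

Definition Esum (A : Type) (J : Type) (r : seq J) (e : J -> @dexp R A) : dexp A :=
  foldr (fun j => Add (e j)) (Cst _ 0) r.

Lemma eval_Esum (A : Type) (J : Type) (r : seq J) (e : J -> @dexp R A) (env : A -> R) :
  eval env (Esum r e) = \sum_(j <- r) eval env (e j).
Proof. by elim: r => [|j r IH]; rewrite ?big_nil// big_cons /= IH. Qed.

Definition nstep (x : ngen) : @dexp R ngen :=
  match x with
  | Some y => Gen (Some (y.1, y.2.+1))
  | None => Mul (Mul (Cst _ (- 2^-1))
      (Mul (Cst _ 2) (Esum (enum 'I_p.+1) (fun c => Mul (Gen (Some (c, 0%N))) (Gen (Some (c, 1%N)))))))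
      (Mul (Gen None) (Mul (Gen None) (Gen None)))
  end.

Definition ninv (v : 'I_p.+1 -> R) : R := (Num.sqrt (\sum_c v c ^+ 2))^-1.

(** The i-th derivative of the component c of s / |s|. *)
Definition nexp (c : 'I_p.+1) (i : nat) : @dexp R ngen :=
  iter i (dd nstep) (Mul (Gen (Some (c, 0%N))) (Gen None)).

Section Along.
Context (I : set R) (I_limpt : limpt I) (sigma : 'I_p.+1 -> R -> R).
Hypothesis s_smooth : forall c, smooth I (sigma c).
Hypothesis s_gt0 : forall t, I t -> 0 < \sum_c sigma c t ^+ 2.

Definition nenv t (x : ngen) : R :=
  match x with
  | Some y => deriven_in I y.2 (sigma y.1) t
  | None => ninv (sigma^~ t)
  end.

Lemma deriven_normalised c i t : I t ->
  deriven_in I i (fun t => sigma c t * ninv (sigma^~ t)) t = eval (nenv t) (nexp c i).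
Proof.
move=> It; apply: (tower_deriven (F := fun i s => eval (nenv s) (nexp c i)) I_limpt) => //.
apply: eval_tower => {c i t It} -[[c i]|] t It; first exact: (smooth_tower (s_smooth c)).
have D : dI I (fun s => \sum_c sigma c s ^+ 2) t
   (\sum_c (2 * (sigma c t * derive_in I (sigma c) t))).
  apply: dI_sum => c; have := dI_pow (k := 2) (dI_smooth (s_smooth c) It).
  by congr (dI I _ t _); rewrite expr1 mulrA.
have := dI_rsqrt (s_gt0 It) D; congr (dI I _ t _) => /=.
rewrite eval_Esum mulr_sumr enumT -mulr_sumr.
rewrite -/(ninv (sigma^~ t)) !exprS expr0 mulr1; congr (_ * _ * _).
by rewrite mulr_sumr /index_enum.
Qed.

Lemma smooth_normalised c : smooth I (fun t => sigma c t * ninv (sigma^~ t)).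
Proof.
apply: smooth_mul; [exact: I_limpt|exact: s_smooth|].
apply: (@smooth_rsqrt _ _ I_limpt (fun t => \sum_c sigma c t ^+ 2)) => //.
by apply: smooth_sum; [exact: I_limpt|move=> j; apply: smooth_exp; [exact: I_limpt|exact: s_smooth]].
Qed.

End Along.

Lemma ninv_unit v : \sum_c v c ^+ 2 = 1 -> ninv v = 1.
Proof. by rewrite /ninv => ->; rewrite sqrtr1 invr1. Qed.

Lemma ninv_near (v0 : 'I_p.+1 -> R) e : \sum_c v0 c ^+ 2 = 1 -> 0 < e ->
  exists2 r, 0 < r & forall v, (forall c, `|v c - v0 c| < r) ->
    0 < \sum_c v c ^+ 2 /\ `|ninv v - 1| < e.
Proof.
move=> v1 e0; pose w0 : 'rV[R]_p.+1 := \row_c v0 c.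
pose q (w : 'rV[R]_p.+1) := \sum_c w 0 c ^+ 2.
have q0 : q w0 = 1 by rewrite -v1; apply: eq_bigr => c _; rewrite mxE.
have Cq : q @ w0 --> q w0.
  apply: cvg_big; [exact: add_continuous|exact: nbhs_filter|move=> c _].
  have C : (fun w : 'rV[R]_p.+1 => w 0 c) @ w0 --> w0 0 c by exact: coord_continuous.
  exact: (cvgM C C).
have Ci : (fun w => (Num.sqrt (q w))^-1) @ w0 --> (1 : R).
  have : (fun w => (Num.sqrt (q w))^-1) @ w0 --> (Num.sqrt (q w0))^-1.
    have S : (fun w => Num.sqrt (q w)) @ w0 --> Num.sqrt (q w0).
      by apply: (cvg_comp q Num.sqrt Cq); exact: sqrt_continuous.
    by apply: cvgV S; rewrite q0 sqrtr1 oner_neq0.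
  by rewrite q0 sqrtr1 invr1.
have N1 := (cvgrPdist_lt _ _).1 Ci e e0.
have N2 := (cvgrPdist_lt _ _).1 Cq 1 ltr01.
have /nbhs_ballP[r /= r0 H] : nbhs w0 (fun w => `|1 - (Num.sqrt (q w))^-1| < e /\ `|q w0 - q w| < 1).
  by apply: filterI; [exact: N1|exact: N2].
exists r => // v Hv; have [|h1 h2] := H (\row_c v c).
  by split=> // i c; rewrite !mxE /ball /= distrC.
have qv : q (\row_c v c) = \sum_c v c ^+ 2 by apply: eq_bigr => c _; rewrite mxE.
rewrite qv in h1; rewrite qv q0 in h2; rewrite /ninv distrC; split=> //.
by move: h2; rewrite ltr_norml => /andP[_]; lra.
Qed.

End NormalisedJets.

Section WhitneyNeighbourhoods.
Context {R : realType} (p : nat) (I : set R).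
Hypothesis I_interval : is_interval I.
Hypothesis I_nondeg : exists u v, [/\ I u, I v & u < v].
Let I_limpt : limpt I := interval_limpt I_interval I_nondeg.

Definition tcomp (x : smooth_RxS p I) (c : 'I_p.+1) (t : R) : R := sm_tau x t 0 c.

Lemma smooth_sm_a (x : smooth_RxS p I) : smooth I (sm_a x).
Proof. by split; exact: sm_a_smooth. Qed.

Lemma smooth_sm_tau (x : smooth_RxS p I) : smooth I (sm_tau x).
Proof. by split; exact: sm_tau_smooth. Qed.

Lemma smooth_tcomp x c : smooth I (tcomp x c).
Proof. by have /(row_smoothP I_limpt)/(_ c) := smooth_sm_tau x. Qed.

Lemma tcomp_unit x t : I t -> \sum_c tcomp x c t ^+ 2 = 1.
Proof.
by move=> It; rewrite -(sm_tau_sphere x It); apply: eq_bigr => c _; rewrite expr2.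
Qed.

Lemma jetE k x t : I t -> jet k x t =
  (t, (\col_(j < k.+1) deriven_in I j (sm_a x) t,
       \matrix_(j < k.+1, c < p.+1) deriven_in I j (tcomp x c) t)).
Proof.
move=> It; rewrite /jet; congr (_, (_, _)); apply/matrixP => i j; rewrite !mxE.
by rewrite (row_deriven I_limpt)//; exact: smooth_sm_tau.
Qed.

Definition nord (y : ngen p) : nat := if y is Some (_, i) then i else 0%N.

(** So a perturbation of s need be controlled only up to some finite order K. *)
Lemma nexp_order k : exists K, (k <= K)%N /\ forall c i, (i <= k)%N ->
  gens (fun y => (nord y <= K)%N) (@nexp R p c i).
Proof.
have /choice[K HK] : forall ci : 'I_p.+1 * nat, exists K,
  gens (fun y => (nord y <= K)%N) (@nexp R p ci.1 ci.2) by move=> ci; exact: gens_bounded.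
exists (maxn k (\max_(i < k.+1) \max_c K (c, val i)))%N; split; first exact: leq_maxl.
move=> c i ik; have := HK (c, i); apply: gens_sub => y /leq_trans; apply.
apply: (leq_trans _ (leq_maxr _ _)).
apply: (leq_trans _ (leq_bigmax (Ordinal (ik : (i < k.+1)%N)))).
exact: (leq_bigmax (F := fun c => K (c, i))).
Qed.

(** The condition that the k-jet of (a, tau) lie in O is stable at t0 under small changes of
    the jet of tau in the ambient space, followed by projection to the sphere. *)
Lemma jet_near k K (O : set (R * ('cV[R]_k.+1 * 'M[R]_(k.+1, p.+1)))) x t0 :
  (forall c i, (i <= k)%N -> gens (fun y => (nord y <= K)%N) (@nexp R p c i)) ->
  open O -> I t0 -> O (jet k x t0) ->
  exists2 r, 0 < r & forall t (al : nat -> R) (env : ngen p -> R), `|t - t0| < r ->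
    (forall i, (i <= k)%N -> `|al i - deriven_in I i (sm_a x) t0| < r) ->
    (forall c i, (i <= K)%N -> `|env (Some (c, i)) - deriven_in I i (tcomp x c) t0| < r) ->
    env None = ninv (fun c => env (Some (c, 0%N))) ->
    0 < \sum_c env (Some (c, 0%N)) ^+ 2 /\
    O (t, (\col_(j < k.+1) al j, \matrix_(j < k.+1, c < p.+1) eval env (nexp c j))).
Proof.
move=> ordK oO It0 Ox.
have /nbhs_ballP[r /= r0 Or] := open_nbhs_nbhs (conj oO Ox).
rewrite jetE// in Or.
pose e0 := nenv I (tcomp x) t0.
have tunit s : I s -> \sum_c tcomp x c s ^+ 2 = 1 by exact: tcomp_unit.
have E0 c i : eval e0 (nexp c i) = deriven_in I i (tcomp x c) t0.
  rewrite -(deriven_normalised I_limpt (smooth_tcomp x))//; last by move=> s Is; rewrite tunit.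
  apply: (deriven_ext I_limpt) => // [s Is|].
    by rewrite ninv_unit ?mulr1// tunit.
  apply: smooth_normalised => // [d|s Is]; [exact: smooth_tcomp|by rewrite tunit].
have /choice[eta He] : forall ci : 'I_p.+1 * 'I_k.+1, exists eta, 0 < eta /\
    forall env, (forall y, (nord y <= K)%N -> `|env y - e0 y| < eta) ->
      `|eval env (nexp ci.1 ci.2) - eval e0 (nexp ci.1 ci.2)| < r.
  move=> [c i] /=; have ik : (i <= k)%N by rewrite -ltnS.
  by have [eta eta0 H] := eval_near e0 r0 (ordK c i ik); exists eta.
have [eta1 [eta10 eta1P]] : exists eta1, 0 < eta1 /\ forall ci, eta1 <= eta ci.
  have : \forall e \near 0^'+, forall ci, e <= eta ci.
    apply: filter_forall => ci; have [h _] := He ci.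
    near=> e; apply/ltW; near: e; exact: nbhs_right_lt.
  move=> H; have /filter_ex[e [e_gt He']] : \forall e \near 0^'+, 0 < e /\ forall ci, e <= eta ci.
    by apply: filterI => //; exact: nbhs_right_gt.
  by exists e.
have [r1 r10 near1] := ninv_near (tunit _ It0) eta10.
exists (Num.min r (Num.min eta1 r1)); first by rewrite !lt_min r0 eta10.
move=> t al env; rewrite lt_min => /andP[tr _] Hal Henv HN.
have [qpos nclose] : 0 < \sum_c env (Some (c, 0%N)) ^+ 2 /\
    `|ninv (fun c => env (Some (c, 0%N))) - 1| < eta1.
  apply: near1 => c; have := Henv c 0%N (leq0n _).
  by rewrite !lt_min => /and3P[].
split=> //; apply: Or; split; first by rewrite /ball /= distrC.
have He0N : e0 None = 1 by rewrite /e0 /= ninv_unit// tunit.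
split; split=> // i c; rewrite !mxE /ball /=.
  have := Hal i; rewrite -ltnS => /(_ (ltn_ord i)).
  by rewrite lt_min distrC => /andP[].
rewrite distrC -E0; have [_ H] := He (c, i); apply: H => /= -[[d j]|] /= ord.
  apply: lt_le_trans (eta1P (c, i)); have := Henv d j ord.
  by rewrite !lt_min => /and3P[].
have := He0N; rewrite /e0 /= => ->; rewrite HN.
exact: lt_le_trans nclose (eta1P _).
Unshelve. all: by end_near.
Qed.

Variable s : R -> R.
Hypothesis s_proper : forall M, compact [set t | I t /\ s t <= M].

(** N is a neighbourhood of x in a usable sense: a perturbation of x whose jet is small
    enough, with a bound depending on the position through the proper function s, remains in N
    after projection to the sphere. *)
Definition adm (x : smooth_RxS p I) (N : set (smooth_RxS p I)) :=
  exists (K : nat) (eta : nat -> R), (forall m, 0 < eta m) /\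
  forall (al : R -> R) (ps : 'I_p.+1 -> R -> R),
    smooth I al -> (forall c, smooth I (ps c)) ->
    (forall t, I t -> exists m : nat, s t <= m%:R /\ forall i, (i <= K)%N ->
       `|deriven_in I i al t| < eta m /\ forall c, `|deriven_in I i (ps c) t| < eta m) ->
    (forall t, I t -> 0 < \sum_c (tcomp x c t + ps c t) ^+ 2) /\
    forall y : smooth_RxS p I, (forall t, I t -> sm_a y t = sm_a x t + al t) ->
      (forall t c, I t -> tcomp y c t =
         (tcomp x c t + ps c t) * ninv (fun c => tcomp x c t + ps c t)) ->
      N y.

Lemma admS x A B : A `<=` B -> adm x A -> adm x B.
Proof.
move=> AB [K [eta [eta0 H]]]; exists K, eta; split=> // al ps sa sp small.
by have [h1 h2] := H al ps sa sp small; split=> // y ya yt; apply: AB; exact: h2.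
Qed.

Lemma admI x A B : adm x A -> adm x B -> adm x (A `&` B).
Proof.
move=> [K1 [e1 [e10 H1]]] [K2 [e2 [e20 H2]]].
exists (maxn K1 K2), (fun m => Num.min (e1 m) (e2 m)); split.
  by move=> m; rewrite lt_min e10 e20.
move=> al ps sa sp small.
have small1 t : I t -> exists m : nat, s t <= m%:R /\ forall i, (i <= K1)%N ->
       `|deriven_in I i al t| < e1 m /\ forall c, `|deriven_in I i (ps c) t| < e1 m.
  move=> It; have [m [sm Hm]] := small t It; exists m; split=> // i iK.
  have [|h1 h2] := Hm i; first by rewrite leq_max iK.
  move: h1; rewrite lt_min => /andP[? _]; split=> // c.
  by have := h2 c; rewrite lt_min => /andP[].
have small2 t : I t -> exists m : nat, s t <= m%:R /\ forall i, (i <= K2)%N ->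
       `|deriven_in I i al t| < e2 m /\ forall c, `|deriven_in I i (ps c) t| < e2 m.
  move=> It; have [m [sm Hm]] := small t It; exists m; split=> // i iK.
  have [|h1 h2] := Hm i; first by rewrite leq_max iK orbT.
  move: h1; rewrite lt_min => /andP[_ ?]; split=> // c.
  by have := h2 c; rewrite lt_min => /andP[].
have [q1 n1] := H1 al ps sa sp small1; have [_ n2] := H2 al ps sa sp small2.
by split=> // y ya yt; split; [exact: n1|exact: n2].
Qed.

(** The sets s <= m are compact, so that the local stability of jet_near gives a bound eta m
    valid on each of them. *)
Lemma adm_base x W : whitney_base W -> W x -> adm x W.
Proof.
move=> [k [Q [oQ ->]]] Wx.
have [K [kK ordK]] := nexp_order k.
have /choice[eta He] : forall m : nat, exists eta, 0 < eta /\ forall t, I t -> s t <= m%:R ->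
  forall (al : nat -> R) (env : ngen p -> R),
    (forall i, (i <= k)%N -> `|al i - deriven_in I i (sm_a x) t| < eta) ->
    (forall c i, (i <= K)%N -> `|env (Some (c, i)) - deriven_in I i (tcomp x c) t| < eta) ->
    env None = ninv (fun c => env (Some (c, 0%N))) ->
    0 < \sum_c env (Some (c, 0%N)) ^+ 2 /\
    Q (t, (\col_(j < k.+1) al j, \matrix_(j < k.+1, c < p.+1) eval env (nexp c j))).
  move=> m; have := (compact_near_coveringP _).1 (@s_proper m%:R).
  pose P (eta : R) t := I t -> forall (al : nat -> R) (env : ngen p -> R),
    (forall i, (i <= k)%N -> `|al i - deriven_in I i (sm_a x) t| < eta) ->
    (forall c i, (i <= K)%N -> `|env (Some (c, i)) - deriven_in I i (tcomp x c) t| < eta) ->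
    env None = ninv (fun c => env (Some (c, 0%N))) ->
    0 < \sum_c env (Some (c, 0%N)) ^+ 2 /\
    Q (t, (\col_(j < k.+1) al j, \matrix_(j < k.+1, c < p.+1) eval env (nexp c j))).
  move=> /(_ R 0^'+ P _) cov.
  have {}cov : \forall e \near 0^'+, [set t | I t /\ s t <= m%:R] `<=` P e.
    apply: cov => t0 [It0 _].
    have [r r0 H] := jet_near ordK oQ It0 (Wx t0 It0).
    have r2 : 0 < r / 2 by rewrite divr_gt0.
    have near_deriv (f : R -> R) i : smooth I f -> \forall t \near t0, I t ->
        `|deriven_in I i f t - deriven_in I i f t0| < r / 2.
      move=> sf; have [d d0 D] := dI_cont (smooth_tower sf (n := i) It0) r2.
      by apply/near_distP; exists d => // t td It; exact: D.
    have N1 : \forall t \near t0, forall i : 'I_K.+1, I t ->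
        `|deriven_in I i (sm_a x) t - deriven_in I i (sm_a x) t0| < r / 2.
      have := @filter_forall _ _ (fun (i : 'I_K.+1) t => I t ->
        `|deriven_in I i (sm_a x) t - deriven_in I i (sm_a x) t0| < r / 2) (nbhs t0) _.
      by apply=> i; apply: near_deriv; exact: smooth_sm_a.
    have N2 : \forall t \near t0, forall (ci : 'I_p.+1 * 'I_K.+1), I t ->
        `|deriven_in I ci.2 (tcomp x ci.1) t - deriven_in I ci.2 (tcomp x ci.1) t0| < r / 2.
      have := @filter_forall _ _ (fun (ci : 'I_p.+1 * 'I_K.+1) t => I t ->
        `|deriven_in I ci.2 (tcomp x ci.1) t - deriven_in I ci.2 (tcomp x ci.1) t0| < r / 2) (nbhs t0) _.
      by apply=> ci; apply: near_deriv; exact: smooth_tcomp.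
    have N3 : \forall t \near t0, `|t - t0| < r by apply/near_distP; exists r.
    exists ([set t | [/\ forall i : 'I_K.+1, I t ->
        `|deriven_in I i (sm_a x) t - deriven_in I i (sm_a x) t0| < r / 2,
        forall (ci : 'I_p.+1 * 'I_K.+1), I t ->
        `|deriven_in I ci.2 (tcomp x ci.1) t - deriven_in I ci.2 (tcomp x ci.1) t0| < r / 2
        & `|t - t0| < r]], [set e | e < r / 2]).
      split=> /=; last exact: nbhs_right_lt.
      near=> t; split; near: t; [exact: N1|exact: N2|exact: N3].
    move=> [t e] /= [[h1 h2 h3] er] It al env Hal Henv HN.
    have tri (u v w : R) : `|u - v| < e -> `|v - w| < r / 2 -> `|u - w| < r.
      move=> uv vw; rewrite -(subrK v u) -addrA (le_lt_trans (ler_normD _ _))//.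
      by move: uv vw; move: (`|u - v|) (`|v - w|) => *; lra.
    apply: H => // [i ik|c i iK].
      apply: (tri _ _ _ (Hal i ik)).
      by have iK : (i < K.+1)%N by [exact: leq_trans kK]; have := h1 (Ordinal iK) It.
    apply: (tri _ _ _ (Henv c i iK)).
    by have := h2 (c, Ordinal (iK : (i < K.+1)%N)) It.
  have /filter_ex[e [e0 He]] : \forall e \near 0^'+, 0 < e /\ [set t | I t /\ s t <= m%:R] `<=` P e.
    by apply: filterI => //; exact: nbhs_right_gt.
  by exists e; split=> // t It st; exact: He.
exists K, eta; split=> [m|al ps sal sps small]; first by case: (He m).
pose sg c t := tcomp x c t + ps c t.
have ssg c : smooth I (sg c) by apply: smooth_add; [exact: I_limpt|exact: smooth_tcomp|exact: sps].
have dsum (f g : R -> R) i t : smooth I f -> smooth I g -> I t ->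
    deriven_in I i (fun t => f t + g t) t = deriven_in I i f t + deriven_in I i g t.
  move=> sf sg' It; apply: (tower_deriven (F := fun i t => deriven_in I i f t + deriven_in I i g t) I_limpt) => //.
  by move=> n t' It'; apply: dI_add; [exact: (smooth_tower sf)|exact: (smooth_tower sg')].
pose env t := nenv I sg t.
have key t : I t -> 0 < \sum_c sg c t ^+ 2 /\
    Q (t, (\col_(j < k.+1) (deriven_in I j (sm_a x) t + deriven_in I j al t),
       \matrix_(j < k.+1, c < p.+1) eval (env t) (nexp c j))).
  move=> It; have [m [sm Hm]] := small t It; have [_ H] := He m.
  apply: (H t It sm (fun j => deriven_in I j (sm_a x) t + deriven_in I j al t)) => //.
    move=> i ik; rewrite addrAC subrr add0r.
    by have [] := Hm i (leq_trans ik kK).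
  move=> c i iK; rewrite /env /nenv /= (dsum _ _ _ _ (smooth_tcomp x c) (sps c) It).
  rewrite addrAC subrr add0r.
  by have [_] := Hm i iK.
have sgpos t : I t -> 0 < \sum_c sg c t ^+ 2 by move=> /key[].
split=> // y ya yt t It; have [_] := key t It; rewrite jetE//.
have -> : (\col_(j < k.+1) deriven_in I j (sm_a y) t) =
    (\col_(j < k.+1) (deriven_in I j (sm_a x) t + deriven_in I j al t)).
  apply/colP => j; rewrite !mxE -(dsum _ _ _ _ (smooth_sm_a x) sal It).
  by apply: (deriven_ext I_limpt) => //; exact: smooth_sm_a.
have -> // : (\matrix_(j < k.+1, c < p.+1) deriven_in I j (tcomp y c) t) =
    (\matrix_(j < k.+1, c < p.+1) eval (env t) (nexp c j)).
apply/matrixP => j c; rewrite !mxE /env -(deriven_normalised I_limpt)//.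
apply: (deriven_ext I_limpt) => //; last exact: smooth_tcomp.
by move=> t' It'; rewrite yt.
Unshelve. all: by end_near.
Qed.

Lemma open_base W : @whitney_base R p I W -> open W.
Proof.
by move=> HW; exists [set W]; [move=> _ ->; exact: finI_from1|rewrite bigcup_set1].
Qed.

(** Open sets are unions of finite intersections of the basic sets. *)
Lemma adm_open x N : open N -> N x -> adm x N.
Proof.
move=> [D' sD DE]; rewrite -DE => -[A DA Ax].
have [F sF AE] := sD _ DA.
apply: (@admS x A) => [y Ay|]; first by exists A.
have [l [Hl lA]] : exists l : seq (set (smooth_RxS p I)),
    (forall W, W \in l -> whitney_base W /\ W x) /\
    (forall y, (forall W, W \in l -> W y) -> (A : set (smooth_RxS p I)) y).
  exists (finmap.enum_fset F); split=> [W WF|y Wy].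
    split; first by have := sF _ WF; rewrite inE.
    by move: Ax; rewrite -[X in X x]AE => /(_ W); apply.
  by rewrite -[X in X y]AE => W WF; exact: Wy.
have : adm x (\bigcap_(W in [set` l]) W).
  elim: l Hl {lA} => [_|W l IH Hl].
    have : adm x setT.
      apply: adm_base => //; exists 0%N, setT; split; first exact: openT.
      by apply/seteqP.
    by apply: admS => y _ W /=; rewrite in_nil.
  have [bW Wx] := Hl W (mem_head _ _).
  apply: (@admS x (W `&` \bigcap_(W in [set` l]) W)).
    move=> y [yW yl] V; rewrite /= inE => /orP[/eqP -> //|Vl].
    exact: yl.
  by apply: admI; [exact: adm_base|apply: IH => V Vl; apply: Hl; rewrite inE Vl orbT].
by apply: admS => y yl; apply: lA => W Wl; exact: yl.
Qed.

End WhitneyNeighbourhoods.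

Section JointContinuity.
Context {R : realType} (I : set R) {V : normedModType R}.

Lemma jcont_const c : jcont I (fun (_ : V) _ => c).
Proof. by move=> z t e _ e0; exists 1 => // *; rewrite subrr normr0. Qed.

Lemma jcont_time (f : R -> R) : smooth I f -> jcont I (fun (_ : V) => f).
Proof.
move=> sf z t e It e0; have [d d0 H] := dI_cont (dI_smooth sf It) e0.
by exists d => // z' s Is _ sd; exact: H.
Qed.

Lemma jcont_add (f g : V -> R -> R) : jcont I f -> jcont I g ->
  jcont I (fun z t => f z t + g z t).
Proof.
move=> Hf Hg z t e It e0; have e2 : 0 < e / 2 by rewrite divr_gt0.
have [d1 d10 H1] := Hf z t _ It e2; have [d2 d20 H2] := Hg z t _ It e2.
exists (Num.min d1 d2) => [|z' s Is]; first by rewrite lt_min d10.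
rewrite !lt_min => /andP[a1 a2] /andP[b1 b2].
rewrite opprD addrACA (le_lt_trans (ler_normD _ _))// [e]splitr ltrD//.
  exact: H1.
exact: H2.
Qed.

Lemma jcont_mul (f g : V -> R -> R) : jcont I f -> jcont I g ->
  jcont I (fun z t => f z t * g z t).
Proof.
move=> Hf Hg z t e It e0.
set a := f z t; set b := g z t.
pose r := Num.min 1 (e / (1 + `|a| + `|b|)).
have s0 : 0 < 1 + `|a| + `|b| by rewrite -addrA ltr_wpDr// addr_ge0.
have r0 : 0 < r by rewrite lt_min ltr01 divr_gt0.
have [d1 d10 H1] := Hf z t r It r0; have [d2 d20 H2] := Hg z t r It r0.
exists (Num.min d1 d2) => [|z' s Is]; first by rewrite lt_min d10.
rewrite !lt_min => /andP[a1 a2] /andP[b1 b2].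
have := H1 z' s Is a1 b1; have := H2 z' s Is a2 b2; rewrite -/a -/b.
set x := f z' s; set y := g z' s => yb xa.
have -> : x * y - a * b = (x - a) * (y - b) + a * (y - b) + (x - a) * b by ring.
have re : r * (1 + `|a| + `|b|) <= e by rewrite -ler_pdivlMr// ge_min lexx orbT.
have r1 : r <= 1 by rewrite ge_min lexx.
rewrite (le_lt_trans (ler_normD _ _))// (le_lt_trans (lerD (ler_normD _ _) (lexx _)))//.
rewrite !normrM; apply: (lt_le_trans _ re).
have h1 : `|x - a| * `|y - b| < r.
  have [->|n0] := eqVneq (x - a) 0; first by rewrite normr0 mul0r.
  apply: (@lt_le_trans _ _ (`|x - a| * 1)).
    by rewrite ltr_pM2l ?normr_gt0// (lt_le_trans yb).
  by rewrite mulr1 ltW.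
have h2 : `|a| * `|y - b| <= `|a| * r by rewrite ler_wpM2l// ltW.
have h3 : `|x - a| * `|b| <= r * `|b| by rewrite ler_wpM2r// ltW.
by move: h1 h2 h3; rewrite !mulrDr mulr1 [r * `|a|]mulrC; move: (_ * `|y - b|) (`|a| * _) => *; lra.
Qed.

Lemma jcont_sum (J : Type) (r : seq J) (f : J -> V -> R -> R) :
  (forall j, jcont I (f j)) -> jcont I (fun z t => \sum_(j <- r) f j z t).
Proof.
move=> H; elim: r => [|j r IH].
  by under [X in jcont _ X]eq_fun2 do rewrite big_nil; exact: jcont_const.
by under [X in jcont _ X]eq_fun2 do rewrite big_cons; exact: jcont_add.
Qed.

Lemma jcont_eval (A : Type) (env : V -> R -> A -> R) e :
  (forall x, jcont I (fun z t => env z t x)) -> jcont I (fun z t => eval (env z t) e).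
Proof.
move=> H; elim: e => [c|x|e1 IH1 e2 IH2|e1 IH1 e2 IH2] /=.
- exact: jcont_const.
- exact: H.
- exact: jcont_add.
- exact: jcont_mul.
Qed.

End JointContinuity.

Section AffineFamilies.
Context {R : realType} (I : set R).
Hypothesis I_interval : is_interval I.
Hypothesis I_nondeg : exists u v, [/\ I u, I v & u < v].

Lemma jcont_coord m n i j : jcont I (fun (z : 'M[R]_(m, n)) (_ : R) => z i j).
Proof.
move=> z t e It e0; exists e => // z' s _ zz _.
have := (@mx_norm_ball R m n); move=> /(congr1 (fun b => b z' e z)) E.
have : ball z' e z by rewrite E /ball_ /=.
by move=> [_ /(_ i j)]; rewrite /ball /=.
Qed.

Definition affine_family m n (A : R -> R) (B : 'I_m -> 'I_n -> R -> R)
    (z : 'M[R]_(m, n)) (t : R) : R := A t + \sum_i \sum_j z i j * B i j t.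

(** In a family affine in the parameters, the parameter z i j moves the function at the speed
    B i j. *)
Theorem affine_simple_zeros (J : countType) m n (A : J -> R -> R)
    (B : J -> 'I_m -> 'I_n -> R -> R) :
  (forall k, smooth I (A k)) -> (forall k i j, smooth I (B k i j)) ->
  residual [set z : 'M[R]_(m, n) | forall t, I t -> (exists k i j, B k i j t != 0) ->
    exists k, affine_family (A k) (B k) z t != 0 \/
      affine_family (derive_in I (A k)) (fun i j => derive_in I (B k i j)) z t != 0].
Proof.
move=> sA sB.
have limI := interval_limpt I_interval I_nondeg.
have C (A' : R -> R) (B' : 'I_m -> 'I_n -> R -> R) : smooth I A' ->
    (forall i j, smooth I (B' i j)) -> jcont I (affine_family A' B').
  move=> sA' sB'; apply: jcont_add; first exact: jcont_time.
  apply: jcont_sum => i; apply: jcont_sum => j; apply: jcont_mul; first exact: jcont_coord.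
  exact: jcont_time.
have := @generic_simple_zeros _ _ I_interval I_nondeg _ J ('I_m * 'I_n)%type
  (fun ij : 'I_m * 'I_n => delta_mx ij.1 ij.2 : 'M[R]_(m, n))
  (fun k => affine_family (A k) (B k))
  (fun k => affine_family (derive_in I (A k)) (fun i j => derive_in I (B k i j))) _ _ _.
move=> H; apply: residualS (H _ _ _) => {H}; last 3 first.
- move=> k z t It; apply: dI_add; first exact: dI_smooth.
  apply: dI_sum => i; apply: dI_sum => j; apply: dI_scale; exact: dI_smooth.
- by move=> k; exact: C.
- by move=> k; apply: C => [|i j]; exact: smooth_derive.
move=> z Hz t It [k [i [j Bt]]]; apply: Hz => //; exists k, (i, j).
have [d d0 D] := dI_cont (dI_smooth (sB k i j) It) (e := `|B k i j t| / 2)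
  ltac:(by rewrite divr_gt0 ?normr_gt0).
exists (`|B k i j t| / 2), d; split=> //; first by rewrite divr_gt0 ?normr_gt0.
move=> z' s h Is _ _ sd.
have -> : affine_family (A k) (B k) (z' + h *: delta_mx i j) s -
    affine_family (A k) (B k) z' s = h * B k i j s.
  rewrite /affine_family opprD addrACA subrr add0r -sumrB.
  rewrite (bigD1 i)//= [X in _ + X]big1 ?addr0 => [|i' ni].
    rewrite -sumrB (bigD1 j)//= [X in _ + X]big1 ?addr0 => [|j' nj].
      by rewrite !mxE !eqxx mulr1 mulrDl addrAC subrr add0r.
    by rewrite !mxE (negbTE nj) andbF mulr0 addr0 subrr.
  by rewrite -sumrB big1// => j' _; rewrite !mxE (negbTE ni) mulr0 addr0 subrr.
rewrite normrM mulrC ler_wpM2l//.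
have := D s Is sd; have := ler_normB (B k i j s) (B k i j s - B k i j t).
by rewrite opprB addrC subrK; move: (`|B k i j s|) (`|_ - _|) (`|B k i j t|) => *; lra.
Qed.

End AffineFamilies.

Section WhitneyPerturbation.
Context {R : realType} (p : nat) (I : set R).
Hypothesis I_interval : is_interval I.
Hypothesis I_nondeg : exists u v, [/\ I u, I v & u < v].
Let I_limpt : limpt I := interval_limpt I_interval I_nondeg.

Lemma smooth_horner (P : {poly R}) : smooth I (fun t => P.[t]).
Proof.
apply: (smooth_ext I_limpt (f := fun t => \sum_(i < size P) P`_i * t ^+ i)).
  by move=> t _; rewrite horner_coef.
apply: smooth_sum; [exact: I_limpt|move=> i].
apply: smooth_mul; [exact: I_limpt|exact: smooth_cst|].
by apply: smooth_exp; [exact: I_limpt|exact: smooth_id].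
Qed.

Definition unit_poly (d : nat) (P : {poly R}) : Prop :=
  (size P <= d.+1)%N /\ forall i, `|P`_i| <= 1.

(** The source of all perturbations: inside any open set N of maps there is room for a family
    with finitely many parameters, the coefficients of polynomials multiplied by one fixed
    positive function delta that is small enough everywhere on I. *)
Theorem whitney_perturbation (x : smooth_RxS p I) (N : set (smooth_RxS p I)) (d : nat) :
  open N -> N x -> exists delta : R -> R, [/\ smooth I delta, forall t, I t -> 0 < delta t &
    forall (Q : {poly R}) (P : 'I_p.+1 -> {poly R}), unit_poly d Q ->
      (forall c, unit_poly d (P c)) ->
      let sg t c := tcomp x c t + delta t * (P c).[t] in
      (forall t, I t -> 0 < \sum_c sg t c ^+ 2) /\
      exists y, [/\ N y, forall t, I t -> sm_a y t = sm_a x t + delta t * Q.[t] &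
        forall c t, I t -> tcomp y c t = sg t c * ninv (sg t)]].
Proof.
move=> oN Nx.
have [s [ss s0 sprop]] := proper_function I_interval I_nondeg.
have [K [eta [eta0 HN]]] := adm_open I_interval I_nondeg sprop oN Nx.
have [delta [sd dpos dsmall]] := @small_positive_function _ _ I_limpt s ss s0 sprop K d
  (fun m => eta m / d.+2%:R) (fun m => divr_gt0 (eta0 m) (ltr0Sn _ _)).
exists delta; split=> // Q P uQ uP sg.
have sdp (S : {poly R}) : smooth I (fun t => delta t * S.[t]).
  by apply: smooth_mul; [exact: I_limpt|exact: sd|exact: smooth_horner].
have bound t : I t -> exists m : nat, s t <= m%:R /\ forall i (S : {poly R}), (i <= K)%N ->
    unit_poly d S -> `|deriven_in I i (fun t => delta t * S.[t]) t| < eta m.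
  move=> It; have [m [sm Hm]] := dsmall t It; exists m; split=> // i S iK [szS cS].
  have sdj j : smooth I (fun t => delta t * t ^+ j).
    apply: smooth_mul; [exact: I_limpt|exact: sd|].
    by apply: smooth_exp; [exact: I_limpt|exact: smooth_id].
  rewrite (tower_deriven (F := fun i t => \sum_(j < d.+1) S`_j * deriven_in I i (fun t => delta t * t ^+ j) t) I_limpt)//; first last.
  - move=> t' It'; rewrite (horner_coef_wide _ szS) mulr_sumr.
    by apply: eq_bigr => j _; rewrite mulrCA.
  - move=> n t' It'; apply: dI_sum => j; apply: dI_scale; exact: (smooth_tower (sdj j)).
  apply: (le_lt_trans (ler_norm_sum _ _ _)).
  apply: (@le_lt_trans _ _ (\sum_(j < d.+1) (eta m / d.+2%:R))).
    apply: ler_sum => j _; rewrite normrM; apply: le_trans (Hm i j iK (ltn_ord j)).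
    by rewrite ler_piMl.
  rewrite sumr_const card_ord -[_ *+ _]mulr_natr mulrAC -mulrA gtr_pMr//.
  by rewrite ltr_pdivrMr ?ltr0Sn// mul1r ltr_nat.
have [|qpos HNy] := HN (fun t => delta t * Q.[t]) (fun c t => delta t * (P c).[t])
    (sdp Q) (fun c => sdp (P c)).
  move=> t It; have [m [sm Hm]] := bound t It; exists m; split=> // i iK.
  by split=> [|c]; exact: Hm.
split=> //.
have ssg c : smooth I (fun t => sg t c).
  by apply: smooth_add; [exact: I_limpt|exact: smooth_tcomp|exact: sdp].
pose ya t := sm_a x t + delta t * Q.[t].
pose yt t : 'rV[R]_p.+1 := \row_c (sg t c * ninv (sg t)).
have sya : smooth_on I ya.
  by apply/smoothP; apply: smooth_add; [exact: I_limpt|exact: smooth_sm_a|exact: sdp].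
have syt : smooth_on I yt.
  apply/smoothP/(row_smoothP I_limpt) => c.
  apply: (smooth_ext I_limpt (f := fun t => sg t c * ninv (sg t))).
    by move=> t _; rewrite mxE.
  exact: (@smooth_normalised _ _ _ I_limpt (fun c t => sg t c) ssg).
have unit_y t : I t -> dot (yt t) (yt t) = 1.
  move=> It; rewrite /dot.
  under eq_bigr do rewrite !mxE -expr2 exprMn.
  rewrite -mulr_suml /ninv exprVn sqr_sqrtr ?(ltW (qpos t It))//.
  by rewrite mulfV// gt_eqF// qpos.
exists (SmoothRxS sya syt unit_y); split=> //.
  by apply: HNy => // t c It; rewrite /tcomp /= mxE.
by move=> c t It; rewrite /tcomp /= mxE.
Qed.

(** Variables of the jets: None stands for a, Some c for the component c of tau. *)
Definition jgen := (option 'I_p.+1 * nat)%type.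

Definition jfun (x : smooth_RxS p I) (v : option 'I_p.+1) : R -> R :=
  if v is Some c then tcomp x c else sm_a x.

Definition jenv (x : smooth_RxS p I) : R -> jgen -> R := fenv I (jfun x).

Lemma smooth_jfun x v : smooth I (jfun x v).
Proof. by case: v => [c|]; [exact: smooth_tcomp|exact: smooth_sm_a]. Qed.

Lemma jenv_dI x e t : I t ->
  dI I (fun t => eval (jenv x t) e) t (eval (jenv x t) (dd (@djet R _) e)).
Proof. by move=> It; apply: dI_eval => y; apply: dI_fenv => //; exact: smooth_jfun. Qed.

Lemma jenv_smooth x e : smooth I (fun t => eval (jenv x t) e).
Proof. by have [] := smooth_fenv I_limpt (e := e) (smooth_jfun x) (fun t _ => erefl). Qed.

Lemma derive_jenv x e t : I t ->
  derive_in I (fun t => eval (jenv x t) e) t = eval (jenv x t) (dd (@djet R _) e).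
Proof. by move=> It; apply: derive_inE => //; exact: jenv_dI. Qed.

(** Conditions of the form: at each t some polynomial in the jet is nonzero. They define basic
    open sets, since finitely many polynomials involve a jet of finite order. *)
Lemma open_jet_condition (J : finType) (e : J -> @dexp R jgen) :
  open [set x : smooth_RxS p I | forall t, I t -> exists j, eval (jenv x t) (e j) != 0].
Proof.
apply: open_base.
have /choice[K HK] : forall j, exists K, gens (fun y => (y.2 <= K)%N) (e j).
  by move=> j; exact: gens_bounded.
pose k := \max_j K j.
pose ej (y : R * ('cV[R]_k.+1 * 'M[R]_(k.+1, p.+1))) (g : jgen) : R :=
  match g.1 with None => y.2.1 (inord g.2) 0 | Some c => y.2.2 (inord g.2) c end.
have ejE x t j : I t -> eval (ej (jet k x t)) (e j) = eval (jenv x t) (e j).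
  move=> It; apply: eval_ext (HK j) => -[[c|] n] /= nK.
    rewrite /ej jetE//= mxE inordK// ltnS (leq_trans nK)//.
    exact: (leq_bigmax (F := K)).
  rewrite /ej jetE//= mxE inordK// ltnS (leq_trans nK)//.
  exact: (leq_bigmax (F := K)).
exists k, [set y | exists j, eval (ej y) (e j) != 0]; split; last first.
  apply/seteqP; split=> x /= H t It; have [j Hj] := H t It; exists j.
    by rewrite ejE.
  by rewrite -ejE.
have cont j : continuous (fun y => eval (ej y) (e j)).
  move=> y; apply: cvg_eval (HK j) => -[[c|] n] _ /=; rewrite /ej /=.
    apply: (cvg_comp (fun y : R * ('cV[R]_k.+1 * 'M[R]_(k.+1, p.+1)) => y.2.2) (fun M : 'M[R]_(k.+1, p.+1) => M (inord n) c)); last exact: coord_continuous.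
    by apply: (cvg_comp _ snd); [exact: cvg_snd|exact: cvg_snd].
  apply: (cvg_comp (fun y : R * ('cV[R]_k.+1 * 'M[R]_(k.+1, p.+1)) => y.2.1) (fun M : 'cV[R]_k.+1 => M (inord n) 0)); last exact: coord_continuous.
  by apply: (cvg_comp _ fst); [exact: cvg_snd|exact: cvg_fst].
rewrite (_ : [set y | _] = \bigcup_j [set y | eval (ej y) (e j) != 0]); last first.
  by apply/seteqP; split=> y /= [j]; [exists j|move=> _; exists j].
apply: bigcup_open => j _.
apply: (@open_comp _ _ (fun y => eval (ej y) (e j)) [set r : R | r != 0]).
  by move=> y _; exact: cont.
exact: open_neq.
Qed.

End WhitneyPerturbation.

(** * Wronskians *)

Section Wronskian.
Context {R : realType} (I : set R) (I_limpt : limpt I).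
Implicit Types f : nat -> R -> R.

Lemma dI_prod (J : finType) (f : J -> R -> R) (l : J -> R) t :
  (forall j, dI I (f j) t (l j)) ->
  dI I (fun s => \prod_j f j s) t (\sum_k \prod_j (if j == k then l j else f j t)).
Proof.
move=> H; suff G (r : seq J) : uniq r -> dI I (fun s => \prod_(j <- r) f j s) t
    (\sum_(k <- r) \prod_(j <- r) (if j == k then l j else f j t)).
  exact: (G _ (index_enum_uniq J)).
elim: r => [_|j r IH /= /andP[jr ur]].
  rewrite big_nil (_ : (fun s => _) = fun=> 1); first exact: dI_cst.
  by apply/funext => s; rewrite big_nil.
rewrite (_ : (fun s => _) = fun s => f j s * \prod_(j <- r) f j s); last first.
  by apply/funext => s; rewrite big_cons.
have := dI_mul (H j) (IH ur); congr (dI I _ t _).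
rewrite big_cons big_cons eqxx; congr (_ * _ + _).
  rewrite !big_seq; apply: eq_bigr => i ir; case: eqP => // E.
  by rewrite -E ir in jr.
rewrite mulr_sumr !big_seq; apply: eq_bigr => i ir.
rewrite big_cons ifN//; apply/eqP => E; by rewrite E ir in jr.
Qed.

Lemma dI_det n (A : 'I_n -> 'I_n -> R -> R) (A' : 'I_n -> 'I_n -> R) t :
  (forall i j, dI I (A i j) t (A' i j)) ->
  dI I (fun s => \det (\matrix_(i, j) A i j s)) t
    (\sum_k \det (\matrix_(i, j) (if i == k then A' i j else A i j t))).
Proof.
move=> H; rewrite /determinant exchange_big /=.
apply: dI_sum => s.
rewrite -mulr_sumr; apply: dI_scale.
have := dI_prod (f := fun i => A i (fun_of_perm s i)) (fun i => H i (fun_of_perm s i)).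
rewrite (_ : (fun x => \prod_j _) = (fun x => \prod_i (\matrix_(i0, j) A i0 j x) i (fun_of_perm s i))); last first.
  by apply/funext => x; apply: eq_bigr => i _; rewrite mxE.
congr (dI I _ t _); apply: eq_bigr => k _; apply: eq_bigr => i _.
by rewrite mxE.
Qed.

Definition wr n f t : R := \det (\matrix_(i < n, c < n) deriven_in I i (f c) t).

(** The Wronskian of order n.+1 with its last row differentiated once more; it is the
    derivative of the Wronskian, because differentiating any other row creates two equal
    rows. *)
Definition wr1 n f t : R :=
  \det (\matrix_(i < n.+1, c < n.+1) deriven_in I (if i == n :> nat then n.+1 else i) (f c) t).

Lemma wr0 f t : wr 0 f t = 1.
Proof. by rewrite /wr det_mx00. Qed.

Lemma dI_wr n f t : (forall c, smooth I (f c)) -> I t -> dI I (wr n.+1 f) t (wr1 n f t).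
Proof.
move=> sf It.
have := @dI_det n.+1 (fun i c s => deriven_in I i (f c) s)
  (fun i c => deriven_in I i.+1 (f c) t) t (fun i c => smooth_tower (sf c) It).
congr (dI I _ t _); rewrite big_ord_recr /= big1 ?add0r => [|k _].
  congr (\det _); apply/matrixP => i j; rewrite !mxE.
  rewrite -(inj_eq val_inj) /=; case: eqP => [->|] //.
have kn : (k.+1 < n.+1)%N by rewrite ltnS.
have neq : widen_ord (leqnSn n) k != Ordinal kn.
  by rewrite -(inj_eq val_inj) /= neq_ltn ltnSn.
apply: (determinant_alternate neq) => j; rewrite !mxE eqxx.
by rewrite -(inj_eq val_inj) /= gtn_eqF.
Qed.

Lemma smooth_wr n f : (forall c, smooth I (f c)) -> smooth I (wr n f).
Proof.
by move=> sf; apply: smooth_det => // i c; apply: smooth_deriven.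
Qed.

Lemma derive_wr n f t : (forall c, smooth I (f c)) -> I t ->
  derive_in I (wr n.+1 f) t = wr1 n f t.
Proof. by move=> sf It; apply: derive_inE => //; exact: dI_wr. Qed.

Lemma wr_ext n f g t : I t -> (forall c, smooth I (f c)) ->
  (forall c s, (c < n)%N -> I s -> f c s = g c s) -> wr n f t = wr n g t.
Proof.
move=> It sf fg; congr (\det _); apply/matrixP => i c; rewrite !mxE.
by apply: (deriven_ext I_limpt) => // s Is; exact: fg.
Qed.

(** By Leibniz's formula, multiplying all functions by lam multiplies the matrix by a triangular
    one with diagonal lam. Hence projecting a curve to the sphere keeps the zeros of its
    Wronskian and their multiplicity. *)
Lemma wr_scale n (lam : R -> R) f t : smooth I lam -> (forall c, smooth I (f c)) -> I t ->
  wr n (fun c s => lam s * f c s) t = lam t ^+ n * wr n f t.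
Proof.
move=> sl sf It; rewrite /wr.
pose L : 'M[R]_n := \matrix_(i, l) ('C(i, l)%:R * deriven_in I (i - l) lam t).
have -> : \matrix_(i < n, c < n) deriven_in I i (fun s => lam s * f c s) t =
    L *m \matrix_(i < n, c < n) deriven_in I i (f c) t.
  apply/matrixP => i c; rewrite !mxE (deriven_mul I_limpt)//.
  rewrite (big_ord_widen n (fun l => 'C(i, l)%:R * (deriven_in I (i - l) lam t * deriven_in I l (f c) t)) (ltn_ord i)).
  rewrite big_mkcond /=; apply: eq_bigr => l _; rewrite !mxE mulrA ltnS.
  by case: leqP => // il; rewrite bin_small// !mul0r.
rewrite det_mulmx det_trig; last first.
  by apply/is_trig_mxP => i l il; rewrite mxE bin_small// mul0r.
under eq_bigr do rewrite mxE subnn binn mul1r.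
by rewrite prodr_const card_ord.
Qed.

(** The Wronskian as a function of its last entry g: the coefficients of the two highest
    derivatives of g are the preceding Wronskian and minus its derivative. *)
Definition with_last n f (g : R -> R) : nat -> R -> R := fun c => if (c < n)%N then f c else g.

Definition wrcof n f t (i : 'I_n.+1) : R :=
  cofactor (\matrix_(i < n.+1, c < n.+1) deriven_in I i (f c) t) i ord_max.

Lemma wr_last n f g t : wr n.+1 (with_last n f g) t =
  \sum_(i < n.+1) deriven_in I i g t * wrcof f t i.
Proof.
rewrite /wr (expand_det_col _ ord_max); apply: eq_bigr => i _.
rewrite mxE /with_last /= ltnn; congr (_ * _).
rewrite /wrcof /cofactor; congr (_ * \det _); apply/matrixP => k l; rewrite !mxE.
rewrite lift_max /=.
by rewrite ltn_ord.
Qed.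

Lemma wrcof_max n f t : wrcof (n := n) f t ord_max = wr n f t.
Proof.
rewrite /wrcof /cofactor /= -signr_odd addnn odd_double expr0 mul1r.
by congr (\det _); apply/matrixP => k l; rewrite !mxE !lift_max.
Qed.

Lemma wrcof_pred n f t : wrcof (n := n.+1) f t (inord n) = - wr1 n f t.
Proof.
rewrite /wrcof /cofactor /= inordK// -signr_odd addnS oddS addnn odd_double expr1 mulN1r.
congr (- \det _); apply/matrixP => k l; rewrite !mxE lift_max; congr (deriven_in I _ _ _).
rewrite /= inordK// /bump; have kn : (k <= n)%N by rewrite -ltnS.
case: eqP => [->|/eqP ne]; first by rewrite leqnn.
by rewrite leqNgt ltn_neqAle ne kn.
Qed.

(** A power of t - t0 isolates one derivative at t0. *)
Lemma deriven_power_at (t0 : R) (delta : R -> R) i j : smooth I delta -> I t0 -> (j <= i)%N ->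
  deriven_in I j (fun t => delta t * (t - t0) ^+ i) t0 =
  if j == i then (i`!)%:R * delta t0 else 0.
Proof.
move=> sd It0 ji.
have T : tower I (fun l t => (i ^_ l)%:R * (t - t0) ^+ (i - l)).
  move=> l t It; rewrite ffactnSr natrM -mulrA; apply: dI_scale.
  have D : dI I (fun t => t - t0) t 1.
    by have := dI_add (dI_id I t) (dI_cst I t (- t0)); rewrite addr0.
  have := dI_pow (k := i - l) D; rewrite mulr1 subnS.
  by congr (dI I _ t _).
have E l : deriven_in I l (fun t => (t - t0) ^+ i) t0 = (i ^_ l)%:R * 0 ^+ (i - l).
  rewrite (tower_deriven I_limpt T)//; first by rewrite subrr.
  by move=> t _; rewrite ffactn0 mul1r subn0.
have sp : smooth I (fun t => (t - t0) ^+ i).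
  by apply: (tower_smooth I_limpt T) => t _; rewrite ffactn0 mul1r subn0.
rewrite (deriven_mul I_limpt)// big_ord_recr /= binn subnn mul1r E big1 ?add0r => [|l _].
  case: eqP => [->|/eqP ne]; first by rewrite subnn expr0 mulr1 ffactnn mulrC.
  by rewrite expr0n subn_eq0 leqNgt ltn_neqAle ne ji /= !mulr0.
rewrite E expr0n subn_eq0 leqNgt (leq_trans (ltn_ord l) ji) /= !mulr0.
by [].
Qed.

(** At each point some polynomial multiple of delta changes the Wronskian as its last entry,
    provided that the preceding Wronskian has only simple zeros: it or its derivative is then
    a nonzero coefficient, which the right power of t - t0 selects. *)
Lemma wr_last_nonzero n f (delta : R -> R) t0 : smooth I delta -> I t0 -> 0 < delta t0 ->
  (forall c, smooth I (f c)) ->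
  (wr n f t0 != 0 \/ derive_in I (wr n f) t0 != 0) ->
  exists i, (i <= n)%N /\
    wr n.+1 (with_last n f (fun t => delta t * (t - t0) ^+ i)) t0 != 0.
Proof.
move=> sd It0 d0 sf H.
have fact_neq0 k : (k`!)%:R != 0 :> R by rewrite pnatr_eq0 -lt0n fact_gt0.
have [W0|W0] := eqVneq (wr n f t0) 0; last first.
  exists n; split=> //; rewrite wr_last big_ord_recr /= big1 ?add0r => [|i _].
    rewrite deriven_power_at// eqxx wrcof_max !mulf_neq0// gt_eqF//.
  by rewrite deriven_power_at// ?(ltnW (ltn_ord i))// ltn_eqF// mul0r.
case: H => [/eqP//|W1]; case: n W0 W1 => [|n] W0 W1; first by rewrite wr0 in W0; move/eqP: W0; rewrite oner_eq0.
exists n; split=> //; rewrite wr_last.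
rewrite derive_wr// in W1.
rewrite big_ord_recr /= wrcof_max W0 mulr0 addr0 big_ord_recr /= big1 ?add0r => [|i _].
  rewrite (_ : widen_ord _ _ = inord n); last by apply/val_inj; rewrite /= inordK.
  rewrite wrcof_pred deriven_power_at// eqxx mulf_neq0 ?oppr_eq0// mulf_neq0// gt_eqF//.
by rewrite deriven_power_at// ?(ltnW (ltn_ord i))// ltn_eqF// mul0r.
Qed.

End Wronskian.

Section DetExpressions.
Context {R : realType} (A : Type).

Definition Eprod (J : Type) (r : seq J) (e : J -> @dexp R A) : dexp A :=
  foldr (fun j => Mul (e j)) (Cst _ 1) r.

Lemma eval_Eprod (J : Type) (r : seq J) (e : J -> @dexp R A) (env : A -> R) :
  eval env (Eprod r e) = \prod_(j <- r) eval env (e j).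
Proof. by elim: r => [|j r IH]; rewrite ?big_nil// big_cons /= IH. Qed.

Definition Edet n (M : 'I_n -> 'I_n -> @dexp R A) : @dexp R A :=
  Esum (enum {: 'S_n}) (fun s => Mul (Cst _ ((-1) ^+ (odd_perm s)))
    (Eprod (enum 'I_n) (fun i => M i (fun_of_perm s i)))).

Lemma eval_Edet n (M : 'I_n -> 'I_n -> @dexp R A) (env : A -> R) :
  eval env (Edet M) = \det (\matrix_(i, j) eval env (M i j)).
Proof.
rewrite /Edet eval_Esum /determinant big_enum /=; apply: eq_bigr => s _.
rewrite eval_Eprod big_enum /=; congr (_ * _); apply: eq_bigr => i _.
by rewrite mxE.
Qed.

End DetExpressions.

Section SimpleZeros.
Context {R : realType} (I : set R) (I_limpt : limpt I).

Lemma simple_zeros_scale (F G lam : R -> R) t : smooth I F -> smooth I lam -> I t ->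
  (forall s, I s -> G s = lam s * F s) -> lam t != 0 ->
  (F t != 0 \/ derive_in I F t != 0) -> (G t != 0 \/ derive_in I G t != 0).
Proof.
move=> sF sl It GE l0 H.
have -> : derive_in I G t = derive_in I lam t * F t + lam t * derive_in I F t.
  apply: derive_inE => //; apply: (dI_ext (f := fun s => lam s * F s)) => //.
    by move=> s Is; rewrite GE.
  by apply: dI_mul; exact: dI_smooth.
rewrite GE//; have [F0|F0] := eqVneq (F t) 0; last by left; rewrite mulf_neq0.
by case: H => [/eqP//|F'0]; right; rewrite F0 mulr0 add0r mulf_neq0.
Qed.

Lemma derive_affine_family m n (A : R -> R) (B : 'I_m -> 'I_n -> R -> R) z t :
  smooth I A -> (forall i j, smooth I (B i j)) -> I t ->
  derive_in I (affine_family A B z) t =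
  affine_family (derive_in I A) (fun i j => derive_in I (B i j)) z t.
Proof.
move=> sA sB It; apply: derive_inE => //; apply: dI_add; first exact: dI_smooth.
by apply: dI_sum => i; apply: dI_sum => j; apply: dI_scale; exact: dI_smooth.
Qed.

Lemma smooth_affine_family m n (A : R -> R) (B : 'I_m -> 'I_n -> R -> R) z :
  smooth I A -> (forall i j, smooth I (B i j)) -> smooth I (affine_family A B z).
Proof.
move=> sA sB; apply: smooth_add; [exact: I_limpt|exact: sA|].
apply: smooth_sum => [|i]; first exact: I_limpt.
apply: smooth_sum => [|j]; first exact: I_limpt.
by apply: smooth_mul; [exact: I_limpt|exact: smooth_cst|exact: sB].
Qed.

Lemma wr_last_lin n f g0 m (k : 'I_m -> R) (phi : 'I_m -> R -> R) t :
  smooth I g0 -> (forall l, smooth I (phi l)) -> I t ->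
  wr I n.+1 (with_last n f (fun t => g0 t + \sum_l k l * phi l t)) t =
  wr I n.+1 (with_last n f g0) t + \sum_l k l * wr I n.+1 (with_last n f (phi l)) t.
Proof.
move=> sg sp It; rewrite !wr_last.
have E i : deriven_in I i (fun t => g0 t + \sum_l k l * phi l t) t =
    deriven_in I i g0 t + \sum_l k l * deriven_in I i (phi l) t.
  apply: (tower_deriven (F := fun i t => deriven_in I i g0 t + \sum_l k l * deriven_in I i (phi l) t) I_limpt) => //.
  move=> j s Is; apply: dI_add; first exact: (smooth_tower sg).
  by apply: dI_sum => l; apply: dI_scale; exact: (smooth_tower (sp l)).
under eq_bigr do rewrite E mulrDl mulr_suml.
rewrite big_split /= exchange_big /=; congr (_ + _); apply: eq_bigr => l _.
by rewrite wr_last mulr_sumr; apply: eq_bigr => i _; rewrite mulrA.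
Qed.

End SimpleZeros.

Section SmallParameters.
Context {R : realType}.

(** Residual sets are dense, so good parameters exist in the unit ball. *)
Lemma residual_small m n (S : set 'M[R]_(m, n)) : residual S ->
  exists2 z, S z & forall i j, `|z i j| <= 1.
Proof.
move=> /residual_dense/(_ (ball (0 : 'M[R]_(m, n)) 1)) [||z [bz Sz]].
- by exists 0; exact: ballxx.
- exact: ball_open.
exists z => // i j; move: bz => [_ /(_ i j)]; rewrite /ball /= mxE sub0r normrN.
exact: ltW.
Qed.

Lemma unit_poly_coef d m (z : 'M[R]_(m, d.+1)) i : (forall i j, `|z i j| <= 1) ->
  unit_poly d (\poly_(l < d.+1) z i (inord l)).
Proof.
move=> z1; split; first exact: size_poly.
by move=> l; rewrite coef_poly; case: ifP => _ //; rewrite normr0.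
Qed.

Lemma unit_poly0 d : unit_poly d (0 : {poly R}).
Proof. by split=> [|i]; rewrite ?size_poly0// coef0 normr0. Qed.

End SmallParameters.

Section WronskianDensity.
Context {R : realType} (p : nat) (I : set R).
Hypothesis I_interval : is_interval I.
Hypothesis I_nondeg : exists u v, [/\ I u, I v & u < v].
Let I_limpt : limpt I := interval_limpt I_interval I_nondeg.

(** The components of tau numbered by natural numbers, as Wronskians need them; inord makes the
    numbers beyond p harmless. *)
Definition cf (x : smooth_RxS p I) (c : nat) : R -> R := tcomp x (inord c).

Lemma smooth_cf x c : smooth I (cf x c).
Proof. exact: smooth_tcomp. Qed.

Definition Ewr (n : nat) : @dexp R (jgen p) :=
  Edet (fun i c : 'I_n => Gen (Some (inord c : 'I_p.+1), val i)).

Lemma eval_Ewr n x t : eval (jenv x t) (Ewr n) = wr I n (cf x) t.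
Proof. by rewrite eval_Edet. Qed.

Definition simple_wr n : set (smooth_RxS p I) :=
  [set x | forall t, I t -> wr I n (cf x) t != 0 \/ derive_in I (wr I n (cf x)) t != 0].

Lemma derive_Ewr n x t : I t ->
  eval (jenv x t) (dd (@djet R _) (Ewr n)) = derive_in I (wr I n (cf x)) t.
Proof.
move=> It; rewrite -(derive_jenv I_interval I_nondeg)//; congr (derive_in I _ t).
by apply/funext => s; rewrite eval_Ewr.
Qed.

Lemma open_simple_wr n : open (simple_wr n).
Proof.
have := open_jet_condition I_interval I_nondeg
  (fun b : bool => if b then Ewr n else dd (@djet R _) (Ewr n)).
congr open; apply/seteqP; split=> x /= H t It.
  have [[] Hb] := H t It; [left|right]; first by rewrite -eval_Ewr.
  by rewrite -derive_Ewr.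
have [h|h] := H t It; [exists true|exists false]; first by rewrite eval_Ewr.
by rewrite derive_Ewr.
Qed.

(** Perturb only the component n of tau, by delta times a polynomial. Before normalisation the
    Wronskian of order n.+1 depends on the coefficients affinely, and at each point some
    coefficient matters by wr_last_nonzero; generic coefficients make its zeros simple.
    Normalisation multiplies it by a power of a positive function. *)
Lemma simple_wr_step n (N : set (smooth_RxS p I)) x : (n <= p)%N -> open N -> N x ->
  simple_wr n x -> exists2 y, N y & simple_wr n.+1 y.
Proof.
move=> np oN Nx simx.
have [delta [sd dpos Hpert]] := whitney_perturbation I_interval I_nondeg p oN Nx.
have sdp l : smooth I (fun t => delta t * t ^+ l).
  apply: smooth_mul; [exact: I_limpt|exact: sd|].
  by apply: smooth_exp; [exact: I_limpt|exact: smooth_id].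
have swl g c : smooth I g -> smooth I (with_last n (cf x) g c).
  by move=> sg; rewrite /with_last; case: ifP => _; [exact: smooth_cf|exact: sg].
pose B (i : 'I_1) (l : 'I_p.+1) := wr I n.+1 (with_last n (cf x) (fun t => delta t * t ^+ l)).
pose A := wr I n.+1 (with_last n (cf x) (cf x n)).
have sA : smooth I A by apply: smooth_wr => // c; apply: swl; exact: smooth_cf.
have sB i l : smooth I (B i l) by apply: smooth_wr => // c; apply: swl; exact: sdp.
have [z Hz z1] := residual_small (@affine_simple_zeros _ _ I_interval I_nondeg unit 1 p.+1
  (fun=> A) (fun=> B) (fun=> sA) (fun=> sB)).
have Bneq t : I t -> exists (k : unit) i l, B i l t != 0.
  move=> It; have [i [ni Wn]] := wr_last_nonzero I_limpt sd It (dpos t It) (smooth_cf x) (simx t It).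
  apply: contrapT => none.
  move/eqP: Wn; apply.
  pose P := ('X - t%:P) ^+ i.
  have szP : (size P <= p.+1)%N by rewrite size_exp_XsubC ltnS (leq_trans ni).
  rewrite (@wr_ext _ _ I_limpt _ _ (with_last n (cf x) (fun s => 0 + \sum_(l < p.+1) P`_l * (delta s * s ^+ l))) t It); first last.
  - move=> c s _ Is; rewrite /with_last; case: ifP => // _.
    rewrite add0r; under eq_bigr do rewrite mulrCA.
    rewrite -mulr_sumr -(horner_coef_wide _ szP) /P horner_exp !hornerE.
    by [].
  - move=> c; apply: swl; apply: smooth_mul; [exact: I_limpt|exact: sd|].
    apply: smooth_exp; [exact: I_limpt|].
    by apply: smooth_add; [exact: I_limpt|exact: smooth_id|exact: smooth_cst].
  rewrite (@wr_last_lin _ _ I_limpt _ _ (fun=> 0) _ (fun l : 'I_p.+1 => P`_l) (fun l s => delta s * s ^+ l))//; last exact: smooth_cst.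
  rewrite big1 ?addr0 => [|l _]; last first.
    have B0 : B ord0 l t = 0.
      by apply/eqP; apply: contraT => nz; exfalso; apply: none; exists tt, ord0, l.
    by transitivity (P`_l * 0); [congr (_ * _); exact: B0|rewrite mulr0].
  rewrite wr_last big1// => j _.
  by rewrite (tower_deriven (F := fun _ _ => 0) I_limpt) ?mul0r// => k s _; exact: dI_cst.
pose P (c : 'I_p.+1) : {poly R} := if c == inord n then \poly_(l < p.+1) z ord0 (inord l) else 0.
have [qpos [y [Ny _ yt]]] := Hpert 0 P (@unit_poly0 _ _)
  (fun c => ltac:(rewrite /P; case: ifP => _; [exact: unit_poly_coef|exact: unit_poly0])).
exists y => // t It.
pose sg s c := tcomp x c s + delta s * (P c).[s].
pose lam s := ninv (sg s).
pose g c s := sg s (inord c).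
have ssg c : smooth I (fun s => sg s c).
  apply: smooth_add; [exact: I_limpt|exact: smooth_tcomp|].
  by apply: smooth_mul; [exact: I_limpt|exact: sd|exact: smooth_horner].
have slam : smooth I lam.
  apply: (@smooth_rsqrt _ _ I_limpt (fun s => \sum_c sg s c ^+ 2)) => //.
  by apply: smooth_sum; [exact: I_limpt|move=> j; apply: smooth_exp; [exact: I_limpt|exact: ssg]].
have gE s : I s -> wr I n.+1 g s = affine_family A B z s.
  move=> Is.
  have gE c s' : (c < n.+1)%N -> I s' -> g c s' = with_last n (cf x)
      (fun s => cf x n s + \sum_(l < p.+1) z ord0 l * (delta s * s ^+ l)) c s'.
    move=> cn Is'; rewrite /g /sg /with_last /P.
    have [lt|ge] := ltnP c n.
      rewrite ifN ?horner0 ?mulr0 ?addr0//.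
      rewrite -(inj_eq val_inj) /= !inordK ?ltnS// ?(leq_trans (ltnW lt) np)//.
      by rewrite ltn_eqF.
    have -> : c = n by apply/eqP; rewrite eqn_leq ge -ltnS cn.
    rewrite eqxx horner_poly mulr_sumr; congr (_ + _); apply: eq_bigr => l _.
    by rewrite inord_val mulrCA.
  rewrite (@wr_ext _ _ I_limpt _ _ _ s Is _ gE); last by move=> c; exact: ssg.
  rewrite (@wr_last_lin _ _ I_limpt)//; last exact: smooth_cf.
  by rewrite /affine_family big_ord1.
have yE s : I s -> wr I n.+1 (cf y) s = lam s ^+ n.+1 * affine_family A B z s.
  move=> Is; rewrite -gE// -(wr_scale I_limpt)//; last by move=> c; exact: ssg.
  apply: wr_ext => // [c|c s' cn Is']; first exact: smooth_cf.
  by rewrite /cf yt// mulrC.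
have saf := smooth_affine_family I_limpt z sA sB.
have lt0 : lam t ^+ n.+1 != 0.
  rewrite expf_neq0// /lam /ninv invr_neq0// gt_eqF// sqrtr_gt0.
  exact: qpos.
apply: (simple_zeros_scale I_limpt saf (smooth_exp I_limpt n.+1 slam) It yE lt0).
have [k] := Hz t It (Bneq t It).
by rewrite derive_affine_family.
Qed.

Lemma simple_wr_dense (N : set (smooth_RxS p I)) x n : (n <= p.+1)%N -> open N -> N x ->
  exists2 y, N y & simple_wr n y.
Proof.
move=> np oN Nx; elim: n np => [_|n IH np].
  by exists x => // t It; left; rewrite wr0 oner_neq0.
have [y Ny sy] := IH (ltnW np).
exact: (simple_wr_step np oN Ny sy).
Qed.

End WronskianDensity.

(** * A frameless form of the condition on the frames *)

(** Locked, because comparing derivatives of different orders by conversion unfolds the limits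
    that define them. *)
HB.lock Definition jt {R : realType} {p : nat} {I : set R} (x : smooth_RxS p I) (i : nat)
  (t : R) (c : 'I_p.+1) : R := deriven_in I i (tcomp x c) t.

Section Theta.
Context {R : realType} (p : nat) (I : set R).
Hypothesis I_interval : is_interval I.
Hypothesis I_nondeg : exists u v, [/\ I u, I v & u < v].
Let I_limpt : limpt I := interval_limpt I_interval I_nondeg.

Definition triple : finType := ('I_p.+1 * 'I_p.+1 * 'I_p.+1)%type.

(** The 3 x 3 minors of the matrix with columns u, v, w: all vanish when u lies in the span of
    v and w, and conversely if v and w are independent. *)
Definition minor3 (u v w : 'I_p.+1 -> R) (x : triple) : R :=
  u x.1.1 * (v x.1.2 * w x.2 - v x.2 * w x.1.2)
  - u x.1.2 * (v x.1.1 * w x.2 - v x.2 * w x.1.1)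
  + u x.2 * (v x.1.1 * w x.1.2 - v x.1.2 * w x.1.1).

Definition speed2 (x : smooth_RxS p I) t : R := \sum_c jt x 1 t c ^+ 2.
Definition accel (x : smooth_RxS p I) t : R := \sum_c jt x 1 t c * jt x 2 t c.

(** The functions theta are the minors of X, tau', tau'', where
    X = |tau'|^2 (a tau'''' - a' tau''') - 5 a <tau',tau''> tau''',
    and theta1 and - theta0 are the coefficients of a and a'. The combination X is chosen so
    that, modulo tau' and tau'', it is a nonzero multiple of the normal vector with components
    a v_i' - a' v_i (frame_theta), v_i being the derivative of ell_i / kappa. In this way a
    condition on frames becomes one on jets of (a, tau), which is open and can be perturbed. *)
Definition theta0 (x : smooth_RxS p I) (k : triple) t : R :=
  speed2 x t * minor3 (jt x 3 t) (jt x 1 t) (jt x 2 t) k.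
Definition theta1 (x : smooth_RxS p I) (k : triple) t : R :=
  speed2 x t * minor3 (jt x 4 t) (jt x 1 t) (jt x 2 t) k
  - 5 * accel x t * minor3 (jt x 3 t) (jt x 1 t) (jt x 2 t) k.
Definition theta (x : smooth_RxS p I) (k : triple) t : R :=
  sm_a x t * theta1 x k t - derive_in I (sm_a x) t * theta0 x k t.

Definition Sub (A : Type) (e1 e2 : @dexp R A) := Add e1 (Mul (Cst _ (-1)) e2).

Lemma evalM (A : Type) (env : A -> R) e1 e2 :
  eval env (Mul e1 e2) = eval env e1 * eval env e2.
Proof. by []. Qed.

Lemma evalB (A : Type) (env : A -> R) e1 e2 :
  eval env (Sub e1 e2) = eval env e1 - eval env e2.
Proof. by rewrite /= mulN1r. Qed.

Definition Ejt i c : @dexp R (jgen p) := Gen (Some c, i).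
Definition Eminor3 (u v w : nat) (x : triple) : @dexp R (jgen p) :=
  Add (Sub (Mul (Ejt u x.1.1) (Sub (Mul (Ejt v x.1.2) (Ejt w x.2)) (Mul (Ejt v x.2) (Ejt w x.1.2))))
    (Mul (Ejt u x.1.2) (Sub (Mul (Ejt v x.1.1) (Ejt w x.2)) (Mul (Ejt v x.2) (Ejt w x.1.1)))))
  (Mul (Ejt u x.2) (Sub (Mul (Ejt v x.1.1) (Ejt w x.1.2)) (Mul (Ejt v x.1.2) (Ejt w x.1.1)))).
Definition Espeed2 := Esum (enum 'I_p.+1) (fun c => Mul (Ejt 1 c) (Ejt 1 c)).
Definition Eaccel := Esum (enum 'I_p.+1) (fun c => Mul (Ejt 1 c) (Ejt 2 c)).
Definition Etheta0 k := Mul Espeed2 (Eminor3 3 1 2 k).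
Definition Etheta1 k := Sub (Mul Espeed2 (Eminor3 4 1 2 k))
  (Mul (Mul (Cst _ 5) Eaccel) (Eminor3 3 1 2 k)).
Definition Etheta k := Sub (Mul (Gen (None, 0%N)) (Etheta1 k)) (Mul (Gen (None, 1%N)) (Etheta0 k)).

Lemma eval_Ejt (x : smooth_RxS p I) t i c : eval (jenv x t) (Ejt i c) = jt x i t c.
Proof. by rewrite jt.unlock. Qed.

Lemma eval_minor3 (x : smooth_RxS p I) t u v w k :
  eval (jenv x t) (Eminor3 u v w k) = minor3 (jt x u t) (jt x v t) (jt x w t) k.
Proof. by rewrite /minor3 -!eval_Ejt /=; ring. Qed.

Lemma eval_theta0 x t k : eval (jenv x t) (Etheta0 k) = theta0 x k t.
Proof.
rewrite /Etheta0 evalM eval_minor3 eval_Esum big_enum.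
by congr (_ * _); apply: eq_bigr => c _; rewrite evalM eval_Ejt expr2.
Qed.

Lemma eval_theta1 x t k : eval (jenv x t) (Etheta1 k) = theta1 x k t.
Proof.
rewrite /Etheta1 evalB !evalM !eval_minor3 !eval_Esum !big_enum.
congr (_ * _ - 5 * _ * _).
  by apply: eq_bigr => c _; rewrite evalM eval_Ejt expr2.
by apply: eq_bigr => c _; rewrite evalM !eval_Ejt.
Qed.

Lemma eval_theta x t k : eval (jenv x t) (Etheta k) = theta x k t.
Proof. by rewrite /Etheta evalB evalM eval_theta1 evalM eval_theta0. Qed.

Lemma smooth_theta0 x k : smooth I (theta0 x k).
Proof.
by apply: (smooth_ext I_limpt (f := fun t => eval (jenv x t) (Etheta0 k)));
  [move=> t _; exact: eval_theta0|exact: jenv_smooth].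
Qed.

Lemma smooth_theta1 x k : smooth I (theta1 x k).
Proof.
by apply: (smooth_ext I_limpt (f := fun t => eval (jenv x t) (Etheta1 k)));
  [move=> t _; exact: eval_theta1|exact: jenv_smooth].
Qed.

Lemma smooth_theta x k : smooth I (theta x k).
Proof.
by apply: (smooth_ext I_limpt (f := fun t => eval (jenv x t) (Etheta k)));
  [move=> t _; exact: eval_theta|exact: jenv_smooth].
Qed.

Lemma derive_theta x t k : I t ->
  eval (jenv x t) (dd (@djet R _) (Etheta k)) = derive_in I (theta x k) t.
Proof.
move=> It; rewrite -(derive_jenv I_interval I_nondeg)//; congr (derive_in I _ t).
by apply/funext => s; rewrite eval_theta.
Qed.

(** The vector theta has no double zero, and none at all at a zero of the last Wronskian. *)
Definition simple_theta : set (smooth_RxS p I) := [set x | forall t, I t ->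
  exists k, theta x k t != 0 \/ derive_in I (theta x k) t != 0].

Definition theta_off_flex : set (smooth_RxS p I) := [set x | forall t, I t ->
  wr I p.+1 (cf x) t != 0 \/ exists k, theta x k t != 0].

Lemma open_simple_theta : open simple_theta.
Proof.
have := open_jet_condition I_interval I_nondeg
  (fun k : triple + triple => match k with inl k => Etheta k
    | inr k => dd (@djet R _) (Etheta k) end).
congr open; apply/seteqP; split=> x /= H t It.
  have [[k|k] Hk] := H t It; exists k; [left; by rewrite -eval_theta|].
  by right; rewrite -derive_theta.
have [k [h|h]] := H t It; [exists (inl k)|exists (inr k)]; first by rewrite eval_theta.
by rewrite derive_theta.
Qed.

Lemma open_theta_off_flex : open theta_off_flex.
Proof.
have := open_jet_condition I_interval I_nondeg
  (fun k : option triple => match k with Some k => Etheta k | None => Ewr p p.+1 end).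
congr open; apply/seteqP; split=> x /= H t It.
  have [[k|] Hk] := H t It; first by right; exists k; rewrite -eval_theta.
  by left; rewrite -eval_Ewr.
have [h|[k h]] := H t It; first by exists None; rewrite eval_Ewr.
by exists (Some k); rewrite eval_theta.
Qed.

(** With tau fixed, theta is linear in the one-jet of a, and not degenerate when (theta0,
    theta1) is nonzero. So it suffices to add to a the product of a small function and a
    generic polynomial of degree one. *)
Lemma theta_step (N : set (smooth_RxS p I)) x : open N -> N x -> simple_wr p.+1 x ->
  (forall t, I t -> exists k, theta0 x k t != 0 \/ theta1 x k t != 0) ->
  exists y, [/\ N y, simple_wr p.+1 y, simple_theta y & theta_off_flex y].
Proof.
move=> oN Nx simx H01.
have [delta [sd dpos Hpert]] := whitney_perturbation I_interval I_nondeg 1 oN Nx.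
pose phi (l : nat) t := delta t * t ^+ l.
have sphi l : smooth I (phi l).
  apply: smooth_mul; [exact: I_limpt|exact: sd|].
  by apply: smooth_exp; [exact: I_limpt|exact: smooth_id].
pose B k (i : 'I_1) (l : 'I_2) t := phi l t * theta1 x k t - derive_in I (phi l) t * theta0 x k t.
have sB k i l : smooth I (B k i l).
  apply: smooth_add; [exact: I_limpt| |].
    by apply: smooth_mul; [exact: I_limpt|exact: sphi|exact: smooth_theta1].
  apply: smooth_opp; [exact: I_limpt|].
  by apply: smooth_mul; [exact: I_limpt|exact: smooth_derive|exact: smooth_theta0].
have Bneq t : I t -> exists k i l, B k i l t != 0.
  move=> It; have [k Hk] := H01 t It; exists k, ord0; apply: contrapT => none.
  have B0 (l : 'I_2) : B k ord0 l t = 0.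
    by apply/eqP; apply: contraT => h; exfalso; apply: none; exists l.
  have D0 : derive_in I (phi 0%N) t = derive_in I delta t.
    by congr (derive_in I _ t); apply/funext => s; rewrite /phi expr0 mulr1.
  have D1 : derive_in I (phi 1%N) t = derive_in I delta t * t + delta t.
    apply: derive_inE => //; rewrite (_ : phi 1%N = fun s => delta s * s).
      rewrite -[X in _ + X]mulr1; apply: dI_mul; [exact: dI_smooth|exact: dI_id].
    by apply/funext => s; rewrite /phi expr1.
  have := B0 (Ordinal (isT : (0 < 2)%N)); have := B0 (Ordinal (isT : (1 < 2)%N)).
  rewrite /B /= D0 D1 /phi expr0 expr1 mulr1.
  set T1 := theta1 _ _ _; set T0 := theta0 _ _ _; set d' := derive_in _ _ _ => E1 E0.
  have T00 : T0 = 0.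
    have : delta t * T0 = 0.
      have -> : delta t * T0 = t * (delta t * T1 - d' * T0) - (delta t * t * T1 - (d' * t + delta t) * T0) by ring.
      by rewrite E1 E0 mulr0 subrr.
    by move/eqP; rewrite mulf_eq0 gt_eqF ?dpos//= => /eqP.
  move: E0; rewrite T00 mulr0 subr0 => /eqP; rewrite mulf_eq0 gt_eqF ?dpos//= => /eqP T10.
  by case: Hk; rewrite -/T0 -/T1 ?T00 ?T10 eqxx.
have res1 := @affine_simple_zeros _ _ I_interval I_nondeg triple 1 2
  (theta x) B (smooth_theta x) sB.
pose w k t : 'rV[R]_2 := \row_l B k ord0 l t.
have res2 := @residual_linear_form _ _ I_interval I_nondeg 2 triple
  (fun=> wr I p.+1 (cf x)) (fun=> derive_in I (wr I p.+1 (cf x))) (theta x) w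
  (fun _ t It => dI_smooth (smooth_wr I_limpt p.+1 (smooth_cf I_interval I_nondeg x)) It).
have [z [Hz1 Hz2] z1] := residual_small (residualI res1 res2).
have [qpos [y [Ny ya yt]]] := Hpert (\poly_(l < 2) z ord0 (inord l)) (fun=> 0)
  (unit_poly_coef ord0 z1) (fun=> unit_poly0 1).
have ytE c t : I t -> tcomp y c t = tcomp x c t.
  move=> It; rewrite yt// ninv_unit; first by rewrite horner0 mulr0 addr0 mulr1.
  rewrite -[RHS](tcomp_unit x It); apply: eq_bigr => d _.
  by rewrite horner0 mulr0 addr0.
have jtE i c t : I t -> jt y i t c = jt x i t c.
  move=> It; rewrite jt.unlock.
  apply: (deriven_ext I_limpt) => // [s Is|]; first exact: ytE.
  exact: smooth_tcomp.
have m3E i t k : I t -> minor3 (jt y i t) (jt y 1 t) (jt y 2 t) k =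
    minor3 (jt x i t) (jt x 1 t) (jt x 2 t) k.
  by move=> It; rewrite /minor3 !jtE.
have spE t : I t -> speed2 y t = speed2 x t.
  by move=> It; apply: eq_bigr => c _; rewrite jtE.
have acE t : I t -> accel y t = accel x t.
  by move=> It; apply: eq_bigr => c _; rewrite !jtE.
pose al t := sm_a x t + \sum_(l < 2) z ord0 l * phi l t.
have yaE t : I t -> sm_a y t = al t.
  move=> It; rewrite ya// horner_poly mulr_sumr; congr (_ + _).
  by apply: eq_bigr => l _; rewrite inord_val mulrCA.
have dya t : I t -> derive_in I (sm_a y) t =
    derive_in I (sm_a x) t + \sum_(l < 2) z ord0 l * derive_in I (phi l) t.
  move=> It; apply: derive_inE => //; apply: (dI_ext (f := al)) => //.
    by move=> s Is; rewrite yaE.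
  apply: dI_add; first by apply: dI_smooth => //; exact: smooth_sm_a.
  by apply: dI_sum => l; apply: dI_scale; exact: dI_smooth.
have thE k t : I t -> theta y k t = affine_family (theta x k) (B k) z t.
  move=> It.
  have f1 (s s' m m' c c' n n' : R) : s = s' -> m = m' -> c = c' -> n = n' ->
      s * m - 5 * c * n = s' * m' - 5 * c' * n' by move=> -> -> -> ->.
  have f0 (s s' m m' : R) : s = s' -> m = m' -> s * m = s' * m' by move=> -> ->.
  have E1 : theta1 y k t = theta1 x k t.
    rewrite /theta1; apply: f1; [exact: spE|exact: m3E|exact: acE|exact: m3E].
  have E0 : theta0 y k t = theta0 x k t.
    rewrite /theta0; apply: f0; [exact: spE|exact: m3E].
  rewrite /theta E1 E0 (yaE t It) (dya t It) /affine_family big_ord1 /al /B.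
  rewrite !big_ord_recl !big_ord0 /=.
  move: (theta1 x k t) (theta0 x k t) (sm_a x t) (derive_in I (sm_a x) t) => T1 T0 a0 a1.
  move: (derive_in I (phi 0%N) t) (derive_in I (phi (bump 0 0)) t) (phi 0%N t) (phi (bump 0 0) t) => *.
  by ring.
have wE t : I t -> wr I p.+1 (cf y) t = wr I p.+1 (cf x) t.
  move=> It; apply: wr_ext => // [c|c s _ Is]; first exact: smooth_cf.
  by rewrite /cf ytE.
have wdE t : I t -> derive_in I (wr I p.+1 (cf y)) t = derive_in I (wr I p.+1 (cf x)) t.
  move=> It; apply: derive_inE => //.
  apply: (dI_ext (f := wr I p.+1 (cf x))) => // [s Is|]; first by rewrite wE.
  by apply: dI_smooth => //; apply: smooth_wr => // c; exact: smooth_cf.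
exists y; split=> //.
- by move=> t It; rewrite wE// wdE//; exact: simx.
- move=> t It; have [k Hk] := Hz1 t It (Bneq t It); exists k; rewrite thE//.
  have -> // : derive_in I (theta y k) t = affine_family (derive_in I (theta x k))
      (fun i j => derive_in I (B k i j)) z t.
  rewrite -(derive_affine_family I_limpt)//; last exact: smooth_theta.
  apply: derive_inE => //.
  apply: (dI_ext (f := affine_family (theta x k) (B k) z)) => // [s Is|]; first by rewrite thE.
  by apply: dI_smooth => //; apply: smooth_affine_family => //; exact: smooth_theta.
- move=> t It; rewrite wE//; have [W0|W0] := eqVneq (wr I p.+1 (cf x) t) 0; last by left.
  right; have [k [i [l Bt]]] := Bneq t It; exists k; rewrite thE//.
  have wn0 : w k t != 0.
    by apply/eqP => /rowP/(_ l); rewrite !mxE => E; move: Bt; rewrite (ord1 i) E eqxx.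
  have dW : derive_in I (wr I p.+1 (cf x)) t != 0.
    by case: (simx t It) => //; rewrite W0 eqxx.
  have := Hz2 k t It W0 dW wn0; congr (_ != _).
  rewrite /affine_family big_ord1 /dot; congr (_ + _); apply: eq_bigr => j _.
  by rewrite mxE.
Qed.

End Theta.

Section RowDependence.
Context {R : realType}.

Lemma det_rows_dep n (A : 'M[R]_n) (v : 'rV[R]_n) : v != 0 -> v *m A = 0 -> \det A = 0.
Proof. by move=> v0 vA; apply/eqP/det0P; exists v. Qed.

Lemma mul_delta_row n (A : 'M[R]_n) (i : 'I_n) : delta_mx 0 i *m A = row i A.
Proof. by rewrite -rowE. Qed.

Lemma det_row0 n (A : 'M[R]_n) i : row i A = 0 -> \det A = 0.
Proof.
move=> Ai; apply: (det_rows_dep (v := delta_mx 0 i)); last by rewrite mul_delta_row.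
by apply/eqP => /rowP/(_ i); rewrite !mxE !eqxx => /eqP; rewrite oner_eq0.
Qed.

Lemma det_row_span n (A : 'M[R]_n) i j k (a b : R) : k != i -> k != j ->
  row k A = a *: row i A + b *: row j A -> \det A = 0.
Proof.
move=> ki kj E.
apply: (det_rows_dep (v := delta_mx 0 k - a *: delta_mx 0 i - b *: delta_mx 0 j)).
  apply/eqP => /rowP/(_ k); rewrite !mxE !eqxx (negbTE ki) (negbTE kj) /= !mulr0 !subr0.
  by move/eqP; rewrite oner_eq0.
by rewrite !mulmxBl -!scalemxAl !mul_delta_row E [_ + b *: _]addrC addrK subrr.
Qed.

(** Cramer's rule with respect to a nonzero 2 x 2 minor. *)
Lemma minor3_span p (u v w : 'I_p.+1 -> R) : (forall k, minor3 u v w k = 0) ->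
  (exists i j, v i * w j - v j * w i != 0) ->
  exists a b, forall c, u c = a * v c + b * w c.
Proof.
move=> H [i [j m0]]; set m := _ - _ in m0.
exists ((u i * w j - u j * w i) / m), ((u j * v i - u i * v j) / m) => c.
have := H (c, i, j); rewrite /minor3 /= => E.
have Em : u c * m = (u i * w j - u j * w i) * v c + (u j * v i - u i * v j) * w c.
  by apply/eqP; rewrite -subr_eq0; apply/eqP; rewrite -E /m; ring.
by rewrite -[LHS](mulfK m0) Em; field.
Qed.

Lemma minor2_dep p (v w : 'I_p.+1 -> R) : (forall i j, v i * w j - v j * w i = 0) ->
  (forall c, v c = 0) \/ exists a, forall c, w c = a * v c.
Proof.
move=> H; have [v0|] := pselect (forall c, v c = 0); first by left.
move=> /existsNP[i /eqP vi]; right; exists (w i / v i) => c.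
have := H i c; move/eqP; rewrite subr_eq0 => /eqP E.
by apply: (mulfI vi); rewrite E; field.
Qed.

End RowDependence.

Section Nondegenerate.
Context {R : realType} (p : nat) (I : set R).
Hypothesis I_interval : is_interval I.
Hypothesis I_nondeg : exists u v, [/\ I u, I v & u < v].
Let I_limpt : limpt I := interval_limpt I_interval I_nondeg.

Lemma cf_ord (x : smooth_RxS p I) (c : 'I_p.+1) : cf x c = tcomp x c.
Proof. by rewrite /cf inord_val. Qed.

Let A (x : smooth_RxS p I) t : 'M[R]_p.+1 := \matrix_(i < p.+1, c < p.+1) deriven_in I i (cf x c) t.
Let A1 (x : smooth_RxS p I) t : 'M[R]_p.+1 := \matrix_(i < p.+1, c < p.+1)
  deriven_in I (if i == p :> nat then p.+1 else i) (cf x c) t.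

Let rowA x t (i : 'I_p.+1) : row i (A x t) = \row_c jt x i t c.
Proof. by apply/rowP => c; rewrite !mxE cf_ord jt.unlock. Qed.

Let rowA1 x t (i : 'I_p.+1) : row i (A1 x t) = \row_c jt x (if i == p :> nat then p.+1 else i) t c.
Proof. by apply/rowP => c; rewrite !mxE cf_ord jt.unlock. Qed.

(** The last Wronskian and its derivative are the determinants of A and A1, whose first p
    rows are the derivatives of tau below order p; so any linear relation among the rows of
    both matrices is excluded. *)
Lemma wr_not_both0 (x : smooth_RxS p I) t : simple_wr p.+1 x -> I t ->
  \det (A x t) = 0 -> \det (A1 x t) = 0 -> False.
Proof.
move=> sx It W0 W1; case: (sx t It) => [/eqP|]; first by apply; exact: W0.
have -> := @derive_wr _ _ I_limpt p (cf x) t (smooth_cf I_interval I_nondeg x) It.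
by move/eqP; apply; exact: W1.
Qed.

Lemma speed2_gt0 (x : smooth_RxS p I) t : (2 <= p)%N -> simple_wr p.+1 x -> I t -> 0 < speed2 x t.
Proof.
move=> p2 sx It; rewrite lt_neqAle sumr_ge0 ?andbT => [|c _]; last exact: sqr_ge0.
rewrite eq_sym; apply/eqP => /eqP; rewrite psumr_eq0 => [/allP H|c _]; last exact: sqr_ge0.
have j1 c : jt x 1 t c = 0.
  by have := H c (mem_index_enum c); rewrite sqrf_eq0 => /eqP.
have i1 : (1 < p.+1)%N by rewrite ltnS ltnW.
apply: (wr_not_both0 sx It); apply: (det_row0 (i := Ordinal i1)).
  by rewrite rowA; apply/rowP => c; rewrite !mxE j1.
by rewrite rowA1; apply/rowP => c; rewrite !mxE /= ltn_eqF// j1.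
Qed.

(** In dimension at least four no further perturbation is needed: if theta0 and theta1 vanish,
    tau''' and tau'''' lie in the span of tau' and tau'', which gives a linear relation among
    the rows of both A and A1. *)
Lemma theta01_nonzero (x : smooth_RxS p I) t : (3 <= p)%N -> simple_wr p.+1 x -> I t ->
  exists k, theta0 x k t != 0 \/ theta1 x k t != 0.
Proof.
move=> p3 sx It; have s0 := speed2_gt0 (ltnW p3) sx It.
apply: contrapT => none.
have m3 k : minor3 (jt x 3 t) (jt x 1 t) (jt x 2 t) k = 0.
  have : theta0 x k t = 0 by apply/eqP; apply: contraT => h; exfalso; apply: none; exists k; left.
  by move/eqP; rewrite mulf_eq0 gt_eqF//= => /eqP.
have m4 k : minor3 (jt x 4 t) (jt x 1 t) (jt x 2 t) k = 0.
  have : theta1 x k t = 0 by apply/eqP; apply: contraT => h; exfalso; apply: none; exists k; right.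
  by move/eqP; rewrite /theta1 m3 mulr0 subr0 mulf_eq0 gt_eqF//= => /eqP.
have i1 : (1 < p.+1)%N by rewrite ltnS ltnW// ltnW.
have i2 : (2 < p.+1)%N by rewrite ltnS ltnW.
have i3 : (3 < p.+1)%N by rewrite ltnS.
have p1 : (1 == p) = false by rewrite ltn_eqF// ltnW.
have p2 : (2 == p) = false by rewrite ltn_eqF.
pose o1 := Ordinal i1; pose o2 := Ordinal i2; pose o3 := Ordinal i3.
have [ind|dep] := pselect (exists i j, jt x 1 t i * jt x 2 t j - jt x 1 t j * jt x 2 t i != 0).
  have [a [b E3]] := minor3_span m3 ind; have [a' [b' E4]] := minor3_span m4 ind.
  apply: (wr_not_both0 sx It).
    apply: (@det_row_span _ _ _ o1 o2 o3 a b) => //.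
    by rewrite !rowA; apply/rowP => c; rewrite !mxE /= E3.
  have [E|np3] := eqVneq 3%N p.
    have e4 : (if 3%N == p then p.+1 else 3%N) = 4%N by rewrite -E eqxx.
    apply: (@det_row_span _ _ _ o1 o2 o3 a' b') => //.
    by rewrite !rowA1; apply/rowP => c; rewrite !mxE /= p1 p2 e4 E4.
  apply: (@det_row_span _ _ _ o1 o2 o3 a b) => //.
  by rewrite !rowA1; apply/rowP => c; rewrite !mxE /= p1 p2 (negbTE np3) E3.
have [|v0|[a E]] := @minor2_dep _ _ (jt x 1 t) (jt x 2 t).
- by move=> i j; apply/eqP; apply: contraT => h; exfalso; apply: dep; exists i, j.
- apply: (wr_not_both0 sx It); apply: (det_row0 (i := o1)).
    by rewrite rowA; apply/rowP => c; rewrite !mxE v0.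
  by rewrite rowA1; apply/rowP => c; rewrite !mxE /= p1 v0.
- apply: (wr_not_both0 sx It); apply: (@det_row_span _ _ _ o1 o1 o2 a 0) => //.
    by rewrite !rowA; apply/rowP => c; rewrite !mxE /= E mul0r addr0.
  by rewrite !rowA1; apply/rowP => c; rewrite !mxE /= p1 p2 E mul0r addr0.
Qed.

End Nondegenerate.

(** * Torsion in three dimensions *)

Section JetFamilies.
Context {R : realType} (I : set R).
Hypothesis I_interval : is_interval I.
Hypothesis I_nondeg : exists u v, [/\ I u, I v & u < v].

(** The differential of an expression at r in the direction pi. *)
Fixpoint ddir (A : Type) (r pi : A -> R) (e : dexp A) : R :=
  match e with
  | Cst _ => 0
  | Gen x => pi x
  | Add e1 e2 => ddir r pi e1 + ddir r pi e2
  | Mul e1 e2 => ddir r pi e1 * eval r e2 + eval r e1 * ddir r pi e2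
  end.

Lemma ddirE (A : Type) (r pi : A -> R) e :
  ddir r pi e = eval r (dd (fun x => Cst A (pi x)) e).
Proof. by elim: e => //= [e1 -> e2 ->|e1 -> e2 ->]. Qed.

Lemma ddir_low (A : Type) (r pi : A -> R) e : gens (fun x => pi x = 0) e -> ddir r pi e = 0.
Proof.
elim: e => [c|x|e1 IH1 e2 IH2|e1 IH1 e2 IH2] //=.
  by move=> [/IH1 -> /IH2 ->]; rewrite addr0.
by move=> [/IH1 -> /IH2 ->]; rewrite mul0r mulr0 addr0.
Qed.

Lemma ddir_ext (A : Type) (ok : A -> Prop) (r pi pi' : A -> R) e :
  (forall x, ok x -> pi x = pi' x) -> gens ok e -> ddir r pi e = ddir r pi' e.
Proof.
move=> H; elim: e => [c|x|e1 IH1 e2 IH2|e1 IH1 e2 IH2] //=; first exact: H.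
  by move=> [/IH1 -> /IH2 ->].
by move=> [/IH1 -> /IH2 ->].
Qed.

Lemma ddir_lin (A : Type) (r : A -> R) n (k : 'I_n -> R) (pi : 'I_n -> A -> R) e :
  ddir r (fun x => \sum_l k l * pi l x) e = \sum_l k l * ddir r (pi l) e.
Proof.
elim: e => [c|x|e1 IH1 e2 IH2|e1 IH1 e2 IH2] //=.
- by rewrite big1// => l _; rewrite mulr0.
- by rewrite IH1 IH2 -big_split /=; apply: eq_bigr => l _; rewrite mulrDr.
- rewrite IH1 IH2 mulr_suml mulr_sumr -big_split /=; apply: eq_bigr => l _.
  by ring.
Qed.

Lemma jcont_ddir {V : normedModType R} (A : Type) (env pi : V -> R -> A -> R) e :
  (forall x, jcont I (fun z t => env z t x)) -> (forall x, jcont I (fun z t => pi z t x)) ->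
  jcont I (fun z t => ddir (env z t) (pi z t) e).
Proof.
move=> H1 H2; elim: e => [c|x|e1 IH1 e2 IH2|e1 IH1 e2 IH2] /=.
- exact: jcont_const.
- exact: H2.
- exact: jcont_add.
- by apply: jcont_add; apply: jcont_mul => //; exact: jcont_eval.
Qed.

(** Generic simplicity of zeros for a polynomial in a jet that depends affinely on the
    parameters, while the polynomial may be nonlinear. By the mean value theorem a nonzero
    differential along pi j means that the parameter direction v j moves the value. *)
Theorem jet_family_simple_zeros {V : normedModType R} (J : countType) (v : J -> V)
    (A : Type) (e : dexp A) (dA : A -> dexp A) (env : V -> R -> A -> R)
    (pi : J -> R -> A -> R) :
  (forall z t x, I t -> dI I (fun s => env z s x) t (eval (env z t) (dA x))) ->
  (forall x, jcont I (fun z t => env z t x)) ->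
  (forall j x, smooth I (fun t => pi j t x)) ->
  (forall j z t h x, env (z + h *: v j) t x = env z t x + h * pi j t x) ->
  residual [set z | forall t, I t -> (exists j, ddir (env z t) (pi j t) e != 0) ->
    eval (env z t) e != 0 \/ eval (env z t) (dd dA e) != 0].
Proof.
move=> H1 H2 H3 H4.
have := @generic_simple_zeros _ _ I_interval I_nondeg V unit J v
  (fun _ z t => eval (env z t) e) (fun _ z t => eval (env z t) (dd dA e)) _ _ _.
move=> H; apply: residualS (H _ _ _) => {H}; last 3 first.
- by move=> _ z t It; apply: dI_eval => x; exact: H1.
- by move=> _; exact: jcont_eval.
- by move=> _; exact: jcont_eval.
move=> z Hz t It [j m0]; have [|k Hk] := Hz t It; last exact: Hk.
exists tt, j; set m := ddir _ _ _ in m0.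
have m2 : 0 < `|m| / 2 by rewrite divr_gt0 ?normr_gt0.
have Cd : jcont I (fun z t => ddir (env z t) (pi j t) e).
  apply: jcont_ddir => // x; exact: jcont_time.
have [d d0 D] := Cd z t _ It m2.
exists (`|m| / 2), d; split=> // z' s h Is z'd zhd sd.
pose f (k : R) := eval (env (z' + k *: v j) s) e.
have Df k : setT k -> dI setT f k (ddir (env (z' + k *: v j) s) (pi j s) e).
  move=> _; rewrite ddirE.
  apply: (dI_eval (env := fun k => env (z' + k *: v j) s)) => x /=.
  rewrite (_ : (fun k => _) = fun k => env z' s x + pi j s x * k); last first.
    by apply/funext => k'; rewrite H4 mulrC.
  by have := dI_add (dI_cst setT k (env z' s x)) (dI_scale (c := pi j s x) (dI_id setT k)); rewrite add0r mulr1.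
have Ti : is_interval [set: R] by [].
have low k : 0 <= k <= 1 -> `|m| / 2 <= `|ddir (env (z' + (k * h) *: v j) s) (pi j s) e|.
  move=> /andP[k0 k1]; have zk : `|z' + (k * h) *: v j - z| < d.
    have -> : z' + (k * h) *: v j - z = (1 - k) *: (z' - z) + k *: (z' + h *: v j - z).
      rewrite [z' + h *: v j - z]addrAC [k *: (_ + _)]scalerDr scalerA addrA -scalerDl subrK scale1r.
      by rewrite addrAC.
    rewrite (le_lt_trans (ler_normD _ _))// !normrZ (ger0_norm k0) ger0_norm ?subr_ge0//.
    move: z'd zhd; set a := `|_ - z|; set b := `|_ - z| => ad bd.
    have [->|kn] := eqVneq k 0; first by rewrite subr0 mul1r mul0r addr0.
    have kp : 0 < k by rewrite lt_neqAle eq_sym kn.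
    have : (1 - k) * a <= (1 - k) * d by rewrite ler_wpM2l ?subr_ge0// ltW.
    have : k * b < k * d by rewrite ltr_pM2l.
    by move: (k * b) => kb; nra.
  have := D _ s Is zk sd; have := ler_normB (ddir (env (z' + (k * h) *: v j) s) (pi j s) e)
    (ddir (env (z' + (k * h) *: v j) s) (pi j s) e - m).
  by rewrite opprB addrC subrK -/m; move: (`|m|) (`|_ - m|) (`|ddir _ _ _|) => *; lra.
have f0 : f 0 = eval (env z' s) e by rewrite /f scale0r addr0.
rewrite -/(f h) -f0.
have [h0|h0|->] := ltgtP h 0; last by rewrite normr0 mulr0.
- have [c [hc c0 E]] := dI_MVT Ti Df (Logic.I : setT h) (Logic.I : setT 0) h0.
  rewrite distrC E normrM sub0r normrN ler_wpM2r//.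
  have hn : h != 0 by rewrite lt_eqF.
  have := low (c / h); rewrite divfK//; apply.
  by rewrite ler_ndivlMr// mul0r ltW//= ler_ndivrMr// mul1r ltW.
- have [c [hc c0 E]] := dI_MVT Ti Df (Logic.I : setT 0) (Logic.I : setT h) h0.
  rewrite E normrM subr0 ler_wpM2r//.
  have hn : h != 0 by rewrite gt_eqF.
  have := low (c / h); rewrite divfK//; apply.
  by rewrite ler_pdivlMr// mul0r ltW//= ler_pdivrMr// mul1r ltW.
Qed.

End JetFamilies.

Section GeodesicCurvature.
Context {R : realType}.

(** Expressions in the jet of a curve s in 3-space. The projection s / |s| has geodesic
    curvature EW (EQ / EK)^(3/2), where EQ = |s|^2, EK = |s|^2 |s'|^2 - <s,s'>^2 and
    EW = det (s, s', s''), and ET is the numerator of its derivative. *)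
Definition gen3 := ('I_3 * nat)%type.
Definition g3 (i k : nat) : @dexp R gen3 := Gen (inord k : 'I_3, i).
Definition Edot i j := Add (Add (Mul (g3 i 0) (g3 j 0)) (Mul (g3 i 1) (g3 j 1))) (Mul (g3 i 2) (g3 j 2)).
Definition Edet3 i j k :=
  Add (Sub (Mul (g3 i 0) (Sub (Mul (g3 j 1) (g3 k 2)) (Mul (g3 j 2) (g3 k 1))))
    (Mul (g3 i 1) (Sub (Mul (g3 j 0) (g3 k 2)) (Mul (g3 j 2) (g3 k 0)))))
  (Mul (g3 i 2) (Sub (Mul (g3 j 0) (g3 k 1)) (Mul (g3 j 1) (g3 k 0)))).

Definition EQ := Edot 0 0.
Definition EK := Sub (Mul EQ (Edot 1 1)) (Mul (Edot 0 1) (Edot 0 1)).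
Definition EW := Edet3 0 1 2.
Definition Ed (e : @dexp R gen3) := dd (@djet R _) e.
Definition Ecomb (q q1 k k1 w w1 : @dexp R gen3) :=
  Add (Mul (Cst _ 2) (Mul q (Mul k w1))) (Mul (Mul (Cst _ 3) w) (Sub (Mul q1 k) (Mul q k1))).
Definition ET := Ecomb EQ (Ed EQ) EK (Ed EK) EW (Ed EW).

Lemma eval_comb (env : gen3 -> R) q q1 k k1 w w1 : eval env (Ecomb q q1 k k1 w w1) =
  2 * (eval env q * (eval env k * eval env w1)) + 3 * eval env w *
   (eval env q1 * eval env k - eval env q * eval env k1).
Proof. by rewrite /= mulN1r. Qed.

Lemma ddir_comb (env pi : gen3 -> R) q q1 k k1 w w1 : ddir env pi q = 0 ->
  ddir env pi q1 = 0 -> ddir env pi k = 0 -> ddir env pi k1 = 0 -> ddir env pi w = 0 ->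
  ddir env pi (Ecomb q q1 k k1 w w1) = 2 * (eval env q * (eval env k * ddir env pi w1)).
Proof. by move=> /= -> -> -> -> ->; ring. Qed.

Lemma evalET (env : gen3 -> R) : eval env ET =
  2 * (eval env EQ * (eval env EK * eval env (Ed EW))) + 3 * eval env EW *
   (eval env (Ed EQ) * eval env EK - eval env EQ * eval env (Ed EK)).
Proof. exact: eval_comb. Qed.

Lemma ord3_cases (c : 'I_3) : [\/ c = inord 0, c = inord 1 | c = inord 2].
Proof.
case: c => [m h]; have h' := h; case: m h h' => [|[|[|m]]] h h' //.
- by constructor 1; apply/val_inj; rewrite /= inordK.
- by constructor 2; apply/val_inj; rewrite /= inordK.
- by constructor 3; apply/val_inj; rewrite /= inordK.
Qed.

Lemma inord3_eq (i j : nat) : (i < 3)%N -> (j < 3)%N -> ((inord i : 'I_3) == inord j) = (i == j).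
Proof. by move=> h1 h2; rewrite -(inj_eq val_inj) /= !inordK. Qed.

(** The components of the cross product of s and s'. *)
Definition ecof (env : gen3 -> R) (c : 'I_3) : R :=
  let a i k := env (inord k : 'I_3, i) in
  if c == inord 0 then a 0 1 * a 1 2 - a 0 2 * a 1 1
  else if c == inord 1 then a 0 2 * a 1 0 - a 0 0 * a 1 2
  else a 0 0 * a 1 1 - a 0 1 * a 1 0.

Lemma ecof0 env : ecof env (inord 0) = env (inord 1 : 'I_3, 0) * env (inord 2 : 'I_3, 1)
   - env (inord 2 : 'I_3, 0) * env (inord 1 : 'I_3, 1).
Proof. by rewrite /ecof eqxx. Qed.
Lemma ecof1 env : ecof env (inord 1) = env (inord 2 : 'I_3, 0) * env (inord 0 : 'I_3, 1)
   - env (inord 0 : 'I_3, 0) * env (inord 2 : 'I_3, 1).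
Proof. by rewrite /ecof inord3_eq//= eqxx. Qed.
Lemma ecof2 env : ecof env (inord 2) = env (inord 0 : 'I_3, 0) * env (inord 1 : 'I_3, 1)
   - env (inord 1 : 'I_3, 0) * env (inord 0 : 'I_3, 1).
Proof. by rewrite /ecof !inord3_eq. Qed.

(** If s and s' are parallel, det (s, s', s'') and its derivative det (s, s', s''') vanish. *)
Lemma evalW_cof env : (forall c, ecof env c = 0) -> eval env EW = 0 /\ eval env (Ed EW) = 0.
Proof.
move=> H; have := H (inord 0); have := H (inord 1); have := H (inord 2).
rewrite ecof0 ecof1 ecof2 /=.
set a0 := env (inord 0 : 'I_3, 0%N); set a1 := env (inord 1 : 'I_3, 0%N); set a2 := env (inord 2 : 'I_3, 0%N).
set b0 := env (inord 0 : 'I_3, 1%N); set b1 := env (inord 1 : 'I_3, 1%N); set b2 := env (inord 2 : 'I_3, 1%N).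
set c0 := env (inord 0 : 'I_3, 2%N); set c1 := env (inord 1 : 'I_3, 2%N); set c2 := env (inord 2 : 'I_3, 2%N).
set d0 := env (inord 0 : 'I_3, 3%N); set d1 := env (inord 1 : 'I_3, 3%N); set d2 := env (inord 2 : 'I_3, 3%N).
move=> h2 h1 h0; split.
  transitivity (c0 * (a1 * b2 - a2 * b1) + c1 * (a2 * b0 - a0 * b2) + c2 * (a0 * b1 - a1 * b0)).
    by ring.
  by rewrite h0 h1 h2 !mulr0 !addr0.
transitivity (d0 * (a1 * b2 - a2 * b1) + d1 * (a2 * b0 - a0 * b2) + d2 * (a0 * b1 - a1 * b0)).
  by ring.
by rewrite h0 h1 h2 !mulr0 !addr0.
Qed.

(** Lagrange's identity. *)
Lemma evalK_cof env : eval env EK =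
  ecof env (inord 0) ^+ 2 + ecof env (inord 1) ^+ 2 + ecof env (inord 2) ^+ 2.
Proof. by rewrite ecof0 ecof1 ecof2 /=; ring. Qed.

Lemma evalK_gt0 env c : ecof env c != 0 -> 0 < eval env EK.
Proof.
move=> h; have p : 0 < ecof env c ^+ 2 by rewrite lt_neqAle eq_sym sqrf_eq0 h sqr_ge0.
rewrite evalK_cof; have := sqr_ge0 (ecof env (inord 0)); have := sqr_ge0 (ecof env (inord 1)).
have := sqr_ge0 (ecof env (inord 2)).
by have [E|E|E] := ord3_cases c; rewrite E in p; move: p; move: (_ ^+ 2) (ecof env (inord 1) ^+ 2) (ecof env (inord 0) ^+ 2) => *; lra.
Qed.

(** The third derivative of s enters ET only through the derivative of EW, linearly with
    coefficients the cross product of s and s'. *)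
Lemma ddir_ET (env pi : gen3 -> R) c m : (forall d i, (i <= 2)%N -> pi (d, i) = 0) ->
  (forall d, pi (d, 3%N) = (c == d)%:R * m) ->
  ddir env pi ET = 2 * (eval env EQ * (eval env EK * (m * ecof env c))).
Proof.
move=> H H3.
have lQ : ddir env pi EQ = 0 by apply: ddir_low; rewrite /= !H.
have lQ1 : ddir env pi (Ed EQ) = 0 by apply: ddir_low; rewrite /= !H.
have lK : ddir env pi EK = 0 by apply: ddir_low; rewrite /= !H.
have lK1 : ddir env pi (Ed EK) = 0 by apply: ddir_low; rewrite /= !H.
have lW : ddir env pi EW = 0 by apply: ddir_low; rewrite /= !H.
have H0 d : pi (d, 0%N) = 0 by exact: H.
have H1 d : pi (d, 1%N) = 0 by exact: H.
have H2 d : pi (d, 2%N) = 0 by exact: H.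
have lW1 : ddir env pi (Ed EW) = m * ecof env c.
  by rewrite /= !H0 !H1 !H2 !H3; have [->|->|->] := ord3_cases c; rewrite ?ecof0 ?ecof1 ?ecof2 !inord3_eq//=; ring.
by rewrite /ET ddir_comb// lW1.
Qed.

Lemma EK1E (env : gen3 -> R) : eval env (Ed EK) =
  eval env (Ed EQ) * eval env (Edot 1 1) + eval env EQ * (2 * eval env (Edot 1 2))
  - 2 * eval env (Edot 0 1) * (eval env (Edot 1 1) + eval env (Edot 0 2)).
Proof. by rewrite /=; ring. Qed.

Lemma EKE (env : gen3 -> R) : eval env EK =
  eval env EQ * eval env (Edot 1 1) - eval env (Edot 0 1) ^+ 2.
Proof. by rewrite /=; ring. Qed.

Lemma EQ1E (env : gen3 -> R) : eval env (Ed EQ) = 2 * eval env (Edot 0 1).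
Proof. by rewrite /=; ring. Qed.

Lemma EQ2E (env : gen3 -> R) :
  eval env (Ed (Ed EQ)) = 2 * (eval env (Edot 0 2) + eval env (Edot 1 1)).
Proof. by rewrite /=; ring. Qed.

Lemma EQ3E (env : gen3 -> R) :
  eval env (Ed (Ed (Ed EQ))) = 2 * (eval env (Edot 0 3) + 3 * eval env (Edot 1 2)).
Proof. by rewrite /=; ring. Qed.

(** The linear relation between s, s', s'', s''' in 3-space, paired with s. *)
Lemma Edet3_relation (env : gen3 -> R) : eval env (Edet3 1 2 3) * eval env EQ =
  eval env (Edet3 0 2 3) * eval env (Edot 0 1)
  - eval env (Ed EW) * eval env (Edot 0 2) + eval env EW * eval env (Edot 0 3).
Proof. by rewrite /=; ring. Qed.

(** For a curve on the unit sphere the pairings of s with its derivatives are determined by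
    differentiating <s,s> = 1, and ET becomes the torsion determinant. *)
Lemma ET_of_unit (env : gen3 -> R) : eval env EQ = 1 -> eval env (Ed EQ) = 0 ->
  eval env (Ed (Ed EQ)) = 0 -> eval env (Ed (Ed (Ed EQ))) = 0 ->
  eval env ET = 2 * eval env (Edet3 1 2 3).
Proof.
move=> h0 h1 h2 h3.
have s1 : eval env (Edot 0 1) = 0 by move: h1; rewrite EQ1E; move: (eval _ _) => v h; lra.
have s2 : eval env (Edot 0 2) = - eval env (Edot 1 1).
  by move: h2; rewrite EQ2E; move: (eval _ _) (eval _ (Edot 1 1)) => v w h; lra.
have s3 : eval env (Edot 0 3) = - 3 * eval env (Edot 1 2).
  by move: h3; rewrite EQ3E; move: (eval _ _) (eval _ (Edot 1 2)) => v w h; lra.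
have := Edet3_relation env; rewrite evalET EK1E EKE h0 h1 s1 s2 s3 mulr1 => ->.
by move: (eval _ (Ed EW)) (eval _ EW) (eval _ (Edot 1 1)) (eval _ (Edot 1 2)) => *; ring.
Qed.

Lemma gens_ET : gens (fun x : gen3 => (x.2 <= 3)%N) ET.
Proof. by rewrite /=. Qed.

End GeodesicCurvature.

Section CurvesOnTheSphere.
Context {R : realType} (I : set R).
Hypothesis I_interval : is_interval I.
Hypothesis I_nondeg : exists u v, [/\ I u, I v & u < v].
Let I_limpt : limpt I := interval_limpt I_interval I_nondeg.

Lemma det_mx33 (M : 'M[R]_3) (f : nat -> nat -> R) : (forall i j, M i j = f i j) ->
  \det M = f 2 0 * (f 0 1 * f 1 2 - f 0 2 * f 1 1) + f 2 1 * (f 0 2 * f 1 0 - f 0 0 * f 1 2)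
    + f 2 2 * (f 0 0 * f 1 1 - f 0 1 * f 1 0).
Proof.
move=> ME; rewrite (expand_det_row _ ord0) !big_ord_recl big_ord0 /cofactor.
rewrite !(expand_det_row _ ord0) !big_ord_recl !big_ord0 /cofactor !det_mx11 !mxE !ME /=.
by rewrite /bump /= !add1n ?addn0 !expr0 ?expr1 ?expr2; ring.
Qed.

Section OneCurve.
Variable sg : 'I_3 -> R -> R.
Hypothesis s_smooth : forall c, smooth I (sg c).

Definition env3 t := fenv I sg t.

Lemma dI_env3 e t : I t -> dI I (fun t => eval (env3 t) e) t (eval (env3 t) (Ed e)).
Proof. by move=> It; apply: dI_eval => x; exact: dI_fenv. Qed.

Lemma smooth_env3 e : smooth I (fun t => eval (env3 t) e).
Proof. by have [] := smooth_fenv I_limpt (e := e) s_smooth (fun t _ => erefl). Qed.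

Lemma derive_env3 e t : I t -> derive_in I (fun t => eval (env3 t) e) t = eval (env3 t) (Ed e).
Proof. by move=> It; apply: derive_inE => //; exact: dI_env3. Qed.

End OneCurve.

Lemma Ed_scale sg sg' (lam : R -> R) e k t : (forall c, smooth I (sg c)) ->
  (forall c, smooth I (sg' c)) -> smooth I lam ->
  (forall s, I s -> eval (env3 sg' s) e = lam s ^+ k * eval (env3 sg s) e) -> I t ->
  eval (env3 sg' t) (Ed e) = k%:R * lam t ^+ k.-1 * derive_in I lam t * eval (env3 sg t) e
    + lam t ^+ k * eval (env3 sg t) (Ed e).
Proof.
move=> ss ss' sl E It; rewrite -(derive_env3 ss')//; apply: derive_inE => //.
apply: (dI_ext (f := fun s => lam s ^+ k * eval (env3 sg s) e)) => //.
  by move=> s Is; rewrite E.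
by apply: dI_mul; [apply: dI_pow; exact: dI_smooth|exact: dI_env3].
Qed.

(** ET is a relative invariant of weight nine, because it is up to a power of |s| a quantity
    that belongs to the projected curve s / |s|. The weights of EQ, EK, EW are 2, 4, 3. *)
Lemma ET_scale sg sg' (lam : R -> R) t : (forall c, smooth I (sg c)) ->
  (forall c, smooth I (sg' c)) -> smooth I lam ->
  (forall c s, I s -> sg' c s = lam s * sg c s) -> I t ->
  eval (env3 sg' t) ET = lam t ^+ 9 * eval (env3 sg t) ET /\
  eval (env3 sg' t) EW = lam t ^+ 3 * eval (env3 sg t) EW.
Proof.
move=> ss ss' sl E.
have e0 s c : I s -> env3 sg' s (c, 0%N) = lam s * env3 sg s (c, 0%N).
  by move=> Is; rewrite /env3 /fenv /= E.
have E' n s c : I s -> env3 sg' s (c, n) = deriven_in I n (fun s => lam s * sg c s) s.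
  move=> Is; rewrite /env3 /fenv /=; apply: (deriven_ext I_limpt) => //.
  by move=> s' Is'; rewrite E.
have e1 s c : I s -> env3 sg' s (c, 1%N) =
    deriven_in I 1 lam s * env3 sg s (c, 0%N) + lam s * env3 sg s (c, 1%N).
  move=> Is; rewrite E'// (deriven_mul I_limpt)// !big_ord_recl big_ord0 /bump /=.
  by rewrite bin0 bin1 /env3 /fenv /=; ring.
have e2 s c : I s -> env3 sg' s (c, 2%N) = deriven_in I 2 lam s * env3 sg s (c, 0%N)
    + 2 * deriven_in I 1 lam s * env3 sg s (c, 1%N) + lam s * env3 sg s (c, 2%N).
  move=> Is; rewrite E'// (deriven_mul I_limpt)// !big_ord_recl big_ord0 /bump /=.
  rewrite bin0 bin1 binn /env3 /fenv /=.
  move: (derive_in I (derive_in I lam) s) (derive_in I lam s) (lam s) => l2 l1 l0.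
  move: (derive_in I (derive_in I (sg c)) s) (derive_in I (sg c) s) (sg c s) => g2 g1 g0.
  by ring.
have hQ s : I s -> eval (env3 sg' s) EQ = lam s ^+ 2 * eval (env3 sg s) EQ.
  by move=> Is; rewrite /= !e0//; ring.
have hK s : I s -> eval (env3 sg' s) EK = lam s ^+ 4 * eval (env3 sg s) EK.
  move=> Is; rewrite /= !e0// !e1//.
  move: (deriven_in I 1 lam s) => l1; move: (env3 sg s) (lam s) => r l; ring.
have hW s : I s -> eval (env3 sg' s) EW = lam s ^+ 3 * eval (env3 sg s) EW.
  move=> Is; rewrite /= !e0// !e1// !e2//.
  move: (deriven_in I 1 lam s) (deriven_in I 2 lam s) => l1 l2.
  move: (env3 sg s) (lam s) => r l; ring.
move=> It; split; last exact: hW.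
rewrite !evalET hQ// hK// hW// (Ed_scale ss ss' sl hQ)// (Ed_scale ss ss' sl hK)//.
rewrite (Ed_scale ss ss' sl hW)// -[2.-1]/1%N -[4.-1]/3%N -[3.-1]/2%N.
set q := eval _ EQ; set k := eval _ EK; set w := eval _ EW.
set q1 := eval _ (Ed EQ); set k1 := eval _ (Ed EK); set w1 := eval _ (Ed EW).
by move: (lam t) (derive_in I lam t) => l l1; ring.
Qed.

End CurvesOnTheSphere.

Section PlanarStep.
Context {R : realType} (I : set R).
Hypothesis I_interval : is_interval I.
Hypothesis I_nondeg : exists u v, [/\ I u, I v & u < v].
Let I_limpt : limpt I := interval_limpt I_interval I_nondeg.
Implicit Types (x y : smooth_RxS 2 I).

Lemma wr3E x t : wr I 3 (cf x) t = eval (env3 I (tcomp x) t) EW.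
Proof.
rewrite /wr (det_mx33 (f := fun i j => env3 I (tcomp x) t (inord j, i))).
  by rewrite /=; move: (env3 I (tcomp x) t) => r; ring.
by move=> i j; rewrite !mxE cf_ord inord_val.
Qed.

Let k012 : triple 2 := (inord 0, inord 1, inord 2).

Lemma jt_env3 x i t c : env3 I (tcomp x) t (c, i) = jt x i t c.
Proof. by rewrite jt.unlock. Qed.

Lemma ET_unit x t : I t ->
  eval (env3 I (tcomp x) t) ET = 2 * minor3 (jt x 3 t) (jt x 1 t) (jt x 2 t) k012.
Proof.
pose r t := env3 I (tcomp x) t; rewrite -/(r t).
have dr e s : I s -> dI I (fun s => eval (r s) e) s (eval (r s) (Ed e)).
  by apply: dI_env3 => c; exact: smooth_tcomp.
have z (e : dexp gen3) v s : (forall s, I s -> eval (r s) e = v) -> I s -> eval (r s) (Ed e) = 0.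
  move=> ev Is; apply: (dI_unique I_limpt Is (dr e s Is)).
  by apply: (dI_ext (f := fun=> v)) (dI_cst I s v) => // s' Is'; rewrite ev.
have q0 s : I s -> eval (r s) EQ = 1.
  move=> Is; rewrite -(tcomp_unit x Is) !big_ord_recl big_ord0 /= /r /env3 /fenv /= !expr2.
  rewrite addr0 addrA; congr (_ + _ + _); congr (tcomp x _ s * tcomp x _ s);
    by apply/val_inj; rewrite /= inordK.
have q1 s : I s -> eval (r s) (Ed EQ) = 0 by exact: z q0.
have q2 s : I s -> eval (r s) (Ed (Ed EQ)) = 0 by exact: z q1.
have q3 s : I s -> eval (r s) (Ed (Ed (Ed EQ))) = 0 by exact: z q2.
move=> It.
have M : minor3 (jt x 3 t) (jt x 1 t) (jt x 2 t) k012 = eval (r t) (Edet3 1 2 3).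
  rewrite /minor3 /k012 -!jt_env3 -/(r t) /=.
  by move: (r t) => e; ring.
rewrite M; exact: ET_of_unit (q0 t It) (q1 t It) (q2 t It) (q3 t It).
Qed.

Definition simple_torsion : set (smooth_RxS 2 I) := [set x | forall t, I t ->
  eval (env3 I (tcomp x) t) ET != 0 \/
  derive_in I (fun t => eval (env3 I (tcomp x) t) ET) t != 0].

(** For p = 2 the minors of tau''', tau', tau'' reduce to one determinant T, and theta0, theta1
    are T and its derivative up to nonzero factors wherever T vanishes. *)
Lemma theta01_nonzero2 x t : simple_wr 3 x -> simple_torsion x -> I t ->
  exists k, theta0 x k t != 0 \/ theta1 x k t != 0.
Proof.
move=> sx tx It; have s0 := speed2_gt0 I_interval I_nondeg (leqnn 2) sx It.
exists k012.
have [T0|T0] := eqVneq (minor3 (jt x 3 t) (jt x 1 t) (jt x 2 t) k012) 0; last first.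
  by left; rewrite mulf_neq0// gt_eqF.
right; rewrite /theta1 T0 mulr0 subr0 mulf_neq0//; first by rewrite gt_eqF.
case: (tx t It) => [|h]; first by rewrite ET_unit// T0 mulr0 eqxx.
apply: contra_neq h => M4; apply: derive_inE => //.
apply: (dI_ext (f := fun s => 2 * eval (jenv x s) (Eminor3 3 1 2 k012))) => // [s Is|].
  by rewrite ET_unit// eval_minor3.
rewrite -[X in dI _ _ _ X](mulr0 2) -M4; apply: dI_scale.
have := @jenv_dI _ _ _ I_interval I_nondeg x (Eminor3 3 1 2 k012) t It; congr (dI I _ t _).
by rewrite /minor3 -!eval_Ejt /=; move: (jenv x t) => r; ring.
Qed.

End PlanarStep.

Section TorsionStep.
Context {R : realType} (I : set R).
Hypothesis I_interval : is_interval I.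
Hypothesis I_nondeg : exists u v, [/\ I u, I v & u < v].
Let I_limpt : limpt I := interval_limpt I_interval I_nondeg.
Implicit Types (x y : smooth_RxS 2 I).

(** All three components of tau are perturbed by delta times cubic polynomials, on condition
    that the Wronskian keeps its zeros simple. At a point t0 where the curve and its derivative
    are not parallel, adding a multiple of delta (t - t0)^3 to a suitable component changes the
    third derivative alone, and therefore ET; if they were parallel, the Wronskian would have a
    double zero. *)
Lemma torsion_step (N : set (smooth_RxS 2 I)) x : open N -> N x -> simple_wr 3 x ->
  exists y, [/\ N y, simple_wr 3 y & simple_torsion y].
Proof.
move=> oN Nx sx.
have oN' : open (N `&` simple_wr (p := 2) (I := I) 3).
  by apply: openI => //; exact: open_simple_wr.
have [delta [sd dpos Hpert]] := whitney_perturbation I_interval I_nondeg 3 oN' (conj Nx sx).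
pose phi (l : nat) t := delta t * t ^+ l.
have sphi l : smooth I (phi l).
  apply: smooth_mul; [exact: I_limpt|exact: sd|].
  by apply: smooth_exp; [exact: I_limpt|exact: smooth_id].
pose env (z : 'M[R]_(3, 4)) (t : R) (g : gen3) : R :=
  deriven_in I g.2 (tcomp x g.1) t + \sum_(l < 4) z g.1 l * deriven_in I g.2 (phi l) t.
pose pi (j : 'I_3 * 'I_4) (t : R) (g : gen3) : R :=
  (j.1 == g.1)%:R * deriven_in I g.2 (phi j.2) t.
have res := @jet_family_simple_zeros _ I I_interval I_nondeg _ ('I_3 * 'I_4)%type
  (fun j => delta_mx j.1 j.2 : 'M[R]_(3, 4)) gen3 ET (@djet R _) env pi.
have {}res : residual [set z | forall t, I t -> (exists j, ddir (env z t) (pi j t) ET != 0) ->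
    eval (env z t) ET != 0 \/ eval (env z t) (Ed ET) != 0].
  apply: res.
  - move=> z t [c i] It; apply: dI_add; first exact: (smooth_tower (smooth_tcomp I_interval I_nondeg x c)).
    by apply: dI_sum => l; apply: dI_scale; exact: (smooth_tower (sphi l)).
  - move=> [c i]; apply: jcont_add.
      by apply: jcont_time; apply: smooth_deriven; exact: smooth_tcomp.
    apply: jcont_sum => l; apply: jcont_mul; first exact: jcont_coord.
    by apply: jcont_time; exact: smooth_deriven.
  - move=> j [c i]; apply: smooth_mul; [exact: I_limpt|exact: smooth_cst|].
    exact: smooth_deriven.
  - move=> [c l] z t h [d i]; rewrite /env /pi /= -addrA; congr (_ + _).
    rewrite (eq_bigr (fun l' : 'I_4 => z d l' * deriven_in I i (phi l') t +
      h * ((c == d)%:R * (l' == l)%:R) * deriven_in I i (phi l') t)); last first.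
      move=> l' _; rewrite !mxE mulrDl; congr (_ + _ * _ * _).
      by rewrite eq_sym; case: (c == d); case: (l' == l); rewrite /= ?mul1r ?mul0r.
    rewrite big_split /=; congr (_ + _); rewrite (bigD1 l)//= big1 ?addr0 => [|l' nl].
      by rewrite eqxx mulr1 mulrA.
    by rewrite (negbTE nl) !mulr0 mul0r.
have [z Hz z1] := residual_small res.
pose P (c : 'I_3) : {poly R} := \poly_(l < 4) z c (inord l).
have [qpos [y [[Ny swy] _ yt]]] := Hpert 0 P (@unit_poly0 _ _) (fun c => unit_poly_coef c z1).
pose sg (c : 'I_3) s := tcomp x c s + delta s * (P c).[s].
pose lam s := ninv (sg^~ s).
have ssg c : smooth I (sg c).
  apply: smooth_add; [exact: I_limpt|exact: smooth_tcomp|].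
  by apply: smooth_mul; [exact: I_limpt|exact: sd|exact: smooth_horner].
have slam : smooth I lam.
  apply: (@smooth_rsqrt _ _ I_limpt (fun s => \sum_c sg c s ^+ 2)) => //.
  by apply: smooth_sum; [exact: I_limpt|move=> j; apply: smooth_exp; [exact: I_limpt|exact: ssg]].
have lam0 t : I t -> lam t != 0.
  move=> It; rewrite /lam /ninv invr_neq0// gt_eqF// sqrtr_gt0.
  exact: qpos.
have sy c : smooth I (tcomp y c) by exact: smooth_tcomp.
have yE c s : I s -> tcomp y c s = lam s * sg c s by move=> Is; rewrite yt// mulrC.
have envE t g : I t -> env z t g = env3 I sg t g.
  case: g => c i It; rewrite /env3 /fenv /= /env /=; apply/esym.
  apply: (tower_deriven (F := fun i t => deriven_in I i (tcomp x c) t +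
     \sum_(l < 4) z c l * deriven_in I i (phi l) t) I_limpt) => //.
  - move=> k s Is; apply: dI_add; first exact: (smooth_tower (smooth_tcomp I_interval I_nondeg x c)).
    by apply: dI_sum => l; apply: dI_scale; exact: (smooth_tower (sphi l)).
  - move=> s Is; rewrite /sg /P horner_poly mulr_sumr; congr (_ + _).
    by apply: eq_bigr => l _; rewrite inord_val mulrCA.
have evE t e : I t -> eval (env z t) e = eval (env3 I sg t) e.
  by move=> It; apply: (eval_ext (ok := fun=> True)) => [g _|]; [exact: envE|elim: e => //= *; split].
exists y; split=> // t It.
have WE s : I s -> eval (env3 I sg s) EW = (lam s)^-1 ^+ 3 * wr I 3 (cf y) s.
  move=> Is; rewrite wr3E.
  have [_ ->] := ET_scale I_interval I_nondeg ssg sy slam yE Is.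
  by rewrite exprVn mulKf// expf_neq0// lam0.
have W_simple : eval (env3 I sg t) EW != 0 \/ eval (env3 I sg t) (Ed EW) != 0.
  rewrite -(derive_env3 I_interval I_nondeg ssg)//.
  apply: (simple_zeros_scale I_limpt (F := wr I 3 (cf y)) _ _ It WE) => //.
  - by apply: smooth_wr => // c; exact: smooth_cf.
  - apply: smooth_exp; [exact: I_limpt|].
    by apply: smooth_inv => //; exact: I_limpt.
  - by rewrite expf_neq0// invr_neq0// lam0.
  - exact: swy.
have [c cof0] : exists c, ecof (env3 I sg t) c != 0.
  apply: contrapT => none; have [|w0 w1] := @evalW_cof _ (env3 I sg t).
    by move=> c; apply/eqP; apply: contraT => h; exfalso; apply: none; exists c.
  by case: W_simple; rewrite ?w0 ?w1 eqxx.
have K0 := evalK_gt0 cof0.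
have Q0 : 0 < eval (env3 I sg t) EQ.
  have := qpos t It; congr (0 < _); rewrite !big_ord_recl big_ord0 addr0 addrA /= /env3 /fenv /= !expr2.
  by congr (_ + _ + _); congr (sg _ t * sg _ t); apply/val_inj; rewrite /= inordK.
have dirs : exists j, ddir (env z t) (pi j t) ET != 0.
  apply: contrapT => none.
  pose X := ('X - t%:P) ^+ 3 : {poly R}.
  have szX : (size X <= 4)%N by rewrite size_exp_XsubC.
  pose pih (g : gen3) := \sum_(l < 4) X`_l * pi (c, l) t g.
  have D0 : ddir (env z t) pih ET = 0.
    rewrite /pih ddir_lin big1// => l _.
    have -> : ddir (env z t) (pi (c, l) t) ET = 0; last by rewrite mulr0.
    by apply/eqP; apply: contraT => h; exfalso; apply: none; exists (c, l).
  have pihE d i : (i <= 3)%N -> pih (d, i) = (c == d)%:R * (if i == 3%N then (3`!)%:R * delta t else 0).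
    move=> i3; rewrite -(deriven_power_at I_limpt sd It i3).
    rewrite (tower_deriven (F := fun i t => \sum_(l < 4) X`_l * deriven_in I i (phi l) t) I_limpt)//.
    - by rewrite mulr_sumr; apply: eq_bigr => l _; rewrite /pi /= mulrCA.
    - by move=> k s Is; apply: dI_sum => l; apply: dI_scale; exact: (smooth_tower (sphi l)).
    - move=> s Is; rewrite /phi; under eq_bigr do rewrite mulrCA.
      by rewrite -mulr_sumr -(horner_coef_wide _ szX) /X horner_exp !hornerE.
  pose pit (g : gen3) := if g.2 == 3%N then (c == g.1)%:R * ((3`!)%:R * delta t) else 0.
  have E := @ddir_ET _ (env z t) pit c ((3`!)%:R * delta t).
  have E2 : ddir (env z t) pih ET = ddir (env z t) pit ET.
    apply: (@ddir_ext _ _ (fun g : gen3 => (g.2 <= 3)%N)); last exact: gens_ET.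
    move=> [d i] i3; rewrite (pihE d i i3) /pit -[(d, i).2]/i -[(d, i).1]/d.
    by case: (i == 3%N); rewrite ?mulr0.
  move: D0; rewrite E2 E; first last.
  - by move=> d.
  - by move=> d i i2; rewrite /pit /= ltn_eqF.
  have ecE : ecof (env z t) c = ecof (env3 I sg t) c.
    by rewrite /ecof; case: ifP => _; [|case: ifP => _]; congr (_ * _ - _ * _); exact: envE.
  move/eqP; rewrite !evE// !mulf_eq0 pnatr_eq0 /= gt_eqF// gt_eqF//= gt_eqF ?dpos//=.
  by rewrite ecE (negbTE cof0) gt_eqF// dpos.
have simT : eval (env3 I sg t) ET != 0 \/ eval (env3 I sg t) (Ed ET) != 0.
  rewrite -(evE t ET It) -(evE t (Ed ET) It); exact: (Hz t It dirs).
have simT' : eval (env3 I sg t) ET != 0 \/ derive_in I (fun s => eval (env3 I sg s) ET) t != 0.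
  by rewrite (derive_env3 I_interval I_nondeg ssg).
have TE s (Is : I s) : eval (env3 I (tcomp y) s) ET = lam s ^+ 9 * eval (env3 I sg s) ET.
  by have [] := ET_scale I_interval I_nondeg ssg sy slam yE Is.
have l9 : lam t ^+ 9 != 0 by rewrite expf_neq0// lam0.
have s9 : smooth I (fun s => lam s ^+ 9) by exact: (smooth_exp I_limpt 9 slam).
have sE := @smooth_env3 R I I_interval I_nondeg sg ssg ET.
exact: (@simple_zeros_scale R I I_limpt (fun s => eval (env3 I sg s) ET)
  (fun s => eval (env3 I (tcomp y) s) ET) (fun s => lam s ^+ 9) t sE s9 It TE l9 simT').
Qed.

End TorsionStep.

(** * The generic set of curves *)

Section Regular.
Context {R : realType} (p : nat) (I : set R).
Hypothesis I_interval : is_interval I.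
Hypothesis I_nondeg : exists u v, [/\ I u, I v & u < v].

Definition regular : set (smooth_RxS p I) :=
  @simple_wr R p I p.+1 `&` @simple_theta R p I `&` @theta_off_flex R p I.

Lemma open_regular : open regular.
Proof.
apply: openI; [apply: openI|].
- exact: open_simple_wr.
- exact: open_simple_theta.
- exact: open_theta_off_flex.
Qed.

Lemma theta01_step (N : set (smooth_RxS p I)) x : (2 <= p)%N -> open N -> N x ->
  exists y, [/\ N y, simple_wr p.+1 y &
    forall t, I t -> exists k, theta0 y k t != 0 \/ theta1 y k t != 0].
Proof.
move=> p2 oN Nx.
have [y Ny sy] := simple_wr_dense I_interval I_nondeg (leqnn _) oN Nx.
have [p3|p3] := ltnP 2 p.
  by exists y; split=> // t It; apply: theta01_nonzero.
have E : p = 2 by apply/eqP; rewrite eqn_leq p3.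
move: N x oN Nx y Ny sy; rewrite E => N x oN Nx y Ny sy.
have [z [Nz sz tz]] := torsion_step I_interval I_nondeg oN Ny sy.
by exists z; split=> // t It; apply: theta01_nonzero2.
Qed.

Lemma dense_regular : (2 <= p)%N -> dense regular.
Proof.
move=> p2 N [x Nx] oN.
have [y [Ny sy y01]] := theta01_step p2 oN Nx.
have [z [Nz sz tz oz]] := theta_step I_interval I_nondeg oN Ny sy y01.
by exists z.
Qed.

End Regular.

(** * Types of frontal curves *)

Section RankOfSequences.
Context {F : fieldType} (n : nat) (f : nat -> 'rV[F]_n).

Definition rankn k := \rank (\matrix_(i < k) f i).

Lemma rankn_step k : (rankn k.+1 <= (rankn k).+1)%N.
Proof.
have H : (\matrix_(i < k.+1) f i <= (\matrix_(i < k) f i) + f k)%MS.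
  apply/row_subP => i; rewrite rowK.
  have := ltn_ord i; rewrite ltnS leq_eqVlt => /orP[/eqP->|ik]; first exact: addsmxSr.
  apply: submx_trans (addsmxSl _ _).
  by have := row_sub (Ordinal ik) (\matrix_(i < k) f i); rewrite rowK.
apply: leq_trans (mxrankS H) _; apply: leq_trans (mxrank_adds_leqif _ _) _.
by apply: leq_trans (leq_add (leqnn _) (rank_leq_row _)) _; rewrite addn1.
Qed.

Lemma rankn_homo : {homo rankn : k l / (k <= l)%N}.
Proof.
move=> k l kl; apply: mxrankS; apply/row_subP => i; rewrite rowK.
by have := row_sub (widen_ord kl i) (\matrix_(i < l) f i); rewrite rowK.
Qed.

Lemma rankn_add k d : (rankn (k + d) <= rankn k + d)%N.
Proof.
elim: d => [|d IH]; first by rewrite !addn0.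
by rewrite !addnS; apply: leq_trans (rankn_step _) _; rewrite ltnS.
Qed.

Lemma rankn_le k : (rankn k <= k)%N. Proof. exact: rank_leq_row. Qed.
Lemma rankn_le_dim k : (rankn k <= n)%N. Proof. exact: rank_leq_col. Qed.

(** The rank grows by at most one at each step, so it cannot catch up. *)
Lemma rankn_full k l : rankn k = k -> (l <= k)%N -> rankn l = l.
Proof.
move=> rk lk; apply/eqP; rewrite eqn_leq rankn_le /=.
by have := rankn_add l (k - l); rewrite subnKC// rk -{1}(subnKC lk) leq_add2r.
Qed.

Lemma rankn_nondegenerate k : \det (\matrix_(i < n) f i) != 0 -> rankn k = minn k n.
Proof.
move=> d0.
have rn : rankn n = n by apply: mxrank_unit; rewrite unitmxE unitfE.
case: leqP => [kn|nk]; first exact: rankn_full kn.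
have := rankn_homo (ltnW nk); rewrite rn => nr.
by apply/eqP; rewrite eqn_leq rankn_le_dim.
Qed.

End RankOfSequences.

(** The first n vectors are independent since they belong to the basis obtained by skipping
    f n; as f n depends on them, the last jump of the rank comes one step late. *)
Lemma rankn_delayed (F : fieldType) n (f : nat -> 'rV[F]_n.+1) k :
  \det (\matrix_(i < n.+1) f i) = 0 ->
  \det (\matrix_(i < n.+1) f (if i == n :> nat then n.+1 else i)) != 0 ->
  rankn f k = if (k <= n)%N then k else if k == n.+1 then n else n.+1.
Proof.
set B := \matrix_(i < _) f (if _ then _ else _) => D0 D1.
have rB : \rank B = n.+1 by apply: mxrank_unit; rewrite unitmxE unitfE.
have BN : (B <= (\matrix_(i < n) f i) + f n.+1)%MS.
  apply/row_subP => i; rewrite rowK; case: eqP => [_|/eqP ni]; first exact: addsmxSr.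
  have ik : (i < n)%N by rewrite ltn_neqAle ni -ltnS ltn_ord.
  apply: submx_trans (addsmxSl _ _).
  by have := row_sub (Ordinal ik) (\matrix_(i < n) f i); rewrite rowK.
have rn : rankn f n = n.
  apply/eqP; rewrite eqn_leq rankn_le /= -ltnS.
  have := mxrankS BN; rewrite rB => /leq_trans; apply.
  apply: leq_trans (mxrank_adds_leqif _ _) _.
  by apply: leq_trans (leq_add (leqnn _) (rank_leq_row _)) _; rewrite addn1.
have rn2 : (n.+1 <= rankn f n.+2)%N.
  have : (\rank B <= rankn f n.+2)%N; last by rewrite rB.
  apply: mxrankS; apply/row_subP => i; rewrite rowK.
  have il : ((if i == n :> nat then n.+1 else i) < n.+2)%N.
    by case: ifP => // _; rewrite ltnS ltnW.
  by have := row_sub (Ordinal il) (\matrix_(i < n.+2) f i); rewrite rowK.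
case: leqP => [kn|nk]; first exact: rankn_full kn.
case: eqP => [->|/eqP nk1].
  have nr : (n <= rankn f n.+1)%N by have := rankn_homo f (leqnSn n); rewrite rn.
  apply/eqP; rewrite eqn_leq nr andbT -ltnS ltn_neqAle rankn_le_dim andbT.
  apply/eqP => full; move: D0; apply/eqP; rewrite -unitfE -unitmxE -row_full_unit.
  by rewrite /row_full -[\rank _]/(rankn f n.+1) full.
apply/eqP; rewrite eqn_leq rankn_le_dim /=; apply: leq_trans rn2 _.
by rewrite rankn_homo// ltn_neqAle eq_sym nk1.
Qed.

Lemma nth_type m p q i : (i < p.+1)%N ->
  nth 0%N (rcons (iota m.+1 p) q) i = if (i < p)%N then (m.+1 + i)%N else q.
Proof.
move=> ip; rewrite nth_rcons size_iota; case: ifP => [lt|]; first by rewrite nth_iota.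
by move/negbT; rewrite -leqNgt => pi; rewrite (_ : i == p)// eqn_leq pi -ltnS ip.
Qed.

Lemma type_increasing m p q : (m + p < q)%N -> path ltn 0%N (rcons (iota m.+1 p) q).
Proof.
case: p => [|p] mq; first by rewrite /= andbT; apply: leq_ltn_trans mq.
rewrite rcons_path; apply/andP; split; first exact: (iota_ltn_sorted m.+1 p.+1).
rewrite -nth_last size_iota nth_iota//=.
by rewrite addSnnS.
Qed.

Section TypeOfCurve.
Context {R : realType} (p : nat) (I : set R) (I_limpt : limpt I).
Variables (h tau : R -> 'rV[R]_p.+1) (b : R -> R).
Hypotheses (sh : smooth I h) (stau : smooth I tau) (sb : smooth I b).
Hypothesis h' : forall t, I t -> derive_in I h t = b t *: tau t.

Lemma has_type_uniq t s s' : has_type I h t s -> has_type I h t s' -> s = s'.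
Proof.
move=> [sz _ H] [sz' _ H']; apply: (@eq_from_nth _ 0%N); first by rewrite sz sz'.
move=> i; rewrite sz => ip; have [r m] := H i ip; have [r' m'] := H' i ip.
by apply/eqP; rewrite eqn_leq m//= m'.
Qed.

Lemma deriven_curve j t i : I t -> deriven_in I j.+1 h t 0 i =
  \sum_(l < j.+1) 'C(j, l)%:R * (deriven_in I (j - l) b t * deriven_in I l tau t 0 i).
Proof.
move=> It; have stc := (row_smoothP I_limpt tau).1 stau i.
rewrite (row_deriven I_limpt _ i sh It).
have -> : deriven_in I j.+1 (fun s => h s 0 i) t = deriven_in I j (fun s => b s * tau s 0 i) t.
  rewrite /deriven_in iterSr; apply: (deriven_ext I_limpt) => //; last first.
    by apply: smooth_derive; exact: (row_smoothP I_limpt h).1 sh i.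
  by move=> s Is; rewrite -(row_derive_in I_limpt i Is (smooth_derivable sh Is)) h'// mxE.
have := deriven_mul I_limpt sb stc j It; rewrite /= => ->; apply: eq_bigr => l _.
by rewrite -(row_deriven I_limpt _ i stau It).
Qed.

Variables (m : nat) (t : R).
Hypothesis It : I t.
Hypotheses (b_low : forall j, (j < m)%N -> deriven_in I j b t = 0)
  (b_m : deriven_in I m b t != 0).

Let f l := deriven_in I l tau t.

(** Leibniz's formula writes the columns of the matrix of derivatives of h, after m zero
    columns, as a triangular combination of the derivatives of tau, with binomial multiples of
    the first nonzero derivative of b on the diagonal. *)
Lemma rank_derivatives k : \rank (W I h k t) = rankn f (k - m).
Proof.
have [km|/ltnW mk] := leqP k m.
  have -> : W I h k t = 0.
    apply/matrixP => i j; rewrite !mxE deriven_curve// big1// => l _.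
    rewrite b_low ?mul0r ?mulr0//; apply: leq_ltn_trans (leq_subr _ _) _.
    exact: leq_trans (ltn_ord j) km.
  apply/esym/eqP; rewrite mxrank0 (eqP (_ : k - m == 0)%N) -?leqn0 ?rankn_le//.
  by rewrite leqn0 subn_eq0.
move: (subnKC mk); move: (k - m)%N => n <- {k mk}.
pose L := \matrix_(j < n, l < n) ('C(m + j, l)%:R * deriven_in I (m + j - l) b t).
have L0 (j l : nat) : (j < l)%N -> 'C(m + j, l)%:R * deriven_in I (m + j - l) b t = 0.
  move=> jl; have [lm|lm] := ltnP (m + j) l; first by rewrite bin_small// mul0r.
  by rewrite b_low ?mulr0// ltn_subLR// addnC ltn_add2r.
pose S := \matrix_(i < n) f i.
have -> : W I h (m + n) t = row_mx 0 (S^T *m L^T).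
  apply/matrixP => i j; case: (split_ordP j) => {}j ->; rewrite ?row_mxEl ?row_mxEr !mxE.
    rewrite deriven_curve// big1// => l _; rewrite b_low ?mul0r ?mulr0//=.
    exact: leq_ltn_trans (leq_subr _ _) _.
  rewrite deriven_curve//=.
  pose G l := 'C(m + j, l)%:R * (deriven_in I (m + j - l) b t * deriven_in I l tau t 0 i).
  have G0 (l : nat) : (j < l)%N -> G l = 0 by move=> jl; rewrite /G mulrA L0// mul0r.
  have tail (a c : nat) : (j < a)%N -> \sum_(a <= l < c) G l = 0.
    move=> ja; rewrite big_nat_cond big1// => l /andP[/andP[al _] _].
    by apply: G0; exact: leq_trans al.
  transitivity (\sum_(0 <= l < m + n) G l).
    rewrite (big_cat_nat (n := (m + j).+1))//=; last by rewrite ltn_add2l.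
    by rewrite (tail (m + j).+1) ?addr0 ?big_mkord// ltnS leq_addl.
  rewrite (big_cat_nat (n := n))//= ?leq_addl// (tail n)// addr0 big_mkord.
  by apply: eq_bigr => l _; rewrite !mxE /G /f mulrA mulrC.
rewrite rank_row_0mx mxrankMfree ?mxrank_tr//.
rewrite row_free_unit unitmx_tr unitmxE det_trig; last by apply/is_trig_mxP => j l jl; rewrite mxE L0.
rewrite unitfE; apply/prodf_neq0 => j _; rewrite mxE mulf_neq0 ?addnK//.
by rewrite pnatr_eq0 -lt0n bin_gt0 leq_addl.
Qed.

Lemma type_nondegenerate : \det (\matrix_(i < p.+1) f i) != 0 ->
  has_type I h t (rcons (iota m.+1 p) (m.+1 + p)%N).
Proof.
move=> D0; split; first by rewrite size_rcons size_iota.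
  by apply: type_increasing; rewrite addSn.
move=> i ip; rewrite nth_type//.
have -> : (if (i < p)%N then (m.+1 + i)%N else (m.+1 + p)%N) = (m.+1 + i)%N.
  by case: ltnP => // pi; congr (_ + _)%N; apply/eqP; rewrite eqn_leq pi -ltnS ip.
split=> [|k]; rewrite rank_derivatives rankn_nondegenerate//.
  by rewrite addSnnS addKn (minn_idPl ip).
by move=> E; rewrite addSnnS -leq_subRL ?E//; lia.
Qed.

Lemma type_flex : \det (\matrix_(i < p.+1) f i) = 0 ->
  \det (\matrix_(i < p.+1) f (if i == p :> nat then p.+1 else i)) != 0 ->
  has_type I h t (rcons (iota m.+1 p) (m.+2 + p)%N).
Proof.
move=> D0 D1; split; first by rewrite size_rcons size_iota.
  by apply: type_increasing; rewrite !addSn ltnS leqnSn.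
move=> i ip; rewrite nth_type//; have [ltip|geip] := ltnP i p.
  split=> [|k]; rewrite rank_derivatives rankn_delayed//.
    by rewrite addSnnS addKn ltip.
  by case: ifP => [|_]; [|case: ifP => [|_]]; lia.
have {ip geip} -> : i = p by apply/eqP; rewrite eqn_leq geip -ltnS ip.
split=> [|k]; rewrite rank_derivatives rankn_delayed//.
  by rewrite !addSnnS addKn leqNgt ltnW//= gtn_eqF.
by case: ifP => [|/negbT]; [|case: ifP => [|/negbT]]; lia.
Qed.

End TypeOfCurve.

(** * Directrices in a normally parallel frame *)

Section FrameJets.
Context {R : realType} (I : set R) (I_limpt : limpt I) (p k : nat).
Variables (T mu : 'I_p.+1 -> R -> R) (nu : 'I_k -> 'I_p.+1 -> R -> R).
Variables (kappa : R -> R) (ell : 'I_k -> R -> R).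
Hypotheses (sT : forall c, smooth I (T c)) (smu : forall c, smooth I (mu c))
  (snu : forall i c, smooth I (nu i c)) (sk : smooth I kappa)
  (sl : forall i, smooth I (ell i)) (k0 : forall t, I t -> kappa t != 0).
Hypotheses (dT : forall c t, I t -> dI I (T c) t (kappa t * mu c t))
  (dmu : forall c t, I t -> dI I (mu c) t (- kappa t * T c t + \sum_i ell i t * nu i c t))
  (dnu : forall i c t, I t -> dI I (nu i c) t (- ell i t * mu c t)).
Hypotheses (mu_unit : forall t, I t -> \sum_c mu c t * mu c t = 1)
  (mu_T : forall t, I t -> \sum_c mu c t * T c t = 0)
  (mu_nu : forall i t, I t -> \sum_c mu c t * nu i c t = 0).

(** The component of tau'' along nu_i divided by kappa^2. Its derivative dslope drives the
    speed of the directrices. *)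
Definition slope i t : R := ell i t / kappa t.
Definition dslope i := derive_in I (slope i).

(** Coefficients of the derivatives of tau in the moving frame: be is the logarithmic derivative
    of kappa, while q and q1 come from the tangential part of the derivatives of nu. *)
Let be t : R := derive_in I kappa t / kappa t.
Let q t : R := \sum_i slope i t * slope i t.
Let ga t : R := derive_in I be t - 2 * be t * be t - kappa t * kappa t * (q t + 1).
Let q1 t : R := \sum_i dslope i t * slope i t.
Let N c t : R := \sum_i slope i t * nu i c t.
Let V c t : R := \sum_i dslope i t * nu i c t.
Let V1 c t : R := \sum_i derive_in I (dslope i) t * nu i c t.

Lemma smooth_slope i : smooth I (slope i).
Proof.
apply: smooth_mul; [exact: I_limpt|exact: sl|].
by apply: smooth_inv; [exact: I_limpt|exact: sk|exact: k0].
Qed.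

Lemma smooth_dslope i : smooth I (dslope i).
Proof. by apply: smooth_derive; exact: smooth_slope. Qed.

Let sbe : smooth I be.
Proof.
apply: smooth_mul; [exact: I_limpt|exact: smooth_derive|].
by apply: smooth_inv; [exact: I_limpt|exact: sk|exact: k0].
Qed.

Let sga : smooth I ga.
Proof.
have sM (f g : R -> R) : smooth I f -> smooth I g -> smooth I (fun s => f s * g s) by exact: smooth_mul.
have sA (f g : R -> R) : smooth I f -> smooth I g -> smooth I (fun s => f s + g s) by exact: smooth_add.
have sN (f : R -> R) : smooth I f -> smooth I (fun s => - f s) by exact: smooth_opp.
apply: (sA _ _ _ _); [apply: (sA _ _ _ _)|apply: sN].
- exact: smooth_derive.
- by apply: sN; apply: (sM _ _ _ sbe); apply: (sM _ _ _ sbe); exact: smooth_cst.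
- apply: (sM _ _ (sM _ _ sk sk)); apply: (sA _ _ _ (smooth_cst I_limpt 1)).
  by apply: smooth_sum => [|i]; [exact: I_limpt|apply: (sM _ _ (smooth_slope i) (smooth_slope i))].
Qed.

Let dk t : I t -> dI I kappa t (be t * kappa t).
Proof. by move=> It; rewrite /be divfK ?k0//; exact: dI_smooth. Qed.

Let dN c t : I t -> dI I (N c) t (V c t - q t * (kappa t * mu c t)).
Proof.
move=> It; have -> : V c t - q t * (kappa t * mu c t) =
    \sum_i (dslope i t * nu i c t + slope i t * (- ell i t * mu c t)).
  rewrite big_split /=; congr (_ + _); rewrite /q mulr_suml -sumrN; apply: eq_bigr => i _.
  have -> : ell i t = slope i t * kappa t by rewrite /slope divfK ?k0.
  by ring.
by apply: dI_sum => i; apply: dI_mul; [exact: dI_smooth (smooth_slope i) It|exact: dnu].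
Qed.

Let dV c t : I t -> dI I (V c) t (V1 c t - q1 t * (kappa t * mu c t)).
Proof.
move=> It; have -> : V1 c t - q1 t * (kappa t * mu c t) =
    \sum_i (derive_in I (dslope i) t * nu i c t + dslope i t * (- ell i t * mu c t)).
  rewrite big_split /=; congr (_ + _); rewrite /q1 mulr_suml -sumrN; apply: eq_bigr => i _.
  have -> : ell i t = slope i t * kappa t by rewrite /slope divfK ?k0.
  by ring.
by apply: dI_sum => i; apply: dI_mul; [exact: dI_smooth (smooth_dslope i) It|exact: dnu].
Qed.

(** The derivatives of tau of order one to four. Modulo tau' and tau'' the last two are
    kappa^2 V and kappa^2 (5 be V + V1); the coefficient 5 of be is what the term in
    <tau',tau''> of theta1 cancels. *)
Let F1 c t : R := kappa t * mu c t.
Let F2 c t : R := be t * F1 c t + kappa t * kappa t * (N c t - T c t).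
Let F3 c t : R := kappa t * kappa t * V c t + 3 * be t * F2 c t + ga t * F1 c t.
Let F4 c t : R := kappa t * kappa t * (5 * be t * V c t + V1 c t) +
  (3 * derive_in I be t + 9 * be t * be t + ga t) * F2 c t +
  (derive_in I ga t + 3 * be t * ga t - kappa t * kappa t * q1 t) * F1 c t.

Let dF1 c t : I t -> dI I (F1 c) t (F2 c t).
Proof.
move=> It; have := dI_mul (dk It) (@dmu c _ It); congr (dI I _ t _).
have -> : \sum_i ell i t * nu i c t = kappa t * N c t.
  by rewrite /N mulr_sumr; apply: eq_bigr => i _; rewrite /slope mulrA mulrCA mulfV ?k0// mulr1.
by rewrite /F2 /F1; ring.
Qed.

Let dF2 c t : I t -> dI I (F2 c) t (F3 c t).
Proof.
move=> It.
have := dI_add (dI_mul (dI_smooth sbe It) (@dF1 c _ It))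
  (dI_mul (dI_mul (dk It) (dk It)) (dI_add (@dN c _ It) (dI_scale (c := -1) (@dT c _ It)))).
have E : (fun s => be s * F1 c s + kappa s * kappa s * (N c s + -1 * T c s)) = F2 c.
  by apply/funext => s; rewrite mulN1r.
rewrite E; congr (dI I _ t _); rewrite /F3 /F2 /ga /F1.
by move: (derive_in I be t) (be t) (N c t) (V c t) (q t) => *; ring.
Qed.

Let dF3 c t : I t -> dI I (F3 c) t (F4 c t).
Proof.
move=> It.
have := dI_add (dI_add (dI_mul (dI_mul (dk It) (dk It)) (@dV c _ It))
    (dI_mul (dI_mul (dI_cst I t 3) (dI_smooth sbe It)) (@dF2 c _ It)))
  (dI_mul (dI_smooth sga It) (@dF1 c _ It)).
congr (dI I _ t _); rewrite /F4 /F3 /F1.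
move: (derive_in I be t) (derive_in I ga t) (ga t) (be t) (V1 c t) (V c t) (q1 t) (F2 c t) => *.
by ring.
Qed.

Lemma frame_jets c t : I t -> [/\ deriven_in I 1 (T c) t = F1 c t,
  deriven_in I 2 (T c) t = F2 c t, deriven_in I 3 (T c) t = F3 c t &
  deriven_in I 4 (T c) t = F4 c t].
Proof.
have step n (f G H : R -> R) : (forall s, I s -> deriven_in I n f s = G s) ->
    (forall s, I s -> dI I G s (H s)) -> forall s, I s -> deriven_in I n.+1 f s = H s.
  move=> fG dG s Is; apply: derive_inE => //; apply: (dI_ext (f := G)) => //; last exact: dG.
  by move=> r Ir; rewrite -fG.
have H1 := step 0%N (T c) (T c) (F1 c) (fun s _ => erefl) (@dT c).
have H2 := step 1%N (T c) _ _ H1 (@dF1 c).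
have H3 := step 2 (T c) _ _ H2 (@dF2 c).
have H4 := step 3 (T c) _ _ H3 (@dF3 c).
by move=> It; split; [exact: H1|exact: H2|exact: H3|exact: H4].
Qed.

(** The minors in the definition of theta are linear combinations of the numbers
    a v_i' - a' v_i, where v_i is dslope i: the coefficient M i is kappa^4 times the minor of
    nu_i, tau', tau''. Here |tau'|^2 = kappa^2 and <tau',tau''> = be kappa^2. *)
Lemma frame_theta (kk : triple p) : exists M : 'I_k -> R -> R,
  (forall i, smooth I (M i)) /\ forall t a a', I t ->
  let J n c := deriven_in I n (T c) t in
  a * ((\sum_c J 1%N c ^+ 2) * minor3 (J 4) (J 1%N) (J 2) kk
       - 5 * (\sum_c J 1%N c * J 2 c) * minor3 (J 3) (J 1%N) (J 2) kk)
  - a' * ((\sum_c J 1%N c ^+ 2) * minor3 (J 3) (J 1%N) (J 2) kk) =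
  \sum_i (a * derive_in I (dslope i) t - a' * dslope i t) * M i t.
Proof.
have sM (f g : R -> R) : smooth I f -> smooth I g -> smooth I (fun s => f s * g s) by exact: smooth_mul.
have sA (f g : R -> R) : smooth I f -> smooth I g -> smooth I (fun s => f s + g s) by exact: smooth_add.
have sN (f : R -> R) : smooth I f -> smooth I (fun s => - f s) by exact: smooth_opp.
have sF1 c : smooth I (F1 c) by exact: sM.
have sF2 c : smooth I (F2 c).
  apply: (sA _ _ (sM _ _ sbe (sF1 c))); apply: (sM _ _ (sM _ _ sk sk)).
  apply: (sA _ _ _ (sN _ (sT c))); apply: smooth_sum => [|i]; first exact: I_limpt.
  by apply: (sM _ _ (smooth_slope i)); exact: snu.
pose m i t := minor3 (fun c => nu i c t) (F1^~ t) (F2^~ t) kk.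
exists (fun i t => kappa t ^+ 4 * m i t); split=> [i|t a a' It J].
  have s3 (f0 f1 f2 g0 g1 g2 h0 h1 h2 : R -> R) : smooth I f0 -> smooth I f1 -> smooth I f2 ->
      smooth I g0 -> smooth I g1 -> smooth I g2 -> smooth I h0 -> smooth I h1 -> smooth I h2 ->
      smooth I (fun s => f0 s * (g1 s * h2 s - g2 s * h1 s) - f1 s * (g0 s * h2 s - g2 s * h0 s)
        + f2 s * (g0 s * h1 s - g1 s * h0 s)).
    move=> F0 F1' F2' G0 G1 G2 H0 H1 H2.
    have d2 (u1 u2 w1 w2 : R -> R) : smooth I u1 -> smooth I u2 -> smooth I w1 -> smooth I w2 ->
        smooth I (fun s => u1 s * w2 s - u2 s * w1 s).
      by move=> U1 U2 W1 W2; apply: (sA _ _ (sM _ _ U1 W2)); apply: sN (sM _ _ U2 W1).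
    apply: (sA _ _ _ (sM _ _ F2' (d2 _ _ _ _ G0 G1 H0 H1))).
    apply: (sA _ _ (sM _ _ F0 (d2 _ _ _ _ G1 G2 H1 H2))).
    exact: sN (sM _ _ F1' (d2 _ _ _ _ G0 G2 H0 H2)).
  apply: (sM _ _ _ _); first by apply: smooth_exp; [exact: I_limpt|exact: sk].
  by apply: s3.
have J1 c : J 1%N c = F1 c t by have [E _ _ _] := frame_jets c It; exact: E.
have J2 c : J 2 c = F2 c t by have [_ E _ _] := frame_jets c It; exact: E.
have J3 c : J 3 c = F3 c t by have [_ _ E _] := frame_jets c It; exact: E.
have J4 c : J 4 c = F4 c t by have [_ _ _ E] := frame_jets c It; exact: E.
move: J J1 J2 J3 J4 => J J1 J2 J3 J4.
have speedE : \sum_c J 1%N c ^+ 2 = kappa t ^+ 2.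
  rewrite -[RHS]mulr1 -(mu_unit It) mulr_sumr; apply: eq_bigr => c _.
  by rewrite J1 /F1; ring.
have accelE : \sum_c J 1%N c * J 2 c = be t * kappa t ^+ 2.
  have muN : \sum_c mu c t * N c t = 0.
    under eq_bigr do rewrite /N mulr_sumr.
    rewrite exchange_big big1//= => i _.
    by under eq_bigr do rewrite mulrCA; rewrite -mulr_sumr mu_nu// mulr0.
  transitivity (\sum_c (be t * kappa t ^+ 2 * (mu c t * mu c t) +
      kappa t ^+ 3 * (mu c t * N c t) - kappa t ^+ 3 * (mu c t * T c t))).
    apply: eq_bigr => c _; rewrite J1 J2 /F2 /F1.
    by move: (be t) (N c t) => *; ring.
  by rewrite sumrB big_split /= -!mulr_sumr mu_unit// muN mu_T// !mulr0 subr0 addr0 mulr1.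
have mV (w : 'I_k -> R) : minor3 (fun c => \sum_i w i * nu i c t) (F1^~ t) (F2^~ t) kk =
    \sum_i w i * m i t.
  rewrite /minor3 !mulr_suml -sumrB -big_split /=; apply: eq_bigr => i _.
  by rewrite /m /minor3; move: (F1^~ t) (F2^~ t) => f1 f2; ring.
have m3E (P : 'I_p.+1 -> R) (X : 'I_p.+1 -> R) al ga' : (forall c, P c = kappa t ^+ 2 * X c + al * F2 c t + ga' * F1 c t) ->
    minor3 P (J 1%N) (J 2) kk = kappa t ^+ 2 * minor3 X (F1^~ t) (F2^~ t) kk.
  move=> PE; rewrite /minor3 !PE.
  rewrite !J1 !J2; move: (F1^~ t) (F2^~ t) => f1 f2; by ring.
rewrite speedE accelE.
rewrite (m3E (J 3) (V^~ t) (3 * be t) (ga t)); last first.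
  by move=> c; rewrite J3 /F3 expr2.
rewrite (m3E (J 4) (fun c => \sum_i (5 * be t * dslope i t + derive_in I (dslope i) t) * nu i c t)
   (3 * derive_in I be t + 9 * be t * be t + ga t)
   (derive_in I ga t + 3 * be t * ga t - kappa t * kappa t * q1 t)); last first.
  move=> c; rewrite J4 /F4 expr2; congr (_ * _ + _ + _).
  rewrite /V /V1 mulr_sumr -big_split /=; apply: eq_bigr => i _.
  by rewrite [RHS]mulrDl mulrA.
have -> : minor3 (V^~ t) (F1^~ t) (F2^~ t) kk = \sum_i dslope i t * m i t by exact: mV.
rewrite mV !mulr_sumr -sumrB !mulr_sumr -sumrB; apply: eq_bigr => i _.
by move: (derive_in I (dslope i) t) (dslope i t) (be t) (m i t) => *; ring.
Qed.

End FrameJets.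

Lemma dot_sumr (R : realType) n (K : finType) (u : 'rV[R]_n) (w : K -> 'rV[R]_n) :
  dot u (\sum_i w i) = \sum_i dot u (w i).
Proof.
by apply: (big_morph (dot u) (dotDr u)); rewrite /dot big1// => i _; rewrite mxE mulr0.
Qed.

Section Directrix.
Context {R : realType} (p : nat) (I : set R).
Hypothesis I_interval : is_interval I.
Hypothesis I_nondeg : exists u v, [/\ I u, I v & u < v].
Let I_limpt : limpt I := interval_limpt I_interval I_nondeg.
Variables (x : smooth_RxS p I) (f : R -> 'rV[R]_p.+1).
Variables (mu : R -> 'rV[R]_p.+1) (kappa : R -> R).
Variables (nu : 'I_p.-1 -> R -> 'rV[R]_p.+1) (ell : 'I_p.-1 -> R -> R).
Hypotheses (Hf : frontal I f (sm_a x) (sm_tau x))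
  (Hpn : principal_normal I (sm_tau x) mu kappa)
  (Hnp : normally_parallel_frame I (sm_tau x) mu nu)
  (Htor : torsion I (sm_tau x) mu kappa nu ell).

Let a := sm_a x.
Let tau := sm_tau x.
Let sa : smooth I a := smooth_sm_a x.
Let stau : smooth I tau := smooth_sm_tau x.
Let sf : smooth I f. Proof. by split; exact: Hf.1. Qed.
Let smu : smooth I mu. Proof. by case: Hpn => H _ _; split. Qed.
Let sk : smooth I kappa. Proof. by case: Hpn => _ H _; split. Qed.
Let snu i : smooth I (nu i). Proof. by case: Hnp => H _; split; exact: H. Qed.
Let k0 t : I t -> kappa t != 0. Proof. by case: Hpn => _ _ H /H[]. Qed.
Let mu_unit t : I t -> dot (mu t) (mu t) = 1. Proof. by case: Hpn => _ _ H /H[]. Qed.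
Let mu_tau t : I t -> dot (mu t) (tau t) = 0. Proof. by case: Hpn => _ _ H /H[]. Qed.
Let dtau t : I t -> derive_in I tau t = kappa t *: mu t.
Proof. by case: Hpn => _ _ H /H[]. Qed.
Let nu_ortho t : I t -> forall i j, dot (nu i t) (nu j t) = (i == j)%:R.
Proof. by case: Hnp => _ H /H[]. Qed.
Let nu_tau i t : I t -> dot (nu i t) (tau t) = 0. Proof. by case: Hnp => _ H /H[_ /(_ i)[]]. Qed.
Let nu_mu i t : I t -> dot (nu i t) (mu t) = 0. Proof. by case: Hnp => _ H /H[_ /(_ i)[]]. Qed.
Let nu_parallel i t : I t -> exists c d, derive_in I (nu i) t = c *: tau t + d *: mu t.
Proof. by case: Hnp => _ H /H[_ _ /(_ i)]. Qed.

(** Differentiating an orthogonality relation. *)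
Let dot_derive (g h : R -> 'rV[R]_p.+1) t : smooth I g -> smooth I h ->
  (forall s, I s -> dot (g s) (h s) = 0) -> I t ->
  dot (derive_in I g t) (h t) = - dot (g t) (derive_in I h t).
Proof.
move=> sg sh gh It; have := derive_dot I_limpt sg sh It.
rewrite (derive_inE I_limpt It (l := 0)) => [/esym/eqP|].
  by rewrite addr_eq0 => /eqP.
by apply: (dI_ext (f := fun=> 0)) => // [s Is|]; [rewrite gh|exact: dI_cst].
Qed.

Let ellE i t : I t -> ell i t = dot (derive_in I mu t) (nu i t).
Proof.
move=> It; rewrite Htor// dotDl dotZl (dotC (sm_tau x t)) nu_tau// mulr0 add0r.
rewrite dotC dot_sumr (bigD1 i)//= big1 ?addr0 => [|j ji].
  by rewrite dotC dotZl nu_ortho// eqxx mulr1.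
by rewrite dotC dotZl nu_ortho// (negbTE ji) mulr0.
Qed.

Let sl i : smooth I (ell i).
Proof.
apply: (smooth_ext I_limpt (f := fun t => dot (derive_in I mu t) (nu i t))).
  by move=> t It; rewrite ellE.
by apply: (smooth_dot I_limpt); [exact: smooth_row_derive|exact: snu].
Qed.

(** The tangential derivative of nu_i has no component along tau because tau' is orthogonal to
    nu_i. *)
Let dnu i t : I t -> derive_in I (nu i) t = - ell i t *: mu t.
Proof.
move=> It; have [c [d E]] := nu_parallel i It.
have c0 : c = 0.
  have := dot_derive (snu i) stau (fun s => @nu_tau i s) It.
  rewrite E dtau// dotDl !dotZl mu_tau// mulr0 addr0 sm_tau_sphere// mulr1 => ->.
  by rewrite dotC dotZl dotC nu_mu// mulr0 oppr0.
have d0 : d = - ell i t.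
  have := dot_derive (snu i) smu (fun s => @nu_mu i s) It.
  by rewrite E c0 scale0r add0r dotZl mu_unit// mulr1 => ->; rewrite dotC -ellE.
by rewrite E c0 d0 scale0r add0r.
Qed.

Let row_dI (g : R -> 'rV[R]_p.+1) t c : smooth I g -> I t ->
  dI I (fun s => g s 0 c) t (derive_in I g t 0 c).
Proof.
move=> sg It; rewrite (row_derive_in I_limpt _ It (smooth_derivable sg It)).
by apply: dI_smooth => //; exact: (row_smoothP I_limpt g).1.
Qed.

Let T c s : R := tcomp x c s.
Let sT c : smooth I (T c). Proof. exact: smooth_tcomp. Qed.
Let sv := @smooth_dslope R I I_limpt p.-1 kappa ell sk sl k0.
Let ssl := @smooth_slope R I I_limpt p.-1 kappa ell sk sl k0.

Let dT c t : I t -> dI I (T c) t (kappa t * mu t 0 c).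
Proof. by move=> It; have := @row_dI _ _ c stau It; rewrite dtau// mxE. Qed.

Let dmu c t : I t -> dI I (fun s => mu s 0 c) t
  (- kappa t * T c t + \sum_i ell i t * nu i t 0 c).
Proof.
move=> It; have := @row_dI _ _ c smu It; rewrite Htor// !mxE summxE.
by under eq_bigr do rewrite mxE.
Qed.

Let dnuc i c t : I t -> dI I (fun s => nu i s 0 c) t (- ell i t * mu t 0 c).
Proof. by move=> It; have := @row_dI _ _ c (snu i) It; rewrite dnu// mxE. Qed.

Definition speed_along (c : 'rV[R]_p.-1) (r t : R) : R := sm_a x t + r * \sum_i c 0 i * dslope I kappa ell i t.

Local Notation g := (directrix f (sm_tau x) kappa nu ell).

Lemma smooth_directrix c r : smooth I (g c r).
Proof.
apply/(row_smoothP I_limpt) => j.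
apply: (smooth_ext I_limpt (f := fun t => f t 0 j +
    r * \sum_i c 0 i * (slope kappa ell i t * T j t + nu i t 0 j))).
  move=> t It; rewrite /directrix !mxE summxE; congr (_ + _ * _); apply: eq_bigr => i _.
  by rewrite !mxE.
have sM (h k : R -> R) : smooth I h -> smooth I k -> smooth I (fun s => h s * k s) by exact: smooth_mul.
have sA (h k : R -> R) : smooth I h -> smooth I k -> smooth I (fun s => h s + k s) by exact: smooth_add.
apply: (sA _ _ ((row_smoothP I_limpt f).1 sf j)); apply: (sM _ _ (smooth_cst I_limpt r)).
apply: smooth_sum => [|i]; first exact: I_limpt.
apply: (sM _ _ (smooth_cst I_limpt (c 0 i))).
by apply: (sA _ _ (sM _ _ (ssl i) (sT j))); exact: (row_smoothP I_limpt (nu i)).1 (snu i) j.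
Qed.

(** The components along mu cancel: slope i makes the derivative of (slope i) tau compensate
    that of nu_i. *)
Lemma directrix_velocity c r t : I t -> derive_in I (g c r) t = speed_along c r t *: sm_tau x t.
Proof.
move=> It; apply/rowP => j.
rewrite (row_derive_in I_limpt _ It (smooth_derivable (smooth_directrix c r) It)).
apply: (derive_inE I_limpt It).
apply: (dI_ext (f := fun t => f t 0 j +
    r * \sum_i c 0 i * (slope kappa ell i t * T j t + nu i t 0 j))) => //.
  move=> s Is; rewrite /directrix !mxE summxE; congr (_ + _ * _); apply: eq_bigr => i _.
  by rewrite !mxE.
have -> : (speed_along c r t *: sm_tau x t) 0 j = (derive_in I f t) 0 j +
    r * \sum_i c 0 i * ((dslope I kappa ell i t * T j t + slope kappa ell i t * (kappa t * mu t 0 j))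
      + (- ell i t * mu t 0 j)).
  rewrite Hf.2// !mxE /speed_along mulrDl; congr (_ + _).
  rewrite -mulrA mulr_suml; congr (_ * _); apply: eq_bigr => i _.
  have -> : ell i t = slope kappa ell i t * kappa t by rewrite /slope divfK ?k0.
  by rewrite /T /tcomp; ring.
apply: dI_add; first exact: row_dI.
apply: dI_scale; apply: dI_sum => i; apply: dI_scale; apply: dI_add; last exact: dnuc.
by apply: dI_mul; [exact: dI_smooth (ssl i) It|exact: dT].
Qed.

(** The numbers that the minors of theta depend on; up to a factor a^2 they are the derivatives
    of dslope i / a. *)
Definition uvec i t : R := sm_a x t * derive_in I (dslope I kappa ell i) t
  - derive_in I (sm_a x) t * dslope I kappa ell i t.

Lemma smooth_frame_dslope i : smooth I (dslope I kappa ell i). Proof. exact: sv. Qed.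

Lemma smooth_uvec i : smooth I (uvec i).
Proof.
apply: smooth_add; [exact: I_limpt|apply: smooth_mul; [exact: I_limpt|exact: sa|]|].
  by apply: smooth_derive; exact: sv.
apply: smooth_opp; [exact: I_limpt|apply: smooth_mul; [exact: I_limpt| |exact: sv]].
by apply: smooth_derive; exact: sa.
Qed.

(** The minors are combinations of the numbers uvec i with smooth coefficients, so that they
    vanish with them, and to second order if these do. *)
Lemma theta_uvec (kk : triple p) : exists M : 'I_p.-1 -> R -> R,
  (forall i, smooth I (M i)) /\
  forall t, I t -> theta x kk t = \sum_i uvec i t * M i t.
Proof.
have [M [sM ME]] := frame_theta I_limpt sT (fun c => (row_smoothP I_limpt mu).1 smu c)
  (fun i c => (row_smoothP I_limpt (nu i)).1 (snu i) c) sk sl k0 dT dmu dnuc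
  (fun t It => mu_unit It) (fun t It => mu_tau It) (fun i t It => etrans (dotC _ _) (nu_mu i It)) kk.
exists M; split=> // t It; have := ME t (sm_a x t) (derive_in I (sm_a x) t) It.
by rewrite /theta /theta1 /theta0 /speed2 /accel jt.unlock.
Qed.

Lemma uvec_simple : simple_theta x ->
  forall t, I t -> exists i, uvec i t != 0 \/ derive_in I (uvec i) t != 0.
Proof.
move=> sx t It; apply: contrapT => none.
have u0 i : uvec i t = 0.
  by apply/eqP; apply: contraT => h; exfalso; apply: none; exists i; left.
have u1 i : derive_in I (uvec i) t = 0.
  by apply/eqP; apply: contraT => h; exfalso; apply: none; exists i; right.
have [kk] := sx t It; have [M [sM ME]] := theta_uvec kk.
have -> : derive_in I (theta x kk) t =
    \sum_i (derive_in I (uvec i) t * M i t + uvec i t * derive_in I (M i) t).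
  apply: (derive_inE I_limpt It).
  apply: (dI_ext (f := fun t => \sum_i uvec i t * M i t)) => //.
    by move=> s Is; rewrite ME.
  by apply: dI_sum => i; apply: dI_mul; apply: dI_smooth => //; exact: smooth_uvec.
rewrite ME// big1 => [|i _]; last by rewrite u0 mul0r.
by rewrite big1 ?eqxx => [[]//|i _]; rewrite u0 u1 !mul0r addr0.
Qed.

Lemma uvec_off_flex : theta_off_flex x ->
  forall t, I t -> wr I p.+1 (cf x) t = 0 -> exists i, uvec i t != 0.
Proof.
move=> sx t It D0; case: (sx t It) => [/eqP//|[kk]].
have [M [sM ME]] := theta_uvec kk; rewrite ME// => s0.
apply: contrapT => none; move/eqP: s0; apply; rewrite big1// => i _.
have [->|h] := eqVneq (uvec i t) 0; first by rewrite mul0r.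
by exfalso; apply: none; exists i.
Qed.

End Directrix.

(** * Loci in the plane of parameters *)

(** A Wronskian of order two: it vanishes where some member of the pencil a + r w, or w itself,
    has a multiple zero. *)
Definition bracket {R : realType} (I : set R) (a w : R -> R) t : R :=
  a t * derive_in I w t - derive_in I a t * w t.

Definition pencil {R : realType} (a w : R -> R) (r t : R) : R := a t + r * w t.

Section Loci.
Context {R : realType} (I : set R).
Hypothesis I_interval : is_interval I.
Hypothesis I_nondeg : exists u v, [/\ I u, I v & u < v].
Let I_limpt : limpt I := interval_limpt I_interval I_nondeg.
Variables a w D : R -> R.
Hypotheses (sa : smooth I a) (sw : smooth I w) (sD : smooth I D).
Let E := bracket I a w.
Hypotheses (E_simple : forall t, I t -> E t != 0 \/ derive_in I E t != 0)
  (E_off_D : forall t, I t -> D t = 0 -> E t != 0)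
  (D_simple : forall t, I t -> D t != 0 \/ derive_in I D t != 0).

Let b := pencil a w.
Let b1 r t := derive_in I a t + r * derive_in I w t.

(** Capped at two; this is the order of vanishing by order_low and order_top. *)
Definition order r t : nat :=
  if b r t != 0 then 0%N else if b1 r t != 0 then 1%N else 2.

Let smooth_pencil r : smooth I (b r).
Proof.
apply: smooth_add; [exact: I_limpt|exact: sa|].
by apply: smooth_mul; [exact: I_limpt|exact: smooth_cst|exact: sw].
Qed.

Let db r t : I t -> dI I (b r) t (b1 r t).
Proof. by move=> It; apply: dI_add; [exact: dI_smooth|apply: dI_scale; exact: dI_smooth]. Qed.

Let db1 r t : I t ->
  dI I (b1 r) t (derive_in I (derive_in I a) t + r * derive_in I (derive_in I w) t).
Proof.
by move=> It; apply: dI_add; [|apply: dI_scale]; apply: dI_smooth => //; exact: smooth_derive.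
Qed.

Let sE : smooth I E.
Proof.
apply: smooth_add; [exact: I_limpt| |].
  by apply: smooth_mul; [exact: I_limpt|exact: sa|exact: smooth_derive].
apply: smooth_opp; [exact: I_limpt|].
by apply: smooth_mul; [exact: I_limpt|exact: smooth_derive|exact: sw].
Qed.

Let dE t : I t -> derive_in I E t =
  a t * derive_in I (derive_in I w) t - derive_in I (derive_in I a) t * w t.
Proof.
move=> It; apply: (derive_inE I_limpt It).
have dd g : smooth I g -> dI I (derive_in I g) t (derive_in I (derive_in I g) t).
  by move=> sg; apply: dI_smooth => //; exact: smooth_derive.
have := dI_add (dI_mul (dI_smooth sa It) (dd _ sw))
  (dI_scale (c := -1) (dI_mul (dd _ sa) (dI_smooth sw It))).
have -> : (fun s => a s * derive_in I w s + -1 * (derive_in I a s * w s)) = E.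
  by apply/funext => s; rewrite mulN1r.
congr (dI I E t _).
by move: (derive_in I w t) (derive_in I a t) (derive_in I (derive_in I w) t)
  (derive_in I (derive_in I a) t) => *; ring.
Qed.

(** If a and w vanished together, so would the bracket E and its derivative. *)
Let w_neq0 r t : I t -> b r t = 0 -> w t != 0.
Proof.
move=> It b0; apply/eqP => w0.
have a0 : a t = 0 by move: b0; rewrite /b /pencil w0 mulr0 addr0.
by case: (E_simple It); rewrite ?dE// ?/E ?/bracket a0 w0 !(mul0r, mulr0) subr0 eqxx.
Qed.

Let EE r t : b r t = 0 -> E t = - w t * b1 r t.
Proof. by rewrite /b /E /b1 /bracket /pencil => /eqP; rewrite addr_eq0 => /eqP ->; ring. Qed.

(** At a zero of b one has E = - w b'. *)
Lemma order2_D r t : I t -> order r t = 2 -> D t != 0.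
Proof.
rewrite /order => It; case: eqP => //= b0; case: eqP => //= b10 _.
apply/eqP => D0; have := E_off_D It D0; by rewrite (EE b0) b10 mulr0 eqxx.
Qed.

Lemma order_low r t j : I t -> (j < order r t)%N -> deriven_in I j (b r) t = 0.
Proof.
rewrite /order => It; case: eqP => //= b0; case: eqP => /= [b10|_]; last by case: j.
case: j => [//|[|//]] _ /=; exact: etrans (derive_inE I_limpt It (db It)) b10.
Qed.

(** If b and b' vanish so does E, whose derivative is then - w b''. *)
Lemma order_top r t : I t -> deriven_in I (order r t) (b r) t != 0.
Proof.
move=> It; rewrite /order; have [b0|//] := eqVneq (b r t) 0.
have [b10|b10] /= := eqVneq (b1 r t) 0; last by rewrite (derive_inE I_limpt It (db It)).
have -> : derive_in I (derive_in I (b r)) t =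
    derive_in I (derive_in I a) t + r * derive_in I (derive_in I w) t.
  apply: (derive_inE I_limpt It); apply: (dI_ext (f := b1 r)) => //; last exact: db1.
  by move=> s Is; rewrite (derive_inE I_limpt Is (db Is)).
case: (E_simple It); first by rewrite (EE b0) b10 mulr0 eqxx.
rewrite dE//; move: b0; rewrite /b /pencil => /eqP; rewrite addr_eq0 => /eqP ->.
apply: contraNneq => /eqP; rewrite addr_eq0 => /eqP ->.
by apply/eqP; ring.
Qed.

Definition locus m d : set (R * R) :=
  [set tr | [/\ I tr.1, order tr.2 tr.1 = m & (D tr.1 == 0) = d]].

Let near_neq0 (g : R -> R) t0 : smooth I g -> I t0 -> g t0 != 0 ->
  exists2 d, 0 < d & forall s, I s -> `|s - t0| < d -> g s != 0.
Proof.
move=> sg It g0; have [|d d0 H] := dI_cont (dI_smooth sg It) (e := `|g t0|).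
  by rewrite normr_gt0.
exists d => // s Is sd; apply/eqP => gs; have := H s Is sd.
by rewrite gs sub0r normrN ltxx.
Qed.

Let pencil_near t0 r0 : I t0 -> b r0 t0 != 0 -> exists2 d, 0 < d &
  forall s r, I s -> `|s - t0| < d -> `|r - r0| < d -> b r s != 0.
Proof.
move=> It b0; pose e := `|b r0 t0| / 2; have e0 : 0 < e by rewrite divr_gt0// normr_gt0.
have [d1 d10 H1] := dI_cont (dI_smooth (smooth_pencil r0) It) e0.
have [d2 d20 H2] := dI_cont (dI_smooth sw It) ltr01.
have W0 : 0 < `|w t0| + 1 by rewrite ltr_wpDl.
exists (Order.min (Order.min d1 d2) (e / (`|w t0| + 1))).
  by rewrite !lt_min d10 d20 divr_gt0.
move=> s r Is; rewrite !lt_min => /andP[/andP[s1 s2] _] /andP[_ rr].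
have ws : `|w s| < `|w t0| + 1.
  rewrite -ltrBlDl; apply: le_lt_trans (H2 s Is s2); exact: lerB_dist.
apply/eqP => bs.
have A1 := H1 s Is s1.
have A2 : `|(r - r0) * w s| < e.
  rewrite normrM; apply: le_lt_trans (ler_wpM2l (normr_ge0 _) (ltW ws)) _.
  by rewrite -ltr_pdivlMr.
have := ler_normD (b r0 t0 - b r0 s) (b r0 s - b r s).
rewrite subrKA bs subr0 leNgt => /negP; apply.
have -> : `|b r0 t0| = e + e by rewrite /e -splitr.
rewrite ltrD//; first by rewrite distrC.
have -> : b r0 s - 0 = b r0 s - b r s by rewrite bs.
by rewrite -normrN (_ : - _ = (r - r0) * w s)// /b /pencil; ring.
Qed.

Lemma codim_order0 : has_codim I 0 (locus 0 false).
Proof.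
move=> t0 r0 [/= It]; rewrite /order; case: ifP => [b0 _|_]; last by case: ifP.
move/negbT => D0; split=> //.
have [d1 d10 H1] := pencil_near It b0; have [d2 d20 H2] := near_neq0 sD It D0.
exists (ball t0 (Order.min d1 d2)), (ball r0 d1); split; try exact: ball_open.
- by apply: ballxx; rewrite lt_min d10.
- exact: ballxx.
apply/seteqP; split=> [[t r] [[/= It' _ _] [? ?]]//|[t r] [[/= It' tA] rB]].
split; last by split.
move: tA rB; rewrite /ball /= distrC lt_min => /andP[t1 t2]; rewrite distrC => rr.
by split=> //=; [rewrite /order H1|apply/negbTE; exact: H2].
Qed.

(** The vertical lines over the zeros of D, which are isolated. *)
Lemma codim_order0_flex : has_codim I 1 (locus 0 true).
Proof.
move=> t0 r0 [/= It]; rewrite /order; case: ifP => [b0 _|_]; last by case: ifP.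
move/eqP => D0; split=> //.
have [d1 d10 H1] := pencil_near It b0.
have D1 : derive_in I D t0 != 0 by case: (D_simple It) => //; rewrite D0 eqxx.
have [d2 d20 H2] := simple_zero_isolated (dI_smooth sD It) D0 D1.
exists (ball t0 d2), (ball r0 d1); split; try exact: ball_open; try exact: ballxx.
have limB : limpt (ball r0 d1).
  rewrite -[ball _ _]setTI; apply: limptI; last exact: ball_open.
  apply: interval_limpt => //; exists 0, 1; split=> //; exact: ltr01.
right; exists (fun=> t0); split.
- by apply/smoothP; exact: smooth_cst.
- by move=> r _; split=> //; exact: ballxx.
apply/seteqP; split=> [[t r] [[/= It' _ /eqP Dt] [tA rB]]|_ [r rB <-]].
  have <- : t = t0 by apply: H2 => //; rewrite distrC.
  by exists r.
split; last by split=> //; exact: ballxx.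
split=> //=; last by rewrite D0 eqxx.
by rewrite /order H1// ?subrr ?normr0// distrC.
Qed.

(** Since w does not vanish on the zero locus of the pencil, this locus is the graph of
    r = - a / w; on it the order is one exactly where E is nonzero. *)
Lemma codim_order1 : has_codim I 1 (locus 1 false).
Proof.
move=> t0 r0 [/= It]; rewrite /order; case: eqP => //= b0; case: ifP => // b10 _.
move/negbT => D0; split=> //.
have w0 := w_neq0 It b0.
have E0 : E t0 != 0 by rewrite (EE b0) mulf_neq0// oppr_eq0.
have [d1 d10 H1] := near_neq0 sw It w0; have [d2 d20 H2] := near_neq0 sD It D0.
have [d3 d30 H3] := near_neq0 sE It E0.
pose A := ball t0 (Order.min d1 (Order.min d2 d3)).
have HA t : (I `&` A) t -> [/\ w t != 0, D t != 0 & E t != 0].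
  move=> [It' ]; rewrite /A /ball /= distrC !lt_min => /and3P[t1 t2 t3].
  by split; [exact: H1|exact: H2|exact: H3].
exists A, setT; split=> //; [exact: ball_open|exact: openT| |].
  by apply: ballxx; rewrite !lt_min d10 d20.
have limA : limpt (I `&` A) by apply: limptI => //; exact: ball_open.
have IA : I `&` A `<=` I by move=> t [].
left; exists (fun t => - a t * (w t)^-1); split=> //.
- apply/smoothP; apply: smooth_mul; [exact: limA| |].
    by apply: smooth_opp; [exact: limA|exact: (smooth_sub limA IA sa)].
  apply: smooth_inv; [exact: limA|exact: (smooth_sub limA IA sw)|].
  by move=> t /HA[].
apply/seteqP; split=> [[t r] [[/= It' ot Dt] [tA _]]|_ [t IAt <-]].
  have [wt _ _] := HA t (conj It' tA).
  exists t => //; congr (_, _); move: ot; rewrite /order; case: eqP => //= bt _.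
  apply: (mulIf wt); rewrite mulfVK//; apply/eqP; move/eqP: bt.
  by rewrite /b /pencil addr_eq0 => /eqP->; rewrite opprK.
have [wt Dt Et] := HA t IAt.
have bt : b (- a t * (w t)^-1) t = 0 by rewrite /b /pencil mulfVK// subrr.
split; last by split=> //; case: IAt.
split=> /=; [by case: IAt| |exact/negbTE].
rewrite /order bt eqxx /= ifT//; apply: contraNneq Et => b1t.
by rewrite (EE bt) b1t mulr0.
Qed.

Let unique_r r r0 t0 : I t0 -> b r0 t0 = 0 -> b r t0 = 0 -> r = r0.
Proof.
move=> It b0 b'0; apply: (mulIf (w_neq0 It b0)); apply: (addrI (a t0)).
exact: etrans b'0 (esym b0).
Qed.

(** Isolated points: t0 is an isolated zero of D, and b determines r. *)
Lemma codim_order1_flex : has_codim I 2 (locus 1 true).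
Proof.
move=> t0 r0 [/= It]; rewrite /order; case: eqP => //= b0; case: ifP => // b10 _.
move/eqP => D0; split=> //.
have D1 : derive_in I D t0 != 0 by case: (D_simple It) => //; rewrite D0 eqxx.
have [d d0 H] := simple_zero_isolated (dI_smooth sD It) D0 D1.
exists (ball t0 d), setT; split=> //; [exact: ball_open|exact: openT|exact: ballxx|].
apply/seteqP; split=> [[t r] [[/= It' ot /eqP Dt] [tA _]]|_ ->].
  have tt : t = t0 by apply: H => //; rewrite distrC.
  move: ot; rewrite tt /order; case: eqP => //= bt _.
  by rewrite (unique_r It b0 bt).
split; last by split=> //; exact: ballxx.
by split=> //=; [rewrite /order b0 eqxx /= b10|rewrite D0 eqxx].
Qed.

(** Isolated points: t0 is an isolated zero of E, and b determines r. *)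
Lemma codim_order2 : has_codim I 2 (locus 2 false).
Proof.
move=> t0 r0 [/= It]; rewrite /order; case: eqP => //= b0; case: eqP => //= b10 _ D0.
split=> //.
have E0 : E t0 = 0 by rewrite (EE b0) b10 mulr0.
have E1 : derive_in I E t0 != 0 by case: (E_simple It) => //; rewrite E0 eqxx.
have [d d0 H] := simple_zero_isolated (dI_smooth sE It) E0 E1.
exists (ball t0 d), setT; split=> //; [exact: ball_open|exact: openT|exact: ballxx|].
apply/seteqP; split=> [[t r] [[/= It' ot Dt] [tA _]]|_ ->].
  move: ot; rewrite /order; case: eqP => //= bt; case: eqP => //= b1t _.
  have tt : t = t0 by apply: H => //; [rewrite distrC|rewrite (EE bt) b1t mulr0].
  by move: bt; rewrite tt => bt; rewrite (unique_r It b0 bt).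
split; last by split=> //; exact: ballxx.
by split=> //=; rewrite /order b0 b10 eqxx.
Qed.

End Loci.

(** * Types of the directrices of generic parallels *)

Section TypesAlongParallels.
Context {R : realType} (p : nat) (I : set R).
Hypothesis p_ge2 : (2 <= p)%N.
Hypothesis I_interval : is_interval I.
Hypothesis I_nondeg : exists u v, [/\ I u, I v & u < v].
Let I_limpt : limpt I := interval_limpt I_interval I_nondeg.

Lemma wr_rows (x : smooth_RxS p I) t : I t ->
  \det (\matrix_(i < p.+1) (deriven_in I i (sm_tau x) t : 'rV_p.+1)) = wr I p.+1 (cf x) t.
Proof.
move=> It; congr (\det _); apply/matrixP => i c; rewrite !mxE cf_ord.
exact: (row_deriven I_limpt _ c (smooth_sm_tau x) It).
Qed.

Lemma wr1_rows (x : smooth_RxS p I) t : I t ->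
  \det (\matrix_(i < p.+1)
    (deriven_in I (if i == p :> nat then p.+1 else i) (sm_tau x) t : 'rV_p.+1)) =
  derive_in I (wr I p.+1 (cf x)) t.
Proof.
move=> It; rewrite (derive_wr I_limpt p (smooth_cf I_interval I_nondeg x) It).
congr (\det _); apply/matrixP => i c; rewrite !mxE cf_ord.
exact: (row_deriven I_limpt _ c (smooth_sm_tau x) It).
Qed.

Lemma regular_no_inflection (x : smooth_RxS p I) t : simple_wr p.+1 x ->
  ~ inflection I (sm_tau x) t.
Proof.
move=> sx [It d0]; have := speed2_gt0 I_interval I_nondeg p_ge2 sx It.
rewrite /speed2 big1 ?ltxx// => c _.
rewrite jt.unlock -(row_deriven I_limpt 1 c (smooth_sm_tau x) It) [deriven_in _ _ _]/=.
by rewrite d0 mxE expr0n.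
Qed.

(** The type of a directrix whose speed vanishes to the order m, where d tells whether the last
    Wronskian of tau vanishes. *)
Definition type_of (m : nat) (d : bool) : seq nat := rcons (iota m.+1 p) (d + m.+1 + p)%N.

Lemma type_of_inj m d m' d' : type_of m d = type_of m' d' -> m = m' /\ d = d'.
Proof.
move=> H; have := congr1 (nth 0%N ^~ 0%N) H; have := congr1 (last 0%N) H.
rewrite /type_of !last_rcons; case: p p_ge2 => //= n _ /eqP E [mm]; split=> //.
by move: E; rewrite mm !eqn_add2r => /eqP; case: d d' {H} => [] [].
Qed.

Variables (x : smooth_RxS p I) (f : R -> 'rV[R]_p.+1).
Hypothesis xreg : regular x.
Variables (mu : R -> 'rV[R]_p.+1) (kappa : R -> R).
Variables (nu : 'I_p.-1 -> R -> 'rV[R]_p.+1) (ell : 'I_p.-1 -> R -> R).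
Hypotheses (Hf : frontal I f (sm_a x) (sm_tau x))
  (Hpn : principal_normal I (sm_tau x) mu kappa)
  (Hnp : normally_parallel_frame I (sm_tau x) mu nu)
  (Htor : torsion I (sm_tau x) mu kappa nu ell).

Let D := wr I p.+1 (cf x).
Let a := sm_a x.
Let w (c : 'rV[R]_p.-1) t := \sum_i c 0 i * dslope I kappa ell i t.
Let E c := bracket I a (w c).
Let u := uvec x kappa ell.

Let sD : smooth I D. Proof. by apply: smooth_wr => // c; exact: smooth_cf. Qed.
Let sa : smooth I a := smooth_sm_a x.
Let su i : smooth I (u i) := smooth_uvec I_interval I_nondeg Hpn Hnp Htor i.
Let sv i : smooth I (dslope I kappa ell i) := smooth_frame_dslope I_interval I_nondeg Hpn Hnp Htor i.
Let sw c : smooth I (w c).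
Proof.
apply: smooth_sum => [|i]; first exact: I_limpt.
by apply: smooth_mul; [exact: I_limpt|exact: smooth_cst|exact: sv].
Qed.
Let D_simple t : I t -> D t != 0 \/ derive_in I D t != 0.
Proof. by have [[sx _] _] := xreg; exact: sx. Qed.

Let EE c t : I t -> E c t = \sum_i c 0 i * u i t.
Proof.
move=> It; rewrite /E /bracket (_ : derive_in I (w c) t =
    \sum_i c 0 i * derive_in I (dslope I kappa ell i) t); last first.
  by apply: (derive_inE I_limpt It); apply: dI_sum => i; apply: dI_scale; exact: dI_smooth.
by rewrite /w !mulr_sumr -sumrB; apply: eq_bigr => i _; rewrite /u /uvec mulrBr !(mulrCA (c 0 i)).
Qed.

Let dE c t : I t -> derive_in I (E c) t = \sum_i c 0 i * derive_in I (u i) t.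
Proof.
move=> It; apply: (derive_inE I_limpt It).
apply: (dI_ext (f := fun t => \sum_i c 0 i * u i t)) => // [s Is|]; first by rewrite EE.
by apply: dI_sum => i; apply: dI_scale; exact: dI_smooth.
Qed.

Definition generic (c : 'rV[R]_p.-1) : Prop :=
  (forall t, I t -> E c t != 0 \/ derive_in I (E c) t != 0) /\
  (forall t, I t -> D t = 0 -> E c t != 0).

(** The bracket E is the linear form c |-> <c,u>. Where u is nonzero the affine family E has
    simple zeros for generic c. Where u vanishes its derivative does not, and E' is nonzero for
    c off one hyperplane for each zero; likewise E for each zero of D. *)
Lemma residual_generic : residual generic.
Proof.
have [[_ th] off] := xreg.
have r1 := @affine_simple_zeros _ _ I_interval I_nondeg unit 1 p.-1 (fun=> fun=> 0) (fun=> fun=> u)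
  (fun=> smooth_cst I_limpt 0) (fun _ _ => su).
have r2 := @residual_linear_form _ _ I_interval I_nondeg p.-1 'I_p.-1 u
  (fun i => derive_in I (u i)) (fun _ => fun=> 0) (fun _ t => \row_l derive_in I (u l) t)
  (fun i t => dI_smooth (su i)).
have r3 := @residual_linear_form _ _ I_interval I_nondeg p.-1 unit (fun=> D)
  (fun=> derive_in I D) (fun _ => fun=> 0) (fun _ t => \row_l u l t)
  (fun _ t => dI_smooth sD).
have dotE c (g : 'I_p.-1 -> R) : dot c (\row_l g l) = \sum_i c 0 i * g i.
  by apply: eq_bigr => i _; rewrite mxE.
apply: residualS (residualI (residualI r1 r2) r3) => c [[/= c1 c2] c3]; split=> t It.
  rewrite EE// dE//; have [[i ui]|u0] := pselect (exists i, u i t != 0).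
    have [k] := c1 t It (ex_intro _ tt (ex_intro _ ord0 (ex_intro _ i ui))).
    have dc : derive_in I (fun=> 0 : R) t = 0 by apply: derive_inE => //; exact: dI_cst.
    by rewrite /affine_family !big_ord1 dc !add0r.
  have {}u0 i : u i t = 0.
    by apply/eqP; apply: contraT => h; exfalso; apply: u0; exists i.
  have [i [|ui]] := uvec_simple I_interval I_nondeg Hpn Hnp Htor th It.
    by rewrite -/u u0 eqxx.
  right; rewrite -dotE -[dot _ _]add0r; apply: (c2 i t It (u0 i) ui).
  by apply/eqP => /rowP/(_ i); rewrite !mxE => h; move: ui; rewrite -/u h eqxx.
move=> D0; rewrite EE// -dotE -[dot _ _]add0r; apply: (c3 tt t It D0).
  by case: (D_simple It) => //; rewrite D0 eqxx.
have [i ui] := uvec_off_flex I_interval I_nondeg Hpn Hnp Htor off It D0.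
by apply/eqP => /rowP/(_ i); rewrite !mxE => h; move: ui; rewrite -/u h eqxx.
Qed.

Let g (c : 'rV[R]_p.-1) := directrix f (sm_tau x) kappa nu ell c.

Lemma type_at c r t : generic c -> I t ->
  has_type I (g c r) t (type_of (order I a (w c) r t) (D t == 0)).
Proof.
move=> [c1 c2] It.
have sb r' : smooth I (pencil a (w c) r').
  apply: smooth_add; [exact: I_limpt|exact: sa|].
  by apply: smooth_mul; [exact: I_limpt|exact: smooth_cst|exact: sw].
have sg := smooth_directrix I_interval I_nondeg Hf Hpn Hnp Htor c r.
have dg t' : I t' -> derive_in I (g c r) t' = pencil a (w c) r t' *: sm_tau x t'.
  by move=> It'; exact: (directrix_velocity I_interval I_nondeg Hf Hpn Hnp Htor c r It').
have low := order_low I_interval I_nondeg sa (sw c) It.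
have top := order_top I_interval I_nondeg sa (sw c) c1 r It.
have [D0|D0] := eqVneq (D t) 0.
  apply: (type_flex I_limpt sg (smooth_sm_tau x) (sb r) dg It (low r) top).
    by rewrite wr_rows.
  by rewrite wr1_rows//; case: (D_simple It) => //; rewrite D0 eqxx.
apply: (type_nondegenerate I_limpt sg (smooth_sm_tau x) (sb r) dg It (low r) top).
by rewrite wr_rows.
Qed.

Let order_le c r t : (order I a (w c) r t <= 2)%N.
Proof. by rewrite /order; case: ifP => // _; case: ifP. Qed.

Lemma type_in_table c r t : generic c -> I t ->
  exists2 e, e \in type_table p & has_type I (g c r) t e.1.
Proof.
move=> gc It; have ty := type_at r gc It; have le2 := order_le c r t.
have two := order2_D gc.2 (r := r) It.
pose m := order I a (w c) r t; pose d := D t == 0.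
exists (type_of m d, (m + d)%N) => //.
move: two le2; rewrite -/m -/D -[D t != 0]/(~~ d) !inE.
case: m => [|[|[|//]]] + _; case: d => //; first 4 last.
  by move/(_ erefl).
all: by move=> _; rewrite /type_of /= ?eqxx ?orbT.
Qed.

Lemma type_locus c m d : generic c ->
  [set tr : R * R | I tr.1 /\ has_type I (g c tr.2) tr.1 (type_of m d)] = locus I a (w c) D m d.
Proof.
move=> gc; apply/seteqP; split=> [[t r] [/= It ty]|[t r] [/= It <- <-]].
  by have [mE dE'] := type_of_inj (has_type_uniq ty (type_at r gc It)); split=> //=.
by split=> //; exact: type_at.
Qed.

Lemma type_codim c e : generic c -> e \in type_table p ->
  has_codim I e.2 [set tr : R * R | I tr.1 /\ has_type I (g c tr.2) tr.1 e.1].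
Proof.
move=> gc; rewrite !inE.
have L (m k : nat) (d : bool) : has_codim I k (locus I a (w c) D m d) ->
    has_codim I k [set tr : R * R | I tr.1 /\ has_type I (g c tr.2) tr.1 (type_of m d)].
  by rewrite type_locus.
case/or4P => [/eqP->|/eqP->|/eqP->|/orP[]/eqP->].
- apply: (L 0%N 0%N false); exact: codim_order0.
- apply: (L 0%N 1%N true); exact: codim_order0_flex.
- apply: (L 1%N 1%N false); exact: (codim_order1 I_interval I_nondeg sa (sw c) sD gc.1).
- apply: (L 1%N 2%N true); exact: (codim_order1_flex I_interval I_nondeg sa (sw c) sD gc.1 D_simple).
- apply: (L 2%N 2%N false); exact: (codim_order2 I_interval I_nondeg sa (sw c) gc.1).
Qed.

End TypesAlongParallels.

Theorem theorem3p5 (R : realType) (p : nat) (p_ge2 : (2 <= p)%N)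
    (I : set R) (I_interval : is_interval I)
    (I_nondegenerate : exists u v, [/\ I u, I v & u < v]) :
  exists U : set (smooth_RxS p I),
    [/\ open U, dense U &
      forall x : smooth_RxS p I, U x ->
      forall f : R -> 'rV[R]_p.+1, frontal I f (sm_a x) (sm_tau x) ->
        (forall t, ~ inflection I (sm_tau x) t) /\
        forall (mu : R -> 'rV[R]_p.+1) (kappa : R -> R)
          (nu : 'I_p.-1 -> R -> 'rV[R]_p.+1) (ell : 'I_p.-1 -> R -> R),
          principal_normal I (sm_tau x) mu kappa ->
          normally_parallel_frame I (sm_tau x) mu nu ->
          torsion I (sm_tau x) mu kappa nu ell ->
          exists G : set 'rV[R]_p.-1, residual G /\
            forall c : 'rV[R]_p.-1, G c ->
              let g := directrix f (sm_tau x) kappa nu ell c in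
              (forall t r, I t ->
                 exists2 e, e \in type_table p & has_type I (g r) t e.1) /\
              (forall e, e \in type_table p ->
                 has_codim I e.2
                   [set tr : R * R | I tr.1 /\ has_type I (g tr.2) tr.1 e.1])].
Proof.
exists (regular (p := p) (I := I)); split.
- exact: open_regular.
- exact: dense_regular.
move=> x xreg f Hf; split=> [t|mu kappa nu ell Hpn Hnp Htor].
  by apply: regular_no_inflection => //; case: xreg => [[]].
exists (generic x kappa ell); split; first exact: (residual_generic I_interval I_nondegenerate xreg Hpn Hnp Htor).
move=> c gc g; split=> [t r It|e et].
  exact: (type_in_table I_interval I_nondegenerate xreg Hf Hpn Hnp Htor r gc It).
exact: (type_codim p_ge2 I_interval I_nondegenerate xreg Hf Hpn Hnp Htor gc et).
Qed.
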